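(* Let $s\ge 0$ be a real number and let $\omega=(\omega(n))_{n\in\mathbb{Z}}$ be a weight such that $\omega(n)=(1+n)^s$ for all $n\ge 0$, such that the sequence $\left(\frac{\omega(-n)}{(1+n)^s}\right)_{n\ge 0}$ is non-decreasing, and such that for every $\varepsilon>0$, $\omega(-n)=O(e^{\varepsilon\sqrt n})$ as $n\to+\infty$. Let $I$ be a closed ideal of $A_\omega(\mathbb{T})$ such that $h^0(I)$ is (at most) countable. Then $$I=\Big\{f\in A_\omega(\mathbb{T}) : f^{(j)}=0 \text{ on } h^j(I)\quad (0\le j\le [s])\Big\}.$$
   Context: $\mathbb{T}$ is the unit circle of $\mathbb{C}$; $[s]$ is the integer part of $s$. A weight is a sequence $\omega=(\omega(n))_{n\in\mathbb{Z}}$ of reals with $\omega(n)\ge 1$ and $\omega(m+n)\le\omega(m)\omega(n)$ for all $m,n\in\mathbb{Z}$. For a weight $\omega$, $$A_\omega(\mathbb{T})=\Big\{f\in\mathcal{C}(\mathbb{T}) : \|f\|_\omega=\sum_{n=-\infty}^{+\infty}|\hat f(n)|\,\omega(n)<+\infty\Big\},$$ where $\hat f(n)$ is the $n$-th Fourier coefficient of $f$; it is a commutative Banach algebra under pointwise multiplication. Under the hypotheses on $\omega$, $A_\omega(\mathbb{T})\subset\mathcal{C}^{[s]}(\mathbb{T})$. Derivatives are taken with respect to the variable $z\in\mathbb{T}$, i.e. $\widehat{f'}(n)=(n+1)\hat f(n+1)$. For a closed ideal $I$ and $0\le k\le[s]$, $$h^k(I)=\{z\in\mathbb{T} : f(z)=\dots=f^{(k)}(z)=0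 \text{ for all } f\in I\}.$$ *)

(* Defs.v *)
From HB Require Import structures.
From mathcomp Require Import all_boot all_order all_algebra.
From mathcomp Require Import complex.
From mathcomp Require Import all_classical all_reals all_analysis.

Set Implicit Arguments.
Unset Strict Implicit.
Unset Printing Implicit Defensive.

Import Order.TTheory GRing.Theory Num.Theory.
Import numFieldNormedType.Exports.

Local Open Scope classical_set_scope.
Local Open Scope ring_scope.
Local Open Scope complex_scope.

(* [R[i]] with the topology and norm of the numeric field [R[i]], which the library
   attaches to the regular module [R[i]^o]. *)
HB.instance Definition _ (R : realType) := NormedModule.copy R[i] R[i]^o.

Section BeurlingAlgebra.
Context {R : realType}.
Implicit Types omega : int -> R.

Definition circle : set R[i] := [set z | `|z| = 1].

Fact expi_circle (t : R) : cos t +i* sin t \in circle.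
Proof. by rewrite inE /circle /= normc_def /= cos2Dsin2 sqrtr1. Qed.

Definition expi (t : R) : circle :=
  exist (fun z => z \in circle) _ (expi_circle t).

Definition weight omega : Prop :=
  (forall n, 1 <= omega n) /\ (forall m n, omega (m + n) <= omega m * omega n).

(* hat f (n) = (2 pi)^-1 \int_0^(2 pi) f (e^(it)) e^(-int) dt, the integral of a
   complex-valued function being taken componentwise. *)
Definition fourier_coef (f : circle -> R[i]) (n : int) : R[i] :=
  let g t := f (expi t) * set_val (expi (- (n%:~R * t))) in
  ((2 * pi)^-1)%:C *
    ((\int[lebesgue_measure]_(t in `[0, 2 * pi]) complex.Re (g t)) +i*
     (\int[lebesgue_measure]_(t in `[0, 2 * pi]) complex.Im (g t))).

(* [`|_|] on [R[i]] takes values in [R[i]], whence the real part. *)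
Definition beurling_norm omega (f : circle -> R[i]) : \bar R :=
  \esum_(n in [set: int]) (complex.Re `|fourier_coef f n| * omega n)%:E.

Definition beurling_algebra omega : set (circle -> R[i]) :=
  [set f | continuous f /\ (beurling_norm omega f < +oo)%E].

(* The derivative along the circle, [lim_(w -> z, w in circle) (f w - f z) / (w - z)];
   as [lim] is total, the value is meaningful only when the limit exists. *)
Definition circle_derive (f : circle -> R[i]) (z : circle) : R[i] :=
  lim ((f w - f z) / (set_val w - set_val z) @[w --> z^']).

Definition circle_deriven (k : nat) (f : circle -> R[i]) : circle -> R[i] :=
  iter k circle_derive f.

(* Closure under scalar multiplication is an instance of [closed_idealM], the
   constants being in the algebra; closedness is for the norm [beurling_norm omega].
   Neither properness nor nontriviality is required. *)
Record closed_ideal omega (I : set (circle -> R[i])) : Prop := ClosedIdeal {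
  closed_ideal_sub : I `<=` beurling_algebra omega;
  closed_ideal0 : I (fun=> 0);
  closed_idealD : forall f g, I f -> I g -> I (fun z => f z + g z);
  closed_idealM : forall f g,
    beurling_algebra omega f -> I g -> I (fun z => f z * g z);
  closed_ideal_closed : forall f, beurling_algebra omega f ->
    (forall e : R, 0 < e -> exists2 g, I g &
       (beurling_norm omega (fun z => f z - g z)%R < e%:E)%E) ->
    I f }.

Definition hull (k : nat) (I : set (circle -> R[i])) : set circle :=
  [set z | forall f, I f -> forall j, (j <= k)%N -> circle_deriven j f z = 0].

End BeurlingAlgebra.

Arguments circle : clear implicits.

(* Main.v *)
Require Import Defs.
From HB Require Import structures.
From mathcomp Require Import all_boot all_order all_algebra.
From mathcomp Require Import complex ring lra zify.
From mathcomp Require Import all_classical all_reals all_analysis.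
Set Implicit Arguments.
Unset Strict Implicit.
Unset Printing Implicit Defensive.
Import Order.TTheory GRing.Theory Num.Theory.
Import numFieldNormedType.Exports.
Local Open Scope classical_set_scope.
Local Open Scope ring_scope.
Local Open Scope complex_scope.

(* Let [m] be the integer part of [s]. Given [f] in the right-hand side, consider the
   closed ideal [K = {g | g f in I}]; one has to show [1 in K].

   - If [J] is a closed ideal and [lam] is not in its hull, [z - lam] is invertible modulo
     [J] up to small errors. If the hull of [J] is empty, the class of [z] thus has empty
     spectrum, its powers are geometrically small, and [1 in J] since [z] is invertible.
     If the hull of [J] is [{z0}], the class of [z / z0 - 1] is quasinilpotent, and a
     theorem of Gelfand-Hille type gives [(z / z0 - 1) ^ (m + 1) in J].
   - The latter is proved with the Newton series [G(x) = sum_k binom(x, k) q ^ k] of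
     [(1 + q) ^ x]: the hypotheses bound it on the integers, Phragmen-Lindelof (first in the
     quadrants of the variable [sqrt x], then in half planes) makes it of polynomial growth,
     and Cauchy's estimate kills the coefficients [q ^ k] for [k > s].
   - If the hull of [K] is not empty, it has an isolated point [z0] because it is countable
     and closed. Multiplying by a function [phi] of the algebra supported near [z0] (it exists
     as the weight is non-quasianalytic), the ideal [{g | g phi in K}] has hull [{z0}], so
     that [(z / z0 - 1) ^ (m + 1) phi f in I]. By the vanishing hypotheses, some [h in I] has
     the same derivatives of order at most [m] as [f] at [z0]; then [f - h] is a limit of
     multiples of [(z / z0 - 1) ^ (m + 1) (f - h)], by means of averages of the powers of
     [z / z0], and it is here that the monotony of [omega (- n) / (1 + n) ^ s] is used. Hence
     [phi f in I], which contradicts that [z0] is in the hull of [K]. *)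

(** * The spectral radius in seminormed algebras *)

Section ComplexModulus.
Context {R : realType}.
Implicit Types z w : R[i].

(** No completion and no vector-valued holomorphic function is formed. Arguments about the quotient
    algebra are about a seminorm on the algebra itself; inverses become approximate ones, with a
    bound independent of the precision, and the spectral radius is controlled by repeated squaring.
    The Newton series is replaced by its truncations, Cauchy integrals by averages over roots of
    unity, the exponentials of Phragmen-Lindelof by powers [(1 + g / n) ^ n]. Hence the order of
    quantifiers in the growth estimates: first the constant, then the radius [L], then the
    truncation order. The two growth conditions are unequal: polynomial for the positive powers of
    [z], [exp (eps sqrt n)] for the negative ones. The variable [sqrt x] turns the second into
    exponential type zero, after which the first propagates to the whole plane. The exponent [m + 1]
    is the least integer above [s], and it enters twice: it is the order of nilpotency, and it makes
    the approximate identities at a point bounded, since frequencies up to [N] need an exponent at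
    least [s] and the Taylor terms of the others need orders at most [s]. *)

Definition cmod z : R := complex.Re `|z|.

Lemma cmodE z : `|z| = (cmod z)%:C.
Proof. by rewrite /cmod normc_def. Qed.

Lemma cmod_sqrt z :
  cmod z = Num.sqrt (complex.Re z ^+ 2 + complex.Im z ^+ 2).
Proof. by rewrite /cmod normc_def. Qed.

Lemma cmod_ge0 z : 0 <= cmod z.
Proof. by rewrite cmod_sqrt sqrtr_ge0. Qed.

Lemma cmod0 : cmod 0 = 0.
Proof. by rewrite /cmod normr0. Qed.

Lemma cmod1 : cmod 1 = 1.
Proof. by rewrite /cmod normr1. Qed.

Lemma cmodN z : cmod (- z) = cmod z.
Proof. by rewrite /cmod normrN. Qed.

Lemma cmodM z w : cmod (z * w) = cmod z * cmod w.
Proof. by apply: complexI; rewrite rmorphM /= -!cmodE normrM. Qed.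

Lemma cmodX z n : cmod (z ^+ n) = cmod z ^+ n.
Proof. by apply: complexI; rewrite rmorphXn /= -!cmodE normrX. Qed.

Lemma cmodV z : cmod z^-1 = (cmod z)^-1.
Proof. by apply: complexI; rewrite fmorphV /= -!cmodE normfV. Qed.

Lemma cmodD z w : cmod (z + w) <= cmod z + cmod w.
Proof. by rewrite -lecR rmorphD /= -!cmodE ler_normD. Qed.

Lemma cmodB z w : cmod (z - w) <= cmod z + cmod w.
Proof. by rewrite -(cmodN w) cmodD. Qed.

Lemma cmodBC z w : cmod (z - w) = cmod (w - z).
Proof. by rewrite -cmodN opprB. Qed.

Lemma cmod_eq0 z : (cmod z == 0) = (z == 0).
Proof.
apply/eqP/eqP => [h|->]; last exact: cmod0.
by apply/eqP; rewrite -normr_eq0 cmodE h.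
Qed.

Lemma cmod_real (x : R) : cmod x%:C = `|x|.
Proof. by rewrite cmod_sqrt /= expr0n addr0 sqrtr_sqr. Qed.

Lemma cmod_nat n : cmod n%:R = n%:R.
Proof. by rewrite -(rmorph_nat (real_complex R)) cmod_real ger0_norm. Qed.

Lemma cmod_sum (I : Type) (r : seq I) (P : pred I) (F : I -> R[i]) :
  cmod (\sum_(i <- r | P i) F i) <= \sum_(i <- r | P i) cmod (F i).
Proof.
elim/big_ind2: _ => [|x y u v h1 h2|//]; first by rewrite cmod0.
by apply: le_trans (cmodD _ _) _; exact: lerD.
Qed.

Lemma cmod_prod (I : Type) (r : seq I) (P : pred I) (F : I -> R[i]) :
  cmod (\prod_(i <- r | P i) F i) = \prod_(i <- r | P i) cmod (F i).
Proof.
by elim/big_ind2: _ => [|x y u v <- <-|//]; rewrite ?cmod1 ?cmodM.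
Qed.

Lemma cmodXz z (n : int) : cmod (z ^ n) = cmod z ^ n.
Proof. by case: n => n; rewrite ?NegzE -?exprnP -?exprnN ?cmodV cmodX. Qed.

Lemma sqr_cmod z : cmod z ^+ 2 = complex.Re z ^+ 2 + complex.Im z ^+ 2.
Proof. by rewrite cmod_sqrt sqr_sqrtr // addr_ge0 // sqr_ge0. Qed.

Lemma Re_le_cmod z : `|complex.Re z| <= cmod z.
Proof. by rewrite -lecR -cmodE normc_ge_Re. Qed.

Lemma Im_le_cmod z : `|complex.Im z| <= cmod z.
Proof.
rewrite -(ler_pXn2r (n:=2)) ?nnegrE ?normr_ge0 ?cmod_ge0 //.
by rewrite sqr_cmod real_normK ?num_real // lerDr sqr_ge0.
Qed.

Lemma cmod_le_ReIm z : cmod z <= `|complex.Re z| + `|complex.Im z|.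
Proof.
case: z => a b /=.
have -> : a +i* b = a%:C + 'i * b%:C by rewrite [LHS]complexE.
apply: le_trans (cmodD _ _) _; rewrite cmodM !cmod_real.
by rewrite [cmod 'i]cmod_sqrt /= expr0n expr1n add0r sqrtr1 mul1r.
Qed.

End ComplexModulus.

(** The two instances are the quotient norm modulo a closed ideal and the weighted norm. The last
    axiom is an inequality because [p] may vanish identically, as it does modulo the whole
    algebra. *)
Record seminorm_axioms {R : realType} {A : comNzRingType}
    (iota : R[i] -> A) (p : A -> R) : Prop := SeminormAxioms {
  seminormD : forall x y, p (x + y) <= p x + p y;
  seminormM : forall x y, p (x * y) <= p x * p y;
  seminormZ_le : forall c x, p (iota c * x) <= cmod c * p x;
  seminorm1 : p 1 <= 1 }.

Section Seminorm.
Context {R : realType} {A : comNzRingType} (iota : {rmorphism R[i] -> A}).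
Context (p : A -> R) (hp : seminorm_axioms iota p).
Implicit Types (x y q : A) (w : R[i]).

Lemma seminorm0 : p 0 = 0.
Proof.
have h : p 0 <= 0.
  have := seminormZ_le hp 0 0; by rewrite mulr0 cmod0 mul0r.
have := seminormD hp 0 0; rewrite addr0 => h2.
by apply/eqP; rewrite eq_le h /=; lra.
Qed.

Lemma seminormZ c x : p (iota c * x) = cmod c * p x.
Proof.
have [->|c0] := eqVneq c 0.
  by rewrite rmorph0 mul0r seminorm0 cmod0 mul0r.
apply/eqP; rewrite eq_le (seminormZ_le hp) /=.
have := seminormZ_le hp c^-1 (iota c * x).
rewrite mulrA -rmorphM mulVf // rmorph1 mul1r cmodV mulrC.
have cp : 0 < cmod c by rewrite lt_neqAle eq_sym cmod_eq0 c0 cmod_ge0.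
by rewrite ler_pdivlMr // [cmod c * _]mulrC.
Qed.

Lemma seminormN x : p (- x) = p x.
Proof.
have := seminormZ (-1) x.
by rewrite rmorphN rmorph1 mulN1r cmodN cmod1 mul1r.
Qed.

Lemma seminormB x y : p (x - y) <= p x + p y.
Proof. by rewrite -(seminormN y) (seminormD hp). Qed.

Lemma seminorm_ge0 x : 0 <= p x.
Proof. by have := seminormB x x; rewrite subrr seminorm0; lra. Qed.

Lemma seminorm_sum (I : Type) (r : seq I) (P : pred I) (F : I -> A) :
  p (\sum_(i <- r | P i) F i) <= \sum_(i <- r | P i) p (F i).
Proof.
elim/big_ind2: _ => [|x y u v h1 h2|//]; first by rewrite seminorm0.
by apply: le_trans (seminormD hp _ _) _; exact: lerD.
Qed.

Lemma seminormX x n : p (x ^+ n) <= p x ^+ n.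
Proof.
elim: n => [|n ih]; first by rewrite !expr0 (seminorm1 hp).
rewrite !exprS; apply: le_trans (seminormM hp _ _) _.
by rewrite ler_wpM2l ?seminorm_ge0.
Qed.

(* That is, [q] is invertible in the completion of [A] for [p]. *)
Definition approx_unit q := forall e : R, 0 < e -> exists x, p (q * x - 1) <= e.

(** In [y = x (q y - 1) + x - y (q x - 1)] the last term has seminorm at most [p y / 2] and is
    absorbed on the left. One rough inverse [x] thus bounds all the precise ones. *)
Lemma approx_inverse_bound q x y e e' :
  p (q * x - 1) <= e -> p (q * y - 1) <= e' -> e <= 1/2 -> e' <= 1 ->
  p y <= 4 * p x.
Proof.
move=> hx hy he he'.
have E : y = x * (q * y - 1) + x - y * (q * x - 1) by ring.
have h1 : p y <= p (x * (q * y - 1) + x) + p (y * (q * x - 1)).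
  by rewrite {1}E seminormB.
have h2 := seminormD hp (x * (q * y - 1)) x.
have h3 := seminormM hp x (q * y - 1).
have h4 := seminormM hp y (q * x - 1).
have := ler_wpM2l (seminorm_ge0 x) (le_trans hy he').
have := ler_wpM2l (seminorm_ge0 y) (le_trans hx he).
lra.
Qed.

Section Quasinilpotent.
Variable q : A.
Hypothesis inv_q : forall w, approx_unit (1 - iota w * q).

(** The bound [M] depends neither on [w] nor on the precision [e]: it stands for a bound of the
    resolvent in the completion. *)
Let bounded_inverse (r M : R) := forall w, cmod w <= r ->
  forall e, 0 < e -> exists x, p ((1 - iota w * q) * x - 1) <= e /\ p x <= M.

(** An approximate inverse at [w0] of precision 1/4 keeps precision 1/2 near [w0], which is what
    [approx_inverse_bound] requires. *)
Lemma approx_inverse_near w0 : exists d M : R, 0 < d /\ forall w,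
  cmod (w - w0) <= d -> forall e, 0 < e ->
  exists x, p ((1 - iota w * q) * x - 1) <= e /\ p x <= M.
Proof.
have [x hx] := inv_q w0 (ltac:(by lra) : 0 < (1/4 : R)).
set k := (1 + p q) * (1 + p x).
have k1 : 0 < k.
  by rewrite mulr_gt0 // ltr_pwDl // seminorm_ge0.
exists (4 * k)^-1, (4 * p x); split; first by rewrite invr_gt0 mulr_gt0.
move=> w hw e e0.
have hx' : p ((1 - iota w * q) * x - 1) <= 1/2.
  have -> : (1 - iota w * q) * x - 1 =
    ((1 - iota w0 * q) * x - 1) - iota (w - w0) * (q * x).
    by rewrite rmorphB /=; ring.
  apply: le_trans (seminormB _ _) _; rewrite seminormZ.
  have : cmod (w - w0) * p (q * x) <= (4 * k)^-1 * k.
    apply: ler_pM; rewrite ?cmod_ge0 ?seminorm_ge0 //.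
    apply: le_trans (seminormM hp _ _) _.
    by apply: ler_pM; rewrite ?seminorm_ge0 // lerDr.
  rewrite invfM -mulrA mulVf ?gt_eqF // mulr1; lra.
have e1 : 0 < Num.min e 1 by rewrite lt_min e0 ltr01.
have [y hy] := inv_q w e1.
have [ye y1] : p ((1 - iota w * q) * y - 1) <= e /\
  p ((1 - iota w * q) * y - 1) <= 1.
  by split; apply: le_trans hy _; rewrite ge_min lexx ?orbT.
by exists y; split=> //; apply: approx_inverse_bound hx' y1 _ _.
Qed.

Lemma approx_inverse_bounded (r : R) : exists M, bounded_inverse r M.
Proof.
pose K := (`[-r, r]%classic `*` `[-r, r]%classic : set (R * R)).
have cK : compact K by apply: compact_setX; exact: segment_compact.
have /compact_near_coveringP/(_ R +oo
  (fun M (z : R * R) => forall e, 0 < e ->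
     exists x, p ((1 - iota (z.1 +i* z.2) * q) * x - 1) <= e /\ p x <= M) _) := cK.
case.
  move=> [a b] _; have [d [M [d0 hd]]] := approx_inverse_near (a +i* b).
  exists (ball a (d/2) `*` ball b (d/2), [set M' | M < M']) => /=.
    split; last by exists M; split=> //; rewrite num_real.
    by exists (ball a (d/2), ball b (d/2)) => //=; split; apply: nbhsx_ballx; lra.
  move=> [[x y] M'] /= [[hx hy] hM] e e0.
  have [|u [hu1 hu2]] := hd (x +i* y) _ e e0.
    apply: le_trans (cmod_le_ReIm _) _ => /=.
    rewrite /ball /= in hx hy.
    by rewrite distrC in hx; rewrite distrC in hy; lra.
  by exists u; split=> //; apply: le_trans hu2 (ltW hM).
move=> M [_ hM]; exists (M + 1) => w hw.
have := hM (M + 1) (ltac:(by rewrite ltrDl) : M < M + 1) (complex.Re w, complex.Im w).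
case: w hw => a b hw; apply; rewrite /K /=.
have h1 := le_trans (Re_le_cmod _) hw; have h2 := le_trans (Im_le_cmod _) hw.
by split; rewrite /= in_itv /= -ler_norml.
Qed.

Lemma approx_inverse_double u x y (e : R) :
  p ((1 - u) * x - 1) <= e -> p ((1 + u) * y - 1) <= e ->
  p ((1 - u ^+ 2) * (iota (2^-1) * (x + y)) - 1) <= (1 + p u) * e.
Proof.
move=> hx hy.
have h2 : iota (2^-1) + iota (2^-1) = 1 by rewrite -rmorphD /= -[2^-1]mul1r -splitr rmorph1.
have -> : (1 - u ^+ 2) * (iota (2^-1) * (x + y)) - 1 =
  iota (2^-1) * ((1 + u) * ((1 - u) * x - 1) + (1 - u) * ((1 + u) * y - 1)).
  apply/eqP; rewrite -subr_eq0.
  by apply/eqP; rewrite -[0](subrr 1) -[X in _ = X - _]h2; ring.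
rewrite seminormZ cmodV (cmod_nat 2).
have h (v z : A) : p v <= 1 + p u -> p z <= e -> p (v * z) <= (1 + p u) * e.
  move=> hv hz; apply: le_trans (seminormM hp _ _) _.
  by apply: ler_pM; rewrite ?seminorm_ge0.
have hp1 := seminorm1 hp.
have h3 : p ((1 + u) * ((1 - u) * x - 1)) <= (1 + p u) * e.
  by apply: h => //; apply: le_trans (seminormD hp _ _) _; rewrite lerD2r.
have h4 : p ((1 - u) * ((1 + u) * y - 1)) <= (1 + p u) * e.
  by apply: h => //; apply: le_trans (seminormB _ _) _; rewrite lerD2r.
have := seminormD hp ((1 + u) * ((1 - u) * x - 1)) ((1 - u) * ((1 + u) * y - 1)).
lra.
Qed.

Lemma cmod_sqrtc (t : R[i]) : cmod t = 1 -> cmod (sqrtc t) = 1.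
Proof.
move=> ht; apply/eqP; rewrite -(eqrXn2 (n := 2)) ?cmod_ge0 //.
by rewrite -cmodX sqr_sqrtc ht expr1n.
Qed.

(* The inverse of [1 - u ^+ 2] is the mean of those of [1 - u] and [1 + u], so
   that the closeness of the inverses at the radii [rho] and [rho'] survives
   all the substitutions of [q ^+ (2 ^ k)] for [q]. *)
Lemma approx_inverse_close (r M rho rho' d : R) :
  bounded_inverse r M -> 0 <= rho' -> rho' <= rho -> rho <= r ->
  (rho - rho') * p q * M ^+ 2 < d ->
  forall k t, cmod t = 1 -> forall e, 0 < e -> exists x y,
  [/\ p ((1 - iota t * (iota rho%:C * q) ^+ (2 ^ k)) * x - 1) <= e,
      p ((1 - iota t * (iota rho'%:C * q) ^+ (2 ^ k)) * y - 1) <= e &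
      p (x - y) <= d].
Proof.
move=> hM r0 r1 r2 hd; elim=> [|k ih] t ht e e0.
  set d0 := d - (rho - rho') * p q * M ^+ 2.
  have d00 : 0 < d0 by rewrite subr_gt0.
  have M0 : 0 <= M.
    have [x [_ hx]] := hM 0 (ltac:(by rewrite cmod0; lra)) 1 ltr01.
    exact: le_trans (seminorm_ge0 _) hx.
  pose e1 := Num.min e (d0 / (2 * M + 1)).
  have e10 : 0 < e1 by rewrite lt_min e0 divr_gt0 // ltr_wpDl // mulr_ge0.
  have [|x [hx1 hx2]] := hM (t * rho%:C) _ _ e10.
    by rewrite cmodM ht mul1r cmod_real ger0_norm //; apply: le_trans r1.
  have [|y [hy1 hy2]] := hM (t * rho'%:C) _ _ e10.
    by rewrite cmodM ht mul1r cmod_real ger0_norm //; apply: le_trans r2.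
  have ee : e1 <= e by rewrite ge_min lexx.
  exists x, y; split.
  - by rewrite expn0 expr1 mulrA -rmorphM; apply: le_trans ee.
  - by rewrite expn0 expr1 mulrA -rmorphM; apply: le_trans ee.
  set a := 1 - iota (t * rho%:C) * q in hx1.
  set b := 1 - iota (t * rho'%:C) * q in hy1.
  (* Resolvent identity, with the defects of the two approximate inverses as correction terms. *)
  have -> : x - y = iota (t * (rho - rho')%:C) * q * (x * y)
     + (y * (a * x - 1) - x * (b * y - 1)).
    by rewrite /a /b !rmorphM !rmorphB /=; ring.
  have h1 : p (iota (t * (rho - rho')%:C) * q * (x * y)) <= (rho - rho') * p q * M ^+ 2.
    rewrite -mulrA seminormZ cmodM ht mul1r cmod_real ger0_norm ?subr_ge0 // -mulrA.
    rewrite ler_wpM2l ?subr_ge0 //; apply: le_trans (seminormM hp _ _) _.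
    rewrite ler_wpM2l ?seminorm_ge0 //; apply: le_trans (seminormM hp _ _) _.
    by apply: ler_pM; rewrite ?seminorm_ge0.
  have h2 : p (y * (a * x - 1)) <= M * e1.
    apply: le_trans (seminormM hp _ _) _.
    by apply: ler_pM; rewrite ?seminorm_ge0.
  have h3 : p (x * (b * y - 1)) <= M * e1.
    apply: le_trans (seminormM hp _ _) _.
    by apply: ler_pM; rewrite ?seminorm_ge0.
  have h4 : (2 * M + 1) * e1 <= d0.
    have : e1 <= d0 / (2 * M + 1) by rewrite ge_min lexx orbT.
    by rewrite ler_pdivlMr ?ltr_wpDl ?mulr_ge0 // mulrC.
  have h5 := seminormD hp (iota (t * (rho - rho')%:C) * q * (x * y))
     (y * (a * x - 1) - x * (b * y - 1)).
  have h6 := seminormB (y * (a * x - 1)) (x * (b * y - 1)).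
  rewrite /d0 in h4; lra.
(* The induction hypothesis is used at both square roots of [t]; this is why it is stated for all
   [t] of modulus 1. *)
have hs := cmod_sqrtc ht; set s := sqrtc t in hs *.
set u := iota s * (iota rho%:C * q) ^+ (2 ^ k).
set v := iota s * (iota rho'%:C * q) ^+ (2 ^ k).
have uv : 0 < 1 + p u + p v by rewrite -addrA ltr_pwDl // addr_ge0 ?seminorm_ge0.
have e10 : 0 < e / (1 + p u + p v) by rewrite divr_gt0.
have [x1 [y1 [hx1 hy1 h1]]] := ih s hs _ e10.
have [|x2 [y2 [hx2 hy2 h2]]] := ih (- s) _ _ e10; first by rewrite cmodN.
rewrite rmorphN mulNr opprK in hx2; rewrite rmorphN mulNr opprK in hy2.
exists (iota (2^-1) * (x1 + x2)), (iota (2^-1) * (y1 + y2)).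
have E (z : A) : iota t * z ^+ (2 ^ k.+1) = (iota s * z ^+ (2 ^ k)) ^+ 2.
  by rewrite exprMn -rmorphXn /= sqr_sqrtc -exprM -expnSr.
have pu := seminorm_ge0 u; have pv := seminorm_ge0 v.
rewrite !E; split.
- apply: le_trans (approx_inverse_double hx1 hx2) _.
  by rewrite mulrCA ger_pMr // ler_pdivrMr // mul1r; lra.
- apply: le_trans (approx_inverse_double hy1 hy2) _.
  by rewrite mulrCA ger_pMr // ler_pdivrMr // mul1r; lra.
rewrite -mulrBr seminormZ cmodV (cmod_nat 2) mulrC ler_pdivrMr //.
have -> : x1 + x2 - (y1 + y2) = (x1 - y1) + (x2 - y2) by ring.
by have := seminormD hp (x1 - y1) (x2 - y2); lra.
Qed.

Lemma approx_inverse_small u x (e d : R) :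
  p ((1 - u) * x - 1) <= e -> p (x - 1) <= d -> d <= 1/2 -> p u <= 2 * (d + e).
Proof.
move=> h1 h2 h3.
have E : u = (x - 1) - ((1 - u) * x - 1) - u * (x - 1) by ring.
have := seminormB ((x - 1) - ((1 - u) * x - 1)) (u * (x - 1)); rewrite -E.
have := seminormB (x - 1) ((1 - u) * x - 1).
have := seminormM hp u (x - 1).
have := ler_wpM2l (seminorm_ge0 u) (le_trans h2 h3).
lra.
Qed.

(** A good [rho] bounds the spectral radius of [q] by [1 / rho]. The good radii are extended by
    steps of a fixed length, up to any prescribed value. *)
Let good (rho : R) := exists C, forall n, p (q ^+ n) * rho ^+ n <= C.

Lemma good_lt1 (rho : R) N : 0 < rho -> (0 < N)%N -> p (q ^+ N) * rho ^+ N <= 1 ->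
  good rho.
Proof.
move=> r0 N0 hN; exists (\sum_(b < N) p (q ^+ b) * rho ^+ b) => n.
have h : p (q ^+ n) * rho ^+ n <= p (q ^+ (n %% N)) * rho ^+ (n %% N).
  rewrite {1 2}(divn_eq n N) !exprD [(n %/ N * N)%N]mulnC !exprM.
  have := ler_wpM2r (mulr_ge0 (exprn_ge0 (n %/ N) (exprn_ge0 N (ltW r0))) (exprn_ge0 (n %% N) (ltW r0)))
    (seminormM hp (q ^+ N ^+ (n %/ N)) (q ^+ (n %% N))).
  move/le_trans; apply.
  rewrite mulrACA -[X in _ <= X]mul1r ler_wpM2r //.
    by rewrite mulr_ge0 ?seminorm_ge0 ?exprn_ge0 // ltW.
  apply: le_trans (ler_wpM2r (exprn_ge0 _ (exprn_ge0 _ (ltW r0))) (seminormX _ _)) _.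
  by rewrite -exprMn exprn_ile1 // mulr_ge0 ?seminorm_ge0 ?exprn_ge0 // ltW.
apply: le_trans h _.
rewrite (bigD1 (Ordinal (ltn_pmod n N0))) //= lerDl sumr_ge0 // => i _.
by rewrite mulr_ge0 ?seminorm_ge0 ?exprn_ge0 // ltW.
Qed.

(** If a power of [rho' q] is small, the inverse of 1 minus this power is close to 1. By
    [approx_inverse_close] so is the inverse at [rho], hence the same power of [rho q] is small too.
    The constants run 1/16, then 3/16 for [y - 1], 1/4 for [x - 1], and at last
    [2 (1/4 + 1/16) < 1]. *)
Lemma good_step (r M rho rho' : R) : bounded_inverse r M -> 0 < rho' ->
  rho' < rho -> rho <= r -> (rho - rho') * p q * M ^+ 2 < 1/16 ->
  (exists2 k, (0 < k)%N & p (q ^+ (2 ^ k)) * rho' ^+ (2 ^ k) <= 1/16) -> good rho.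
Proof.
move=> hM r0 r1 r2 hd [k k0 hk].
have [x [y [hx hy hxy]]] := approx_inverse_close hM (ltW r0) (ltW r1) r2 hd k cmod1
   (ltac:(by lra) : 0 < (1/16 : R)).
rewrite rmorph1 !mul1r !exprMn -!rmorphXn /= in hx hy.
have r0' := lt_trans r0 r1.
have E (z : R) : 0 < z -> p (iota (z ^+ (2 ^ k))%:C * q ^+ (2 ^ k)) = p (q ^+ (2 ^ k)) * z ^+ (2 ^ k).
  by move=> z0; rewrite seminormZ cmod_real ger0_norm ?exprn_ge0 ?ltW // mulrC.
apply: (good_lt1 r0' (N := (2 ^ k)%N)); first by rewrite expn_gt0.
rewrite -E //; set u := iota (rho ^+ _)%:C * _ in hx *.
set v := iota (rho' ^+ _)%:C * _ in hy.
have hv : p v <= 1/16 by rewrite /v E.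
have y1 : p (y - 1) <= 3/16.
  have F : y - 1 = ((1 - v) * y - 1) + v * (y - 1) + v by ring.
  have := seminormD hp (((1 - v) * y - 1) + v * (y - 1)) v; rewrite -F.
  have := seminormD hp ((1 - v) * y - 1) (v * (y - 1)).
  have := seminormM hp v (y - 1).
  have := ler_wpM2r (seminorm_ge0 (y - 1)) hv.
  have := seminorm_ge0 (y - 1).
  lra.
have x1 : p (x - 1) <= 1/4.
  have -> : x - 1 = (x - y) + (y - 1) by ring.
  have := seminormD hp (x - y) (y - 1); lra.
have := approx_inverse_small hx x1 (ltac:(by lra)); lra.
Qed.

Lemma good_lt (rho rho' : R) : good rho -> 0 < rho' -> rho' < rho ->
  exists2 k, (0 < k)%N & p (q ^+ (2 ^ k)) * rho' ^+ (2 ^ k) <= 1/16.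
Proof.
move=> [C hC] r0 r1.
pose b := rho' / rho.
have rho0 := lt_trans r0 r1.
have b0 : 0 < b by rewrite divr_gt0.
have b1 : b < 1 by rewrite ltr_pdivrMr // mul1r.
have C0 : 0 <= C by apply: le_trans (hC 0%N); rewrite !expr0 mulr1 seminorm_ge0.
have : (fun n => b ^+ n) @ \oo --> (0 : R) by apply: cvg_expr; rewrite ger0_norm // ltW.
move=> /cvgrPdist_lt/(_ ((16 * (C + 1))^-1) _)[].
  by rewrite invr_gt0 mulr_gt0 // ltr_wpDl.
move=> N _ hN; exists N.+1 => //.
have := hN (2 ^ N.+1)%N (ltac:(by apply: ltnW; apply: ltnW; apply: ltn_expl) : (N <= 2 ^ N.+1)%N).
rewrite /= sub0r normrN ger0_norm ?(exprn_ge0 _ (ltW b0)) // => h.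
have -> : rho' = rho * b by rewrite /b mulrCA mulfV ?mulr1 ?gt_eqF.
rewrite exprMn mulrA.
apply: le_trans (_ : C * (16 * (C + 1))^-1 <= _).
  apply: ler_pM => //; rewrite ?mulr_ge0 ?seminorm_ge0 ?exprn_ge0 ?ltW //.
rewrite invfM mulrCA [X in _ <= X]mul1r ger_pMr ?invr_gt0 //.
by rewrite ler_pdivrMr ?ltr_wpDl // mul1r lerDl.
Qed.

Theorem quasinilpotent_exprn (eta : R) : 0 < eta ->
  exists C, forall n, p (q ^+ n) <= C * eta ^+ n.
Proof.
move=> eta0.
suff [C hC] : good eta^-1.
  by exists C => n; rewrite -ler_pdivrMr ?exprn_gt0 // -exprVn.
set r := eta^-1; have r0 : 0 < r by rewrite invr_gt0.
have [M hM] := approx_inverse_bounded r.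
have [M1 hM1] := approx_inverse_bounded (r + 1).
pose c := 1 + p q * M1 ^+ 2.
have c0 : 0 < c by rewrite ltr_pwDl // mulr_ge0 ?sqr_ge0 ?seminorm_ge0.
(* The three terms respectively keep all radii below [r + 1], make a step of length [2 d] admissible
   in [good_step], and make the initial radius [2 d] good. *)
pose d := Num.min (1/2) (Num.min ((64 * c)^-1) ((1 + p q)^-1 / 2)).
have d0 : 0 < d.
  rewrite !lt_min; apply/and3P; split; first by lra.
    by rewrite invr_gt0 mulr_gt0.
  by rewrite divr_gt0 // invr_gt0 ltr_pwDl // seminorm_ge0.
have dle : d <= 1/2 by rewrite ge_min lexx.
have dc : 2 * d * p q * M1 ^+ 2 < 1/16.
  have : d * c <= (64 * c)^-1 * c.
    by rewrite ler_pM2r // !ge_min lexx ?orbT.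
  rewrite invfM mulfVK ?(gt_eqF c0) // /c; lra.
have dq : 2 * d * p q <= 1.
  have : d * (1 + p q) <= ((1 + p q)^-1 / 2) * (1 + p q).
    by rewrite ler_wpM2r ?addr_ge0 ?seminorm_ge0 // !ge_min lexx !orbT.
  by rewrite mulrAC mulVf ?mul1r ?gt_eqF // ?ltr_pwDl ?seminorm_ge0 //; lra.
(* From a good radius, [good_lt] steps back by [d] to get a small power, and [good_step] then
   advances by [2 d]: the net gain is [d]. *)
have ind k : (k%:R * d <= r) -> good ((k.+2)%:R * d).
  elim: k => [_|k ih hk].
    apply: (good_lt1 (N := 1)) => //; first by rewrite mulr_gt0.
    by rewrite !expr1 mulrC.
  have hk' : k%:R * d <= r.
    by apply: le_trans hk; rewrite ler_wpM2r ?(ltW d0) // ler_nat.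
  have kd : 0 < k.+1%:R * d by rewrite mulr_gt0.
  have := good_lt (ih hk') kd; rewrite ltr_pM2r // ltr_nat ltnSn => /(_ isT).
  apply: (good_step hM1) => //.
  - by rewrite ltr_pM2r // ltr_nat.
  - by rewrite !mulrSr !mulrDl !mul1r in hk *; lra.
  - have -> // : k.+3%:R * d - k.+1%:R * d = 2 * d.
    by rewrite -[k.+3]add2n natrD mulrDl addrK.
pose k := Num.truncn (r / d).
have [|C hC] := ind k.
  by rewrite -ler_pdivlMr // truncn_le divr_ge0 // ltW.
have kr : r <= k.+2%:R * d.
  rewrite -ler_pdivrMr //.
  by apply: le_trans (ltW (truncnS_gt _)) _; rewrite ler_nat.
exists C => n; apply: le_trans (hC n).
rewrite ler_wpM2l ?seminorm_ge0 // lerXn2r // nnegrE.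
  exact: ltW.
exact: le_trans (ltW r0) kr.
Qed.

End Quasinilpotent.

End Seminorm.

(** * Maximum and Phragmen-Lindelof principles *)

Section PolynomialsOverAlgebra.
Context {R : realType} {A : comNzRingType} (iota : {rmorphism R[i] -> A}).
Context (p : A -> R) (hp : seminorm_axioms iota p).
Implicit Types (x y q : A) (w : R[i]).

Section MaximumPrinciple.
Implicit Types (P : {poly A}).

Lemma exists_primitive_root n : (0 < n)%N ->
  exists z : R[i], n.-primitive_root z.
Proof.
pose P : {poly R[i]} := 'X^n - 1; have [r Dp] := closed_field_poly_normal P.
move=> n_gt0; rewrite (monicP _) ?monicXnsubC // scale1r in Dp.
have rn1: all n.-unity_root r by apply/allP=> z; rewrite -root_prod_XsubC -Dp.
have sz_r: (n < (size r).+1)%N by rewrite -(size_prod_XsubC r id) -Dp size_XnsubC.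
have [|z] := hasP (cyclic.has_prim_root n_gt0 rn1 _ sz_r); last by exists z.
by rewrite -separable.separable_prod_XsubC -Dp cyclotomic.separable_Xn_sub_1 // pnatr_eq0 -lt0n.
Qed.

Lemma cmod_primitive_root n (z : R[i]) : n.-primitive_root z -> cmod z = 1.
Proof.
move=> hz; have n0 := prim_order_gt0 hz.
apply/eqP; rewrite -(eqrXn2 (n := n)) ?cmod_ge0 //.
by rewrite -cmodX (prim_expr_order hz) cmod1 expr1n.
Qed.

Lemma sum_primitive_root n (z : R[i]) m : n.-primitive_root z ->
  \sum_(j < n) z ^+ (m * j) = if (n %| m)%N then n%:R else 0.
Proof.
move=> hz; rewrite (eq_bigr (fun j : 'I_n => (z ^+ m) ^+ j)); last first.
  by move=> j _; rewrite exprM.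
rewrite (prim_order_dvd hz); case: eqP => [->|/eqP h].
  by rewrite (eq_bigr (fun=> 1)) ?sumr_const ?card_ord // => i _; rewrite expr1n.
have := subrX1 (z ^+ m) n; rewrite -exprM mulnC exprM (prim_expr_order hz) expr1n subrr.
by move/esym/eqP; rewrite mulf_eq0 subr_eq0 (negPf h) => /eqP.
Qed.

(** Cauchy's formula with the integral replaced by a sum over the [n]-th roots of unity. It is exact
    as [n] is at least the size of [P]: among the exponents [i + (n - k)] with [i < n], only [i = k]
    gives a multiple of [n]. *)
Lemma cauchy_coef P x (r z : R[i]) n k :
  n.-primitive_root z -> (size P <= n)%N -> (k < n)%N ->
  \sum_(j < n) P.[x + iota (r * z ^+ j)] * iota (z ^+ ((n - k) * j)) =
  iota (n%:R * r ^+ k) * P^`N(k).[x].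
Proof.
move=> hz hs hk.
rewrite (eq_bigr (fun j : 'I_n => \sum_(i < n)
   P^`N(i).[x] * iota (r ^+ i * z ^+ ((i + (n - k)) * j)))); last first.
  move=> j _; rewrite (nderiv_taylor_wide (n := n)) //; last exact: mulrC.
  rewrite mulr_suml; apply: eq_bigr => i _.
  rewrite -mulrA -!rmorphXn -rmorphM /= exprMn -mulrA -exprM -exprD.
  by rewrite [(j * i)%N]mulnC -mulnDl.
rewrite exchange_big /= (eq_bigr (fun i : 'I_n => P^`N(i).[x] *
   iota (r ^+ i * (if i == k :> nat then n%:R else 0)))).
  rewrite (bigD1 (Ordinal hk)) //= eqxx big1 ?addr0; last first.
    move=> i; rewrite -val_eqE /= => /negPf ->.
    by rewrite mulr0 rmorph0 mulr0.
  by rewrite mulrC [r ^+ k * _]mulrC.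
move=> i _; rewrite -mulr_sumr -rmorph_sum /= -mulr_sumr (sum_primitive_root _ hz).
congr (_ * iota (_ * _)); congr (if _ then _ else _).
apply/idP/eqP => [|->]; last by rewrite subnKC ?dvdnn // ltnW.
have hi := ltn_ord i; case/dvdnP => -[|[|c]].
- by rewrite mul0n; lia.
- by rewrite mul1n; lia.
- by rewrite !mulSn; lia.
Qed.

Lemma cauchy_estimate P x (r M : R) k : 0 < r ->
  (forall h, cmod h = r -> p P.[x + iota h] <= M) -> p P^`N(k).[x] * r ^+ k <= M.
Proof.
move=> r0 hM.
pose n := (maxn (size P) k).+1.
have [z hz] := exists_primitive_root (ltn0Sn (maxn (size P) k)).
have h1 := cmod_primitive_root hz.
have := cauchy_coef x r%:C hz (k := k) (leq_trans (leq_maxl _ _) (leqnSn _)).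
rewrite ltnS leq_maxr => /(_ isT)/(congr1 p).
rewrite (seminormZ hp) cmodM cmod_nat cmodX cmod_real (ger0_norm (ltW r0)) => E.
rewrite -(ler_pM2l (x := n%:R)) ?ltr0n // [p _ * _]mulrC mulrA -E.
apply: le_trans (seminorm_sum hp _ _ _) _.
rewrite mulr_natl -[X in M *+ X]card_ord -sumr_const; apply: ler_sum => i _.
rewrite mulrC (seminormZ hp) cmodX h1 expr1n mul1r; apply: hM.
by rewrite cmodM cmod_real cmodX h1 expr1n mulr1 ger0_norm // ltW.
Qed.

Lemma horner_lipschitz P (z : R[i]) : exists2 S : R, 0 < S &
  forall h, cmod h <= 1 -> p (P.[iota (z + h)] - P.[iota z]) <= cmod h * S.
Proof.
exists (1 + \sum_(i < size P) p P^`N(i).[iota z]).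
  by rewrite ltr_pwDl // sumr_ge0 // => i _; apply: (seminorm_ge0 hp).
move=> h h1; rewrite rmorphD /= (nderiv_taylor_wide (n := (size P).+1)) //; last exact: mulrC.
rewrite big_ord_recl /= nderivn0 expr0 mulr1 addrC addKr.
apply: le_trans (seminorm_sum hp _ _ _) _.
rewrite mulrDr mulr_sumr -[X in X <= _]add0r lerD ?mulr1 ?cmod_ge0 //.
have -> : \sum_(i < size P) cmod h * p P^`N(i).[iota z] =
   \sum_(i < (size P).+1) cmod h * p P^`N(i).[iota z].
  rewrite big_ord_recr /= [P^`N(size P)](_ : _ = 0) ?horner0 ?(seminorm0 hp) ?mulr0 ?addr0 //.
  by apply/polyP => i; rewrite coef_nderivn coef0 nth_default ?mul0rn // leq_addr.
rewrite [X in _ <= X]big_ord_recl -[X in X <= _]add0r lerD //.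
  by rewrite mulr_ge0 ?cmod_ge0 ?(seminorm_ge0 hp).
apply: ler_sum => i _; rewrite mulrC -rmorphXn /= (seminormZ hp) cmodX /=.
rewrite /bump /= add1n; apply: ler_pM; rewrite ?exprn_ge0 ?cmod_ge0 ?(seminorm_ge0 hp) //.
by rewrite exprS ler_piMr ?exprn_ile1 ?cmod_ge0.
Qed.

Lemma continuous_seminorm_horner P :
  continuous (fun z : R * R => p P.[iota (z.1 +i* z.2)]).
Proof.
move=> [a b]; have [S S0 hS] := horner_lipschitz P (a +i* b).
apply/cvgrPdist_lt => e e0 /=.
pose d := Num.min (1/2) (e / (2 * S) / 2).
have d0 : 0 < d.
  rewrite lt_min; apply/andP; split; first lra.
  by rewrite !divr_gt0 // mulr_gt0.
exists (ball a d, ball b d) => /=; first by split; exact: nbhsx_ballx.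
move=> [x y] /= [hx hy]; rewrite /ball /= in hx hy.
have E : x +i* y = (a +i* b) + ((x - a) +i* (y - b)).
  by apply/eqP; rewrite eq_complex /= !subrKC !eqxx.
have h : cmod ((x - a) +i* (y - b)) < 2 * d.
  apply: le_lt_trans (cmod_le_ReIm _) _ => /=.
  by rewrite distrC in hx; rewrite distrC in hy; lra.
have d1 : d <= 1/2 by rewrite ge_min lexx.
have d2 : 2 * d * S < e.
  have : 2 * d * S <= 2 * (e / (2 * S) / 2) * S.
    by rewrite ler_pM2r // ler_pM2l // ge_min lexx orbT.
  rewrite (_ : 2 * (e / (2 * S) / 2) * S = e / 2); first by lra.
  by field; rewrite gt_eqF.
have := hS _ (ltac:(by lra) : cmod ((x - a) +i* (y - b)) <= 1).
rewrite -E => h2.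
have h3 : p (P.[iota (x +i* y)] - P.[iota (a +i* b)]) < e.
  by apply: le_lt_trans h2 (lt_trans _ d2); rewrite ltr_pM2r.
rewrite ltr_distlC; apply/andP; split.
  have := seminormB hp P.[iota (x +i* y)] (P.[iota (x +i* y)] - P.[iota (a +i* b)]).
  by rewrite opprB addrC subrK; lra.
have := seminormD hp P.[iota (a +i* b)] (P.[iota (x +i* y)] - P.[iota (a +i* b)]).
by rewrite addrC subrK; lra.
Qed.

(* Take the rightmost of the points where the maximum is attained: the mean value
   property over a small circle excludes that it is an interior point. *)
Theorem maximum_principle P (K B : set R[i]) (M : R) :
  compact [set z : R * R | K (z.1 +i* z.2)] ->
  (forall z, K z -> ~ B z -> exists2 r : R, 0 < r &
     forall h, cmod h <= r -> K (z + h)) ->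
  (forall z, K z -> B z -> p P.[iota z] <= M) ->
  forall z, K z -> p P.[iota z] <= M.
Proof.
move=> cK intK hB z0 Kz0; rewrite leNgt; apply/negP => hz0.
pose f (z : R * R) := p P.[iota (z.1 +i* z.2)].
have cf : continuous f := @continuous_seminorm_horner P.
set K' := [set z : R * R | K (z.1 +i* z.2)] in cK.
have Kf (z : R[i]) : f (complex.Re z, complex.Im z) = p P.[iota z] by case: z.
have [||c Kc hc] := compact_EVT_max (f := f) _ cK.
- by exists (complex.Re z0, complex.Im z0); rewrite /K' /=; case: z0 Kz0 {hz0}.
- exact: continuous_subspaceT.
pose K1 := K' `&` [set z | f c <= f z].
have cK1 : compact K1.
  apply: compact_closedI => //; apply: (@closed_comp _ _ f [set x | f c <= x]).
    by move=> x _; exact: cf.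
  exact: closed_ge.
have K1c : K1 c by split => //=; apply/set_mem.
have [||c1 /set_mem Kc1 hc1] := compact_EVT_max (f := fst) _ cK1.
- by exists c.
- by apply: continuous_subspaceT => x; exact: cvg_fst.
have fM : M < f c.
  apply: lt_le_trans hz0 _; rewrite -Kf; apply: hc; apply/mem_set.
  by rewrite /K' /=; case: (z0) Kz0.
set w := c1.1 +i* c1.2.
have Kw : K w by case: Kc1.
have fw : p P.[iota w] = f c.
  apply/eqP; rewrite eq_le; case: Kc1 => k1 k2; apply/andP; split => //.
  by apply: (hc c1); apply/mem_set.
have nB : ~ B w by move=> /(hB _ Kw); rewrite fw leNgt fM.
have [r r0 hr] := intK w Kw nB.
pose n := (size P).+1.
have [z hz] := exists_primitive_root (ltn0Sn (size P)).
have h1 := cmod_primitive_root hz.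
have := cauchy_coef (iota w) r%:C hz (leqnSn (size P)) (ltn0Sn _).
move=> /(congr1 p); rewrite nderivn0 expr0 mulr1 (seminormZ hp) cmod_nat fw => E.
have hf j : p P.[iota w + iota (r%:C * z ^+ j)] <= f c.
  rewrite -rmorphD /= -Kf; apply: hc; apply/mem_set; rewrite /K' /=.
  set u := w + _; have : K u; last by case: (u).
  by apply: hr; rewrite cmodM cmod_real cmodX h1 expr1n mulr1 gtr0_norm.
have hf0 : p P.[iota w + iota (r%:C * z ^+ 0)] < f c.
  rewrite ltNge; apply/negP => h.
  have : K1 (c1.1 + r, c1.2).
    have E2 : (c1.1 + r) +i* c1.2 = w + r%:C.
      by apply/eqP; rewrite eq_complex /= addr0 !eqxx.
    split; rewrite /K' /f /= E2.
      by apply: hr; rewrite cmod_real gtr0_norm.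
    by move: h; rewrite expr0 mulr1 rmorphD.
  by move=> /mem_set/hc1 /=; lra.
have : n%:R * f c < n%:R * f c; last by rewrite ltxx.
rewrite -{1}E; apply: le_lt_trans (seminorm_sum hp _ _ _) _.
have -> : n%:R * f c = \sum_(j < n) f c by rewrite sumr_const card_ord mulr_natl.
rewrite !big_ord_recl; apply: ltr_leD.
  by rewrite [nat_of_ord ord0]/= muln0 [X in _ * iota X]expr0 rmorph1 mulr1.
apply: ler_sum => j _; rewrite mulrC (seminormZ hp) cmodX h1 expr1n mul1r.
exact: hf.
Qed.

End MaximumPrinciple.

End PolynomialsOverAlgebra.

Section PhragmenLindelof.
Context {R : realType} {A : comNzRingType} (iota : {rmorphism R[i] -> A}).
Context (p : A -> R) (hp : seminorm_axioms iota p).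

(** A polynomial substitute for the exponential, so that the maximum principle is only needed for
    polynomials. Squared moduli are compared: with [y = 2 Re w / n], the upper bound is
    [1 + t <= exp t] and the lower one is [exp (y / (1 + y)) <= 1 + y]. *)
Lemma cmod_exp_approx (w : R[i]) n : (0 < n)%N ->
  8 * cmod w ^+ 2 + 4 * cmod w <= n%:R ->
  expR (complex.Re w - 1/2) <= cmod (1 + w / n%:R) ^+ n <= expR (complex.Re w + 1/2).
Proof.
move=> n0 hn; set x := complex.Re w; set m := cmod w in hn *.
have N0 : 0 < n%:R :> R by rewrite ltr0n.
have m0 : 0 <= m := cmod_ge0 w.
have xm : `|x| <= m := Re_le_cmod w.
have m2 : m ^+ 2 = x ^+ 2 + complex.Im w ^+ 2 := sqr_cmod w.
set y := 2 * x / n%:R.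
have yn : n%:R * y = 2 * x by rewrite /y mulrCA mulfV ?mulr1 // gt_eqF.
have E : cmod (1 + w / n%:R) ^+ 2 = 1 + y + m ^+ 2 / n%:R ^+ 2.
  rewrite -(rmorph_nat (real_complex R)) -fmorphV sqr_cmod m2 /y /x.
  case: (w) => a b /=; field; by rewrite gt_eqF.
have y1 : - (1/2) <= y.
  rewrite -(ler_pM2l N0) yn mulrN.
  have : - m <= x by rewrite (le_trans _ (lerNnormlW xm)).
  have := sqr_ge0 m; lra.
have sq0 : 0 <= cmod (1 + w / n%:R) ^+ n by rewrite exprn_ge0 ?cmod_ge0.
have e0 (t : R) : 0 <= expR t := expR_ge0 t.
rewrite -(ler_pXn2r (n := 2)) ?nnegrE //.
rewrite -(ler_pXn2r (n := 2) _ sq0) ?nnegrE //.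
rewrite -exprM mulnC exprM E -!expRM_natl.
have y0 : 0 < 1 + y by lra.
apply/andP; split.
  apply: le_trans (_ : (1 + y) ^+ n <= _); last first.
    have q0 : 0 <= m ^+ 2 / n%:R ^+ 2 by rewrite divr_ge0 ?exprn_ge0 // ltW.
    by rewrite lerXn2r ?nnegrE ?lerDl ?(ltW y0) // addr_ge0 // ltW.
  have h1 : expR (y / (1 + y)) <= 1 + y.
    have := expR_ge1Dx (- (y / (1 + y))).
    have -> : 1 - y / (1 + y) = (1 + y)^-1 by field; rewrite gt_eqF.
    by rewrite expRN lef_pV2 ?posrE ?expR_gt0.
  apply: le_trans (_ : expR (y / (1 + y)) ^+ n <= _); last first.
    by rewrite lerXn2r ?nnegrE ?e0 ?(ltW y0).
  rewrite -expRM_natl ler_expR mulrA yn.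
  rewrite ler_pdivlMr // mulrDr mulr1.
  have h2 : n%:R * y * y <= 1/2.
    have -> : n%:R * y * y = 4 * x ^+ 2 / n%:R.
      by rewrite yn /y; field; rewrite gt_eqF.
    have : x ^+ 2 <= m ^+ 2 by rewrite m2 lerDl sqr_ge0.
    rewrite ler_pdivrMr //; lra.
  rewrite yn in h2; lra.
apply: le_trans (_ : expR (y + m ^+ 2 / n%:R ^+ 2) ^+ n <= _).
  rewrite lerXn2r ?nnegrE ?e0 //.
    by apply: addr_ge0; [exact: ltW | rewrite divr_ge0 ?exprn_ge0 // ltW].
  by rewrite -addrA expR_ge1Dx.
rewrite -expRM_natl ler_expR mulrDr yn.
have -> : n%:R * (m ^+ 2 / n%:R ^+ 2) = m ^+ 2 / n%:R by field; rewrite gt_eqF.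
have : m ^+ 2 / n%:R <= 1.
  by rewrite ler_pdivrMr // mul1r; have := sqr_ge0 m; lra.
lra.
Qed.

Lemma horner_bounded (g : {poly R[i]}) (L : R) :
  exists G, forall z, cmod z <= L -> cmod g.[z] <= G.
Proof.
exists (\sum_(i < size g) cmod g`_i * L ^+ i) => z hz.
rewrite horner_coef; apply: le_trans (cmod_sum _ _ _) _.
apply: ler_sum => i _; rewrite cmodM cmodX ler_wpM2l ?cmod_ge0 //.
have := cmod_ge0 z; by move=> h; rewrite lerXn2r ?nnegrE // (le_trans h).
Qed.

(** This is the maximum principle for [P] times [(1 + g / n) ^ n], the factor [expR 1] being the
    loss of this approximation. In each use, [Re g] is a harmonic function that compensates the
    growth of [P] on the boundary and is under control at the points of interest. *)
Theorem phragmen_lindelof (P : {poly A}) (g : {poly R[i]}) (K B : set R[i]) (L M : R) :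
  compact [set z : R * R | K (z.1 +i* z.2)] ->
  (forall z, K z -> ~ B z -> exists2 r : R, 0 < r &
     forall h, cmod h <= r -> K (z + h)) ->
  (forall z, K z -> cmod z <= L) ->
  (forall z, K z -> B z -> p P.[iota z] * expR (complex.Re g.[z]) <= M) ->
  forall z, K z -> p P.[iota z] * expR (complex.Re g.[z]) <= expR 1 * M.
Proof.
move=> cK intK hL hB z0 Kz0.
have [G hG'] := horner_bounded g L; have hG z (Kz : K z) := hG' z (hL z Kz).
pose n := (Num.truncn (8 * G ^+ 2 + 4 * G)).+1.
have N0 : 0 < n%:R :> R by rewrite ltr0n.
have hn : 8 * G ^+ 2 + 4 * G <= n%:R by apply: ltW; exact: truncnS_gt.
have happ z : K z -> expR (complex.Re g.[z] - 1/2) <= cmod (1 + g.[z] / n%:R) ^+ n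
    <= expR (complex.Re g.[z] + 1/2).
  move=> Kz; apply: cmod_exp_approx => //; apply: le_trans hn.
  have G0 := le_trans (cmod_ge0 _) (hG z Kz).
  by rewrite lerD // ler_wpM2l ?lerXn2r ?nnegrE ?cmod_ge0 ?hG.
pose F : {poly R[i]} := (1 + n%:R^-1%:P * g) ^+ n.
have FE z : F.[z] = (1 + g.[z] / n%:R) ^+ n.
  by rewrite /F horner_exp hornerD hornerM !hornerC mulrC.
have PE z : p (P * map_poly iota F).[iota z] = cmod (1 + g.[z] / n%:R) ^+ n * p P.[iota z].
  by rewrite hornerM horner_map mulrC (seminormZ hp) FE cmodX.
have := maximum_principle hp (P := P * map_poly iota F) (M := expR (1/2) * M) cK intK _ Kz0.
rewrite PE.
move=> h.
have [h1 h2] := andP (happ _ Kz0).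
have -> : expR 1 * M = expR (1/2) * (expR (1/2) * M).
  by rewrite mulrA -expRD; congr (expR _ * _); field.
have h3 : p P.[iota z0] * expR (complex.Re g.[z0]) <=
   expR (1/2) * (cmod (1 + g.[z0] / n%:R) ^+ n * p P.[iota z0]).
  rewrite mulrA mulrC ler_wpM2r ?(seminorm_ge0 hp) //.
  have -> : complex.Re g.[z0] = 1/2 + (complex.Re g.[z0] - 1/2) by ring.
  by rewrite expRD ler_pM2l ?expR_gt0.
apply: le_trans h3 _; rewrite ler_pM2l ?expR_gt0 //; apply: h.
move=> z Kz Bz; rewrite PE.
apply: le_trans (_ : expR (1/2) * (p P.[iota z] * expR (complex.Re g.[z])) <= _); last first.
  by rewrite ler_pM2l ?expR_gt0 // hB.
have [_ h4] := andP (happ _ Kz).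
rewrite mulrC [p _ * expR _]mulrC mulrA mulrC ler_wpM2r ?(seminorm_ge0 hp) //.
by apply: le_trans h4 _; rewrite addrC expRD.
Qed.

End PhragmenLindelof.

(** * Newton series and the Gelfand-Hille theorem *)

Section NewtonSeries.
Context {R : realType} {A : comNzRingType} (iota : {rmorphism R[i] -> A}).
Context (p : A -> R) (hp : seminorm_axioms iota p).

Definition binpoly k : {poly R[i]} :=
  (k`!%:R)^-1 *: \prod_(i < k) ('X - i%:R%:P).

Lemma binpoly0 : binpoly 0 = 1.
Proof. by rewrite /binpoly big_ord0 fact0 invr1 scale1r. Qed.

Lemma fact_unit n : n`!%:R != 0 :> R[i].
Proof. by rewrite pnatr_eq0 -lt0n fact_gt0. Qed.

Lemma binpolyE k z : (binpoly k).[z] = (\prod_(i < k) (z - i%:R)) / k`!%:R.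
Proof.
rewrite hornerZ horner_prod mulrC; congr (_ / _).
by apply: eq_bigr => i _; rewrite !hornerE.
Qed.

Lemma binpoly_pascal k z :
  (binpoly k.+1).[z + 1] = (binpoly k.+1).[z] + (binpoly k).[z].
Proof.
rewrite !binpolyE [in LHS]big_ord_recl /= subr0.
rewrite (eq_bigr (fun i : 'I_k => z - i%:R)); last first.
  by move=> i _; rewrite /bump /= add1n mulrSr opprD addrACA subrr addr0.
rewrite big_ord_recr /= factS natrM mulrSr.
have k0 : k%:R + 1 != 0 :> R[i] by rewrite -mulrSr pnatr_eq0.
by field; rewrite k0 fact_unit.
Qed.

(** The coefficient of [d ^ k] in [(1 - d) ^ (- x)]; it dominates the binomial coefficients
    [binom(z, k)] with [z] of modulus [x]. *)
Definition rising (x : R) k := (\prod_(i < k) (x + i%:R)) / k`!%:R.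

Lemma rising_ge0 x k : 0 <= x -> 0 <= rising x k.
Proof.
by move=> x0; rewrite divr_ge0 ?prodr_ge0 // => i _; rewrite addr_ge0.
Qed.

Lemma rising_pascal x k : rising (x + 1) k.+1 = rising x k.+1 + rising (x + 1) k.
Proof.
rewrite /rising [in LHS]big_ord_recr /= [X in _ = X / _ + _]big_ord_recl /= addr0.
have -> : \prod_(i < k) (x + (bump 0 i)%:R) = \prod_(i < k) (x + 1 + i%:R).
  by apply: eq_bigr => i _; rewrite /bump add1n mulrSr; ring.
rewrite factS natrM mulrSr.
have k0 : k%:R + 1 != 0 :> R by rewrite -mulrSr pnatr_eq0.
have f0 : k`!%:R != 0 :> R by rewrite pnatr_eq0 -lt0n fact_gt0.
by field; rewrite k0 f0.
Qed.

Lemma ler_rising x y k : 0 <= x -> x <= y -> rising x k <= rising y k.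
Proof.
move=> x0 xy; rewrite ler_pM2r ?invr_gt0 ?ltr0n ?fact_gt0 //.
by apply: ler_prod => i _; rewrite addr_ge0 // lerD2r.
Qed.

Lemma cmod_binpoly k z : cmod (binpoly k).[z] <= rising (cmod z) k.
Proof.
rewrite binpolyE cmodM cmodV cmod_nat cmod_prod ler_pM2r ?invr_gt0 ?ltr0n ?fact_gt0 //.
apply: ler_prod => i _; rewrite cmod_ge0 /=.
by apply: le_trans (cmodB _ _) _; rewrite cmod_nat.
Qed.

(* Partial sums of the expansion of [(1 - d) ^- m]. *)
Lemma sum_rising_nat (d : R) m n : 0 <= d -> d < 1 ->
  \sum_(k < n) rising m%:R k * d ^+ k <= (1 - d) ^- m.
Proof.
move=> d0 d1; have d2 : 0 < 1 - d by rewrite subr_gt0.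
elim: m => [|m ih].
  rewrite expr0 invr1; case: n => [|n]; first by rewrite big_ord0.
  rewrite big_ord_recl big1 ?addr0 => [|i _].
    by rewrite /rising big_ord0 fact0 expr0 invr1 !mulr1.
  by rewrite /rising big_ord_recl /= addr0 !mul0r.
have h : \sum_(k < n) rising m.+1%:R k * d ^+ k <=
   \sum_(k < n) rising m%:R k * d ^+ k + d * \sum_(k < n) rising m.+1%:R k * d ^+ k.
  case: n {ih} => [|n]; first by rewrite !big_ord0 mulr0 addr0.
  rewrite [X in X <= _]big_ord_recl [X in _ <= X + _]big_ord_recl.
  have -> : rising m.+1%:R 0 = rising m%:R 0 by rewrite /rising !big_ord0.
  rewrite -addrA lerD2l.
  rewrite (eq_bigr (fun i : 'I_n => rising m%:R (bump 0 i) * d ^+ bump 0 i +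
     d * (rising m.+1%:R i * d ^+ i))) => [|i _]; last first.
    by rewrite /bump /= add1n mulrSr rising_pascal exprS; ring.
  rewrite big_split /= lerD2l -mulr_sumr ler_wpM2l //.
  by rewrite [X in _ <= X]big_ord_recr lerDl mulr_ge0 ?rising_ge0 ?exprn_ge0.
rewrite exprS invfM mulrC ler_pdivlMr //; apply: le_trans ih; lra.
Qed.

Lemma sum_rising (d x : R) n : 0 <= d -> d < 1 -> 0 <= x ->
  \sum_(k < n) rising x k * d ^+ k <= (1 - d) ^- (Num.truncn x).+1.
Proof.
move=> d0 d1 x0; apply: le_trans (sum_rising_nat _ n d0 d1).
apply: ler_sum => k _; rewrite ler_wpM2r ?exprn_ge0 // ler_rising //.
exact: ltW (truncnS_gt x).
Qed.

Variable q : A.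
Hypothesis quasinil : forall e : R, 0 < e -> exists C, forall n, p (q ^+ n) <= C * e ^+ n.

(* Truncations of the Newton series of [z |-> (1 + q) ^ z]. *)
Definition newton n : {poly A} :=
  \sum_(k < n.+1) map_poly iota (binpoly k) * (q ^+ k)%:P.

Lemma newtonE n z : (newton n).[iota z] =
  \sum_(k < n.+1) iota (binpoly k).[z] * q ^+ k.
Proof.
rewrite horner_sum; apply: eq_bigr => k _.
by rewrite hornerM horner_map hornerC.
Qed.

Lemma newton0 n : (newton n).[iota 0] = 1.
Proof.
rewrite newtonE big_ord_recl binpoly0 hornerC rmorph1 mulr1 big1 ?addr0 //.
by move=> i _; rewrite binpolyE big_ord_recl /= subr0 !mul0r rmorph0 mul0r.
Qed.

Lemma newtonS n z :
  (newton n.+1).[iota (z + 1)] = (newton n.+1).[iota z] + q * (newton n).[iota z].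
Proof.
rewrite !newtonE big_ord_recl [in RHS]big_ord_recl mulr_sumr -addrA -big_split /=.
congr (_ + _); first by rewrite binpoly0 !hornerC.
apply: eq_bigr => i _; rewrite /bump /= add1n binpoly_pascal rmorphD exprS /=.
by ring.
Qed.

(** The functional equation [G(z + 1) = (1 + q) G(z)], up to an error that [newton_remainder] makes
    uniformly small on each disc. *)
Lemma newtonS' n z : (newton n).[iota (z + 1)] =
  (1 + q) * (newton n).[iota z] - iota (binpoly n).[z] * q ^+ n.+1.
Proof.
case: n => [|n].
  by rewrite !newtonE !big_ord_recl !big_ord0 binpoly0 !hornerC rmorph1 expr1; ring.
rewrite newtonS mulrDl mul1r -addrA; congr (_ + _).
rewrite [in RHS]newtonE big_ord_recr /= -newtonE mulrDr -addrA.
by rewrite (exprS q n.+1); ring.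
Qed.

Lemma newton_growth (e : R) : 0 < e -> exists2 C, 0 < C & forall n z,
  p (newton n).[iota z] <= C * expR (e * cmod z).
Proof.
(* So that [(1 - d)^-1 = 1 + e <= expR e]. *)
move=> e0; pose d := e / (1 + e).
have e1 : 0 < 1 + e by rewrite addr_gt0.
have d0 : 0 < d by rewrite divr_gt0.
have d1 : d < 1 by rewrite ltr_pdivrMr // mul1r ltrDr.
have [C hC] := quasinil d0.
have C0 : 0 <= C.
  by have := hC 0%N; rewrite expr0 mulr1; apply: le_trans; exact: seminorm_ge0 hp _.
exists ((C + 1) * expR e); first by rewrite mulr_gt0 ?expR_gt0 // ltr_wpDl.
move=> n z; rewrite newtonE.
apply: le_trans (seminorm_sum hp _ _ _) _.
apply: le_trans (_ : C * \sum_(k < n.+1) rising (cmod z) k * d ^+ k <= _).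
  rewrite mulr_sumr; apply: ler_sum => k _; rewrite (seminormZ hp).
  rewrite mulrCA; apply: ler_pM; rewrite ?cmod_ge0 ?(seminorm_ge0 hp) //.
  exact: cmod_binpoly.
rewrite -mulrA -expRD; apply: ler_pM => //; rewrite ?lerDl //.
  by apply: sumr_ge0 => i _; rewrite mulr_ge0 ?rising_ge0 ?cmod_ge0 ?exprn_ge0 ?(ltW d0).
apply: le_trans (sum_rising _ (ltW d0) d1 (cmod_ge0 _)) _.
have -> : 1 - d = (1 + e)^-1 by rewrite /d; field; rewrite gt_eqF.
rewrite exprVn invrK; apply: le_trans (_ : expR e ^+ (Num.truncn (cmod z)).+1 <= _).
  by rewrite lerXn2r ?nnegrE ?expR_ge0 ?expR_ge1Dx // ltW.
rewrite -expRM_natl ler_expR mulrC -[X in X + _]mulr1 -mulrDr ler_pM2l //.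
by rewrite mulrSr addrC lerD2l truncn_le cmod_ge0.
Qed.

Lemma newton_remainder (L e : R) : 0 <= L -> 0 < e -> exists n0, forall n, (n0 <= n)%N ->
  forall z, cmod z <= L -> p (iota (binpoly n).[z] * q ^+ n.+1) <= e.
Proof.
move=> L0 e0.
(* One factor 1/2 of 1/4 makes the binomial coefficients summable, the other one tends to 0. *)
have [C hC] := quasinil (ltac:(by lra) : 0 < (1/4 : R)).
have C0 : 0 <= C.
  by have := hC 0%N; rewrite expr0 mulr1; apply: le_trans; exact: seminorm_ge0 hp _.
pose K := (1 - 1/2 : R) ^- (Num.truncn L).+1.
have K0 : 0 < K by rewrite invr_gt0 exprn_gt0 //; lra.
have : (fun n => (1/2) ^+ n) @ \oo --> (0 : R) by apply: cvg_expr; rewrite ger0_norm; lra.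
move=> /cvgrPdist_lt/(_ (e / (K * (C + 1))) _)[].
  by rewrite divr_gt0 // mulr_gt0 // ltr_wpDl.
move=> n0 _ hn0; exists n0 => n hn z hz.
have := hn0 n hn; rewrite /= sub0r normrN ger0_norm; last by rewrite exprn_ge0 //; lra.
rewrite ltr_pdivlMr; last by rewrite mulr_gt0 // ltr_wpDl.
move=> /ltW; apply: le_trans.
rewrite (seminormZ hp).
have h1 : cmod (binpoly n).[z] * (1/2) ^+ n <= K.
  apply: le_trans (_ : rising L n * (1/2) ^+ n <= _).
    have h0 : 0 < (1/2 : R) ^+ n by rewrite exprn_gt0 //; lra.
    rewrite ler_pM2r //.
    by apply: le_trans (cmod_binpoly _ _) _; rewrite ler_rising ?cmod_ge0.
  apply: le_trans (sum_rising (d := 1/2) n.+1 _ _ L0); [|lra|lra].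
  rewrite big_ord_recr /= lerDr sumr_ge0 // => i _.
  by rewrite mulr_ge0 ?rising_ge0 ?exprn_ge0 //; lra.
have h2 : p (q ^+ n.+1) <= (C + 1) * (1/2) ^+ n * (1/2) ^+ n.
  apply: le_trans (hC n.+1) _; rewrite -mulrA -exprMn; apply: ler_pM => //.
  - by rewrite lerDl.
  rewrite exprS (_ : 1/2 * (1/2) = 1/4 :> R); last by field.
  by rewrite ler_piMl ?exprn_ge0 //; lra.
have h3 : 0 <= (1/2 : R) ^+ n by rewrite exprn_ge0 //; lra.
apply: le_trans (ler_wpM2l (cmod_ge0 _) h2) _.
have := ler_wpM2r (mulr_ge0 (ltac:(by lra) : 0 <= C + 1) h3) h1.
by rewrite [(1/2) ^+ n * (K * _)]mulrC -!mulrA; congr (_ <= _); ring.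
Qed.
Lemma affine_iter (S : A) (y : nat -> A) (e : R) m : 0 <= e ->
  (forall n, (n < m)%N -> p (y n.+1 - S * y n) <= e) ->
  p (y m) <= p (S ^+ m) * p (y 0) + m%:R * (1 + p S) ^+ m * e.
Proof.
move=> e0 hy.
have S0 := seminorm_ge0 hp S.
have h n : (n <= m)%N -> p (y n - S ^+ n * y 0) <= n%:R * (1 + p S) ^+ n * e.
  elim: n => [|n ih] hn.
    by rewrite expr0 mul1r subrr (seminorm0 hp) !mul0r.
  have -> : y n.+1 - S ^+ n.+1 * y 0 = (y n.+1 - S * y n) + S * (y n - S ^+ n * y 0).
    by rewrite exprS; ring.
  apply: le_trans (seminormD hp _ _) _.
  apply: le_trans (lerD (hy n hn) (seminormM hp _ _)) _.
  apply: le_trans (lerD (lexx _) (ler_wpM2l S0 (ih (ltnW hn)))) _.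
  rewrite !mulrA -[X in X + _]mul1r -mulrDl ler_wpM2r //.
  rewrite mulrSr mulrDl mul1r addrC; apply: lerD; last by rewrite exprn_ege1 // lerDl.
  rewrite [p S * _]mulrC -mulrA ler_wpM2l // exprS ler_wpM2r ?exprn_ge0 ?addr_ge0 //.
  by rewrite lerDr.
have -> : y m = S ^+ m * y 0 + (y m - S ^+ m * y 0) by ring.
apply: le_trans (seminormD hp _ _) _.
by apply: lerD; [exact: seminormM hp _ _ | exact: h].
Qed.

Lemma newton_unit_bound : exists2 C, 0 < C & forall n z, cmod z <= 1 ->
  p (newton n).[iota z] <= C.
Proof.
have [C C0 hC] := newton_growth ltr01.
exists (C * expR 1); first by rewrite mulr_gt0 ?expR_gt0.
move=> n z hz; apply: le_trans (hC n z) _.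
by rewrite ler_pM2l // ler_expR mul1r.
Qed.

(** The functional equation is iterated from the fractional part of [t]. Only [n0] depends on [L],
    so that [C] is in effect a bound for the whole Newton series. *)
Lemma newton_pos (C0 : R) d : (forall n, p ((1 + q) ^+ n) <= C0 * (1 + n%:R) ^+ d) ->
  exists2 C, 0 < C & forall L, 0 <= L -> exists n0, forall n, (n0 <= n)%N ->
  forall t, 0 <= t <= L -> p (newton n).[iota t%:C] <= C * (1 + t) ^+ d.
Proof.
move=> hT; have [C1 C10 hC1] := newton_unit_bound.
have C00 : 0 <= C0.
  by have := hT 0%N; rewrite addr0 expr1n mulr1; apply: le_trans; exact: seminorm_ge0 hp _.
exists (C0 * C1 + 1); first by rewrite ltr_wpDl // mulr_ge0 // ltW.
move=> L L0; pose N := Num.truncn L.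
have k0 : 0 < (N%:R + 1) * (2 + p q) ^+ N.
  have := seminorm_ge0 hp q; have := ler0n R N => ? ?.
  by apply: mulr_gt0; [lra | apply: exprn_gt0; lra].
have [n0 hn0] := newton_remainder L0 (ltac:(by rewrite invr_gt0) : 0 < ((N%:R + 1) * (2 + p q) ^+ N)^-1).
exists n0 => n hn t /andP[t0 tL].
pose m := Num.truncn t; pose x := t - m%:R.
have /andP[m1 m2] := truncn_itv t0; rewrite -/m in m1 m2.
have mN : (m <= N)%N by apply: le_truncn.
pose y j := (newton n).[iota (x + j%:R)%:C].
have e0 := ltW (ltac:(by rewrite invr_gt0) : 0 < ((N%:R + 1) * (2 + p q) ^+ N)^-1).
have h j : (j < m)%N -> p (y j.+1 - (1 + q) * y j) <= ((N%:R + 1) * (2 + p q) ^+ N)^-1.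
  move=> jm; rewrite /y mulrSr addrA [in X in p (X - _)]rmorphD /= newtonS'.
  rewrite addrAC subrr add0r (seminormN hp); apply: hn0 => //.
  rewrite cmod_real ger0_norm; last by rewrite addr_ge0 // subr_ge0.
  apply: le_trans tL; rewrite /x -addrA gerDl addrC subr_le0 ler_nat.
  exact: ltnW.
have := affine_iter e0 h.
have -> : y m = (newton n).[iota t%:C] by rewrite /y /x subrK.
move/le_trans; apply.
rewrite [X in _ <= X]mulrDl mul1r; apply: lerD.
  rewrite mulrAC; apply: ler_pM; rewrite ?(seminorm_ge0 hp) //.
    apply: le_trans (hT m) _; rewrite ler_wpM2l // lerXn2r ?nnegrE ?addr_ge0 //.
    by rewrite lerD2l.
  apply: hC1; rewrite /y addr0 cmod_real ger0_norm ?subr_ge0 // /x lerBlDr.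
  by rewrite addrC -mulrSr ltW.
apply: le_trans (_ : 1 <= _); last by rewrite exprn_ege1 // lerDl.
rewrite ler_pdivrMr // mul1r; apply: ler_pM; rewrite ?exprn_ge0 ?addr_ge0 ?(seminorm_ge0 hp) //.
  by rewrite (le_trans (_ : m%:R <= N%:R)) ?ler_nat // lerDl.
have p1 : p (1 + q) <= 1 + p q.
  by apply: le_trans (seminormD hp _ _) _; rewrite lerD2r (seminorm1 hp).
have q0 := seminorm_ge0 hp q; have p0 := seminorm_ge0 hp (1 + q).
apply: le_trans (_ : (2 + p q) ^+ m <= _).
  by rewrite lerXn2r ?nnegrE; lra.
by rewrite ler_weXn2l //; lra.
Qed.

(** The functional equation is iterated downwards, multiplying by the inverse [S], from the point
    [m - t] of [0, 1], where [m] is the integer part of [t] plus 1. *)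
Lemma newton_neg (S : A) : (1 + q) * S = 1 ->
  (forall e, 0 < e -> exists C, forall n, p (S ^+ n) <= C * expR (e * Num.sqrt n%:R)) ->
  forall e, 0 < e -> exists2 C, 0 < C & forall L, 0 <= L ->
  exists n0, forall n, (n0 <= n)%N ->
  forall t, 0 <= t <= L -> p (newton n).[iota (- t)%:C] <= C * expR (e * Num.sqrt t).
Proof.
move=> TS hS e e0; have [C1 C10 hC1] := newton_unit_bound.
have [C0 hC0] := hS e e0.
have C00 : 0 <= C0.
  have := hC0 0%N; rewrite sqrtr0 mulr0 expR0 mulr1; apply: le_trans.
  exact: seminorm_ge0 hp _.
have S0 := seminorm_ge0 hp S.
exists (C0 * expR e * C1 + 1); first by rewrite ltr_wpDl // !mulr_ge0 ?expR_ge0 // ltW.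
move=> L L0; pose N := (Num.truncn L).+1.
have k0 : 0 < ((N%:R + 1) * (1 + p S) ^+ N * (1 + p S))^-1.
  have := ler0n R N => ?; rewrite invr_gt0.
  by apply: mulr_gt0; [apply: mulr_gt0; [lra | apply: exprn_gt0; lra] | lra].
have [n0 hn0] := newton_remainder (addr_ge0 L0 ler01) k0.
exists n0 => n hn t /andP[t0 tL].
pose m := (Num.truncn t).+1; pose x := m%:R - t.
have /andP[m1 m2] := truncn_itv t0.
have mN : (m <= N)%N by rewrite ltnS; apply: le_truncn.
have mt : m%:R <= t + 1 by rewrite /m mulrSr lerD2r.
have x0 : 0 <= x by rewrite subr_ge0 ltW.
have x1 : x <= 1 by rewrite /x lerBlDr addrC.
pose y j := (newton n).[iota (x - j%:R)%:C].
have e'0 : 0 <= p S * ((N%:R + 1) * (1 + p S) ^+ N * (1 + p S))^-1.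
  by rewrite mulr_ge0 // ltW.
have h j : (j < m)%N -> p (y j.+1 - S * y j) <=
    p S * ((N%:R + 1) * (1 + p S) ^+ N * (1 + p S))^-1.
  move=> jm.
  have E : y j = (1 + q) * y j.+1 - iota (binpoly n).[(x - j.+1%:R)%:C] * q ^+ n.+1.
    rewrite /y -newtonS'; congr ((newton n).[iota _]).
    by rewrite [in RHS]mulrSr -(rmorph1 (real_complex R)) -rmorphD /= opprD addrA subrK.
  have -> : y j.+1 - S * y j = S * (iota (binpoly n).[(x - j.+1%:R)%:C] * q ^+ n.+1).
    rewrite E; set B := iota _ * _.
    by rewrite mulrBr [S * (_ * y _)]mulrA [S * (1 + q)]mulrC TS mul1r opprB addrC subrK.
  apply: le_trans (seminormM hp _ _) _; rewrite ler_wpM2l //; apply: hn0 => //.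
  rewrite cmod_real ler_norml; apply/andP; split.
    rewrite lerNl opprB lerBlDr (le_trans (_ : _ <= m%:R)) ?ler_nat //.
    by apply: le_trans mt _; rewrite -addrA lerD // lerDl.
  by have := ler0n R j.+1; lra.
have := affine_iter e'0 h.
have -> : y m = (newton n).[iota (- t)%:C] by rewrite /y /x addrAC subrr add0r.
move/le_trans; apply.
rewrite [X in _ <= X]mulrDl mul1r; apply: lerD.
  rewrite mulrAC; apply: ler_pM; rewrite ?(seminorm_ge0 hp) //.
    apply: le_trans (hC0 m) _; rewrite -mulrA ler_wpM2l // -expRD ler_expR.
    rewrite -[X in X + _]mulr1 -mulrDr ler_pM2l //.
    rewrite -(ler_pXn2r (n := 2)) ?nnegrE ?addr_ge0 ?sqrtr_ge0 //.
    rewrite sqr_sqrtr // sqrrD expr1n sqr_sqrtr //.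
    apply: le_trans mt _; rewrite addrC lerD // lerDl mul1r.
    by rewrite mulrn_wge0 // sqrtr_ge0.
  by apply: hC1; rewrite /y subr0 cmod_real ger0_norm.
apply: le_trans (_ : 1 <= _); last by rewrite -expR0 ler_expR mulr_ge0 ?sqrtr_ge0 // ltW.
have k1 : 0 < (N%:R + 1) * (1 + p S) ^+ N * (1 + p S) by rewrite -invr_gt0.
rewrite mulrA ler_pdivrMr // mul1r; apply: ler_pM; rewrite ?mulr_ge0 ?exprn_ge0 ?addr_ge0 //; last by rewrite lerDr.
apply: ler_pM; rewrite ?exprn_ge0 ?addr_ge0 //.
  by rewrite (le_trans (_ : m%:R <= N%:R)) ?ler_nat // lerDl.
by rewrite ler_weXn2l // lerDl.
Qed.

(* A half or a quarter of the disc of radius [L], according to [a]. *)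
Definition disc_sector (a : bool) (s L : R) : set R[i] :=
  [set z | (a -> 0 <= complex.Re z) /\ 0 <= s * complex.Im z /\ cmod z <= L].

Definition sector_boundary (a : bool) (L : R) : set R[i] :=
  [set z | a /\ complex.Re z = 0 \/ complex.Im z = 0 \/ cmod z = L].

Lemma compact_disc_sector a s L :
  compact [set z : R * R | disc_sector a s L (z.1 +i* z.2)].
Proof.
have cK : compact (`[- L, L]%classic `*` `[- L, L]%classic : set (R * R)).
  by apply: compact_setX; exact: segment_compact.
apply: (subclosed_compact _ cK).
- have -> : [set z : R * R | disc_sector a s L (z.1 +i* z.2)] =
    [set z | (if a then z.1 else 0) \in `[0, +oo[%classic] `&`
    ([set z | s * z.2 \in `[0, +oo[%classic] `&`
     [set z | cmod (z.1 +i* z.2) \in `]-oo, L]%classic]).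
    apply/seteqP; split => -[x y] /=; rewrite /disc_sector /= !inE /= !in_itv /= !andbT.
      by move=> [h1 [h2 h3]]; split => //; case: a h1 => // h1; exact: h1.
    by move=> [h1 [h2 h3]]; split => //; case: a h1.
  apply: closedI; last apply: closedI.
  + have -> : [set z : R * R | (if a then z.1 else 0) \in `[0, +oo[%classic] =
       (fun z : R * R => if a then z.1 else 0) @^-1` `[0, +oo[%classic.
      by apply/seteqP; split => z /=; rewrite inE.
    apply: (@closed_comp _ _ (fun z : R * R => if a then z.1 else 0)).
      by move=> z _; case: a; [exact: cvg_fst | exact: cvg_cst].
    exact: rray_closed.
  + have -> : [set z : R * R | s * z.2 \in `[0, +oo[%classic] =
       (fun z : R * R => s * z.2) @^-1` `[0, +oo[%classic.
      by apply/seteqP; split => z /=; rewrite inE.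
    apply: (@closed_comp _ _ (fun z : R * R => s * z.2)).
      by move=> z _; apply: cvgMr; exact: cvg_snd.
    exact: rray_closed.
  + have -> : [set z : R * R | cmod (z.1 +i* z.2) \in `]-oo, L]%classic] =
       (fun z : R * R => cmod (z.1 +i* z.2)) @^-1` `]-oo, L]%classic.
      by apply/seteqP; split => z /=; rewrite inE.
    apply: (@closed_comp _ _ (fun z : R * R => cmod (z.1 +i* z.2))).
      move=> z _; have -> : (fun z : R * R => cmod (z.1 +i* z.2)) =
        (fun z : R * R => Num.sqrt (z.1 ^+ 2 + z.2 ^+ 2)).
        by apply/funext => w; rewrite cmod_sqrt.
      apply: (@cvg_comp _ _ _ (fun w : R * R => w.1 ^+ 2 + w.2 ^+ 2) (@Num.sqrt R)
        _ (nbhs (z.1 ^+ 2 + z.2 ^+ 2))); last exact: sqrt_continuous.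
      by apply: cvgD; rewrite !expr2; apply: cvgM; (exact: cvg_fst || exact: cvg_snd).
    exact: lray_closed.
move=> [x y] [_ [_ /= h]]; rewrite /= !in_itv /= -!ler_norml.
by split; apply: le_trans h; [exact: (Re_le_cmod (x +i* y)) | exact: (Im_le_cmod (x +i* y))].
Qed.

Lemma disc_sector_interior a s L z : s ^+ 2 = 1 -> disc_sector a s L z ->
  ~ sector_boundary a L z ->
  exists2 r : R, 0 < r & forall h, cmod h <= r -> disc_sector a s L (z + h).
Proof.
move=> s1 [h1 [h2 h3]] nB.
have y0 : 0 < s * complex.Im z.
  rewrite lt_neqAle h2 andbT; apply/eqP => E; apply: nB; right; left.
  have : s * (s * complex.Im z) = 0 by rewrite -E mulr0.
  by rewrite mulrA -expr2 s1 mul1r.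
have z0 : cmod z < L.
  by rewrite lt_neqAle h3 andbT; apply/eqP => E; apply: nB; right; right.
pose x' := if a then complex.Re z else 1.
have x0 : 0 < x'.
  rewrite /x'; case: ifPn => // ha.
  by rewrite lt_neqAle h1 // andbT; apply/eqP => E; apply: nB; left.
exists (Num.min x' (Num.min (s * complex.Im z) (L - cmod z))).
  by rewrite !lt_min x0 y0 subr_gt0 z0.
move=> h; rewrite !le_min => /and3P[k1 k2 k3].
have s2 : `|s| = 1.
  by apply/eqP; rewrite -(eqrXn2 (n := 2)) ?normr_ge0 // expr1n real_normK ?num_real ?s1.
split; last split.
- move=> ha; rewrite raddfD /=; move: k1; rewrite /x' ha => k1.
  have := le_trans (Re_le_cmod h) k1; rewrite ler_norml => /andP[? _]; lra.
- rewrite raddfD /= mulrDr; have := le_trans (Im_le_cmod h) k2.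
  rewrite -[X in X <= _]mul1r -s2 -normrM ler_norml => /andP[? _]; lra.
- by apply: le_trans (cmodD _ _) _; lra.
Qed.

(* [2 sin t + cos (2 t) >= 1] for [0 <= t <= pi]. *)
Lemma arc_aux (x y L : R) : 0 <= y -> 0 < L -> x ^+ 2 + y ^+ 2 = L ^+ 2 ->
  1 <= 2 * y / L + (x ^+ 2 - y ^+ 2) / L ^+ 2.
Proof.
move=> y0 L0 h.
have yL : y <= L.
  by rewrite -(ler_pXn2r (n := 2)) ?nnegrE ?(ltW L0) // -h lerDr sqr_ge0.
have -> : 2 * y / L + (x ^+ 2 - y ^+ 2) / L ^+ 2 = (2 * y * L + (x ^+ 2 - y ^+ 2)) / L ^+ 2.
  by field; rewrite gt_eqF.
rewrite ler_pdivlMr ?exprn_gt0 // mul1r -h.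
have := ler_wpM2l y0 yL; rewrite -expr2; lra.
Qed.

Lemma ler_poly_expR d (e : R) : 0 < e -> exists2 C, 0 < C & forall x, 0 <= x ->
  (1 + x ^+ 2) ^+ d <= C * expR (e * x).
Proof.
move=> e0; pose a := e / d.+1%:R.
have a0 : 0 < a by rewrite divr_gt0 // ltr0n.
pose K := 1 + 4 / a ^+ 2.
have K0 : 0 < K by rewrite ltr_pwDl // divr_ge0 // sqr_ge0.
exists (K ^+ d); first by rewrite exprn_gt0.
move=> x x0.
have h : 1 + x ^+ 2 <= K * expR (a * x).
  have h1 : 1 + a * x / 2 <= expR (a * x / 2) := expR_ge1Dx _.
  have h2 : (1 + a * x / 2) ^+ 2 <= expR (a * x).
    have -> : expR (a * x) = expR (a * x / 2) ^+ 2.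
      by rewrite -expRM_natl; congr expR; field.
    by rewrite lerXn2r ?nnegrE ?expR_ge0 // addr_ge0 // !mulr_ge0 // ltW.
  apply: le_trans (_ : K * (1 + a * x / 2) ^+ 2 <= _); last by rewrite ler_pM2l.
  have -> : K * (1 + a * x / 2) ^+ 2 = 1 + x ^+ 2 + (a * x + (a * x) ^+ 2 / 4 + 4 / a ^+ 2 + 4 * x / a).
    by rewrite /K; field; rewrite gt_eqF.
  have k1 : 0 <= a * x by rewrite mulr_ge0 // ltW.
  have k2 : 0 <= 4 / a ^+ 2 by rewrite divr_ge0 // sqr_ge0.
  have k3 : 0 <= 4 * x / a by rewrite divr_ge0 ?mulr_ge0 // ltW.
  have := sqr_ge0 (a * x); lra.
apply: le_trans (_ : (K * expR (a * x)) ^+ d <= _).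
  by rewrite lerXn2r ?nnegrE ?addr_ge0 ?sqr_ge0 // mulr_ge0 ?expR_ge0 // ltW.
rewrite exprMn ler_pM2l ?exprn_gt0 // -expRM_natl ler_expR mulrA ler_wpM2r //.
rewrite /a mulrA ler_pdivrMr ?ltr0n // mulrC ler_pM2l // ler_nat.
exact: leqnSn.
Qed.

(** * Polynomial growth of the Newton series *)

Section Growth.
Variables (S : A) (C0 : R) (d : nat).
Hypothesis TS : (1 + q) * S = 1.
Hypothesis hT : forall n, p ((1 + q) ^+ n) <= C0 * (1 + n%:R) ^+ d.
Hypothesis hS : forall e, 0 < e ->
  exists C, forall n, p (S ^+ n) <= C * expR (e * Num.sqrt n%:R).

Lemma newton_square n w :
  ((newton n) \Po 'X^2).[iota w] = (newton n).[iota (w ^+ 2)].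
Proof. by rewrite horner_comp hornerXn rmorphXn. Qed.

(* Phragmen-Lindelof in the quadrants of the variable [w], where [z = w ^ 2]: the
   growth of exponential type zero contributes through the harmonic function of
   [arc_aux] taken at [w ^ 2], which is nonnegative on the two axes. *)
Lemma newton_quadrant (s e : R) : s ^+ 2 = 1 -> 0 < e -> exists2 C, 0 < C &
  forall L, 0 < L -> exists n0, forall n, (n0 <= n)%N -> forall w,
  0 <= complex.Re w -> 0 <= s * complex.Im w -> cmod w <= L ->
  p (newton n).[iota (w ^+ 2)] <= C * expR (2 * e * cmod w).
Proof.
move=> s1 e0.
have [C1 C10 hneg] := newton_neg TS hS e0.
have [C2 C20 hpos] := newton_pos hT.
have [C3 C30 hC3] := ler_poly_expR d e0.
pose M := C1 + C2 * C3 + 1.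
have M0 : 0 < M by rewrite !addr_gt0 // mulr_gt0.
exists (expR 1 * M * expR 6); first by rewrite !mulr_gt0 ?expR_gt0.
move=> L L0.
(* The growth on the arc of radius [La] is at most [exp ka] up to a constant factor, and [ka] times
   the harmonic function compensates it. As [La] is large, [ka <= 2 La ^ 2 / (L ^ 2 + 1)], while
   this function is at most [3 L ^ 2 / La ^ 2] in the disc of radius [L]: the price there is at most
   6, independently of [L]. *)
pose eta := (L ^+ 2 + 1)^-1.
have L21 : 0 < L ^+ 2 + 1 by rewrite ltr_wpDl ?sqr_ge0.
have eta0 : 0 < eta by rewrite invr_gt0.
have [C4 C40 hgr] := newton_growth eta0.
pose La := L + 1 + C4 * (L ^+ 2 + 1).
have c5 : 0 < C4 * (L ^+ 2 + 1) by rewrite mulr_gt0.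
have La1 : 1 <= La by rewrite /La; lra.
have LLa : L <= La by rewrite /La; lra.
have La0 : 0 < La by lra.
have La2 : C4 * (L ^+ 2 + 1) <= La ^+ 2.
  apply: le_trans (_ : La <= _); first by rewrite /La; lra.
  by rewrite expr2 ler_peMl ?(ltW La0).
have [n1 hn1] := hneg _ (sqr_ge0 La).
have [n2 hn2] := hpos _ (sqr_ge0 La).
exists (maxn n1 n2) => n; rewrite geq_max => /andP[k1 k2] w w1 w2 w3.
pose ka := eta * La ^+ 2 + C4.
have ka0 : 0 < ka by rewrite addr_gt0 // mulr_gt0 ?exprn_gt0.
(* The linear term absorbs the growth [exp (e |w|)] on the two axes; the other two have as real part
   [- ka] times the harmonic function of [arc_aux] at [w ^ 2]. *)
pose g : {poly R[i]} := ((- e) +i* (e * s))%:P * 'X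
   + (0 +i* (2 * s * ka / La ^+ 2))%:P * ('X * 'X)
   + (- (ka / La ^+ 4) +i* 0)%:P * ('X * 'X * ('X * 'X)).
have gE z : complex.Re g.[z] = - e * (complex.Re z + s * complex.Im z)
   - ka * (4 * (s * complex.Im z) * complex.Re z / La ^+ 2 +
     ((complex.Re z ^+ 2 - complex.Im z ^+ 2) ^+ 2 -
      4 * complex.Re z ^+ 2 * complex.Im z ^+ 2) / La ^+ 4).
  rewrite /g !hornerE; case: z => x y /=; field.
  by rewrite gt_eqF.
have sy2 z : (s * complex.Im z) ^+ 2 = complex.Im z ^+ 2 by rewrite exprMn s1 mul1r.
have hbd z : disc_sector true s La z -> sector_boundary true La z ->
    p (newton n \Po 'X^2).[iota z] * expR (complex.Re g.[z]) <= M.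
  move=> [z1 [z2 z3]] hB; rewrite newton_square gE.
  have z1' := z1 isT.
  set x := complex.Re z in z1' *; set y := s * complex.Im z in z2 *.
  have hy : complex.Im z ^+ 2 = y ^+ 2 by rewrite /y sy2.
  rewrite hy.
  have zm : cmod z ^+ 2 = x ^+ 2 + y ^+ 2 by rewrite sqr_cmod hy.
  case: hB => [[_ xE]|[yE|zL]].
  + rewrite -/x in xE.
    have -> : z ^+ 2 = (- (y ^+ 2))%:C.
      rewrite /y sy2; move: xE; rewrite /x; case: (z) => a b /= ->.
      by apply/eqP; rewrite expr2 eq_complex /= !mul0r mulr0 addr0 sub0r -expr2 !eqxx.
    have yLa : 0 <= y ^+ 2 <= La ^+ 2.
      rewrite sqr_ge0 /= -[y ^+ 2]add0r -[0](expr0n _ 2) -xE -zm.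
      by rewrite lerXn2r ?nnegrE ?cmod_ge0 ?(ltW La0).
    have := hn1 n k1 _ yLa; rewrite sqrtr_sqr ger0_norm // => h.
    apply: le_trans (ler_wpM2r (expR_ge0 _) h) _; rewrite -[X in X <= _]mulrA -expRD.
    apply: le_trans (_ : C1 * 1 <= _); last by rewrite mulr1 /M; have := mulr_gt0 C20 C30; lra.
    rewrite ler_pM2l // -expR0 ler_expR xE.
    have : 0 <= ka * ((y ^+ 2) ^+ 2 / La ^+ 4).
      by rewrite mulr_ge0 ?(ltW ka0) // divr_ge0 ?sqr_ge0 // exprn_ge0 // ltW.
    by rewrite !expr0n /= !(mulr0, mul0r, add0r, addr0, subr0, sub0r) sqrrN; lra.
  + have y0 : y = 0 by rewrite /y yE mulr0.
    have -> : z ^+ 2 = (x ^+ 2)%:C.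
      move: yE; rewrite /x; case: (z) => a b /= ->.
      by apply/eqP; rewrite expr2 eq_complex /=; apply/andP; split; apply/eqP; ring.
    have xLa : 0 <= x ^+ 2 <= La ^+ 2.
      rewrite sqr_ge0 /= -[x ^+ 2]addr0 -[X in _ + X](expr0n _ 2) -y0 -zm.
      by rewrite lerXn2r ?nnegrE ?cmod_ge0 ?(ltW La0).
    have h := hn2 n k2 _ xLa.
    apply: le_trans (ler_wpM2r (expR_ge0 _) h) _.
    apply: le_trans (ler_wpM2r (expR_ge0 _) (ler_wpM2l (ltW C20) (hC3 x z1'))) _.
    rewrite [C2 * (C3 * _)]mulrA -[X in X <= _]mulrA -expRD.
    apply: le_trans (_ : C2 * C3 * 1 <= _); last by rewrite mulr1 /M; lra.
    rewrite ler_pM2l ?mulr_gt0 // -expR0 ler_expR y0.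
    have : 0 <= ka * ((x ^+ 2) ^+ 2 / La ^+ 4).
      by rewrite mulr_ge0 ?(ltW ka0) // divr_ge0 ?sqr_ge0 // exprn_ge0 // ltW.
    by rewrite !expr0n /= !(mulr0, mul0r, add0r, addr0, subr0, sub0r); lra.
  + have h := hgr n (z ^+ 2); rewrite cmodX zL in h.
    have harc := @arc_aux (x ^+ 2 - y ^+ 2) (2 * x * y) (La ^+ 2) _ _ _.
    have {}harc : 1 <= 4 * y * x / La ^+ 2 +
      ((x ^+ 2 - y ^+ 2) ^+ 2 - 4 * x ^+ 2 * y ^+ 2) / La ^+ 4.
      apply: le_trans (harc _ _ _) _.
      * by apply: mulr_ge0 => //; apply: mulr_ge0.
      * by rewrite exprn_gt0.
      * rewrite -zL zm; ring.
      * by rewrite le_eqVlt; apply/orP; left; apply/eqP; field; rewrite gt_eqF.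
    apply: le_trans (ler_wpM2r (expR_ge0 _) h) _; rewrite -[X in X <= _]mulrA -expRD.
    apply: le_trans (_ : expR C4 * expR (- C4) <= _).
      apply: ler_pM; rewrite ?expR_ge0 ?(ltW C40) //.
        by apply: le_trans (expR_ge1Dx _); lra.
      rewrite ler_expR.
      have := ler_wpM2l (ltW ka0) harc; rewrite mulr1 {1}/ka.
      have : 0 <= e * (x + y) by rewrite mulr_ge0 ?addr_ge0 // ltW.
      lra.
    by rewrite -expRD subrr expR0 /M; have := mulr_gt0 C20 C30; lra.
have := phragmen_lindelof hp (P := newton n \Po 'X^2) (g := g) (M := M)
  (@compact_disc_sector true s La) (fun z => disc_sector_interior s1)
  (fun z Kz => (proj2 (proj2 Kz))).
move=> /(_ hbd w (conj (fun=> w1) (conj w2 (le_trans w3 LLa)))).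
rewrite newton_square gE.
set x := complex.Re w in w1 *; set y := s * complex.Im w in w2 *.
rewrite -(sy2 w) -/y => h.
have zm : cmod w ^+ 2 = x ^+ 2 + y ^+ 2 by rewrite sqr_cmod /y sy2.
have wL2 : x ^+ 2 + y ^+ 2 <= L ^+ 2.
  by rewrite -zm lerXn2r ?nnegrE ?cmod_ge0 ?(ltW L0).
set u := 4 * y * x / La ^+ 2 + _ in h.
have u6 : ka * u <= 6.
  have u1 : u <= 3 * L ^+ 2 / La ^+ 2.
    have h1 : 4 * y * x <= 2 * L ^+ 2.
      have := sqr_ge0 (x - y); rewrite sqrrB; lra.
    have h2 : ((x ^+ 2 - y ^+ 2) ^+ 2 - 4 * x ^+ 2 * y ^+ 2) <= L ^+ 2 * La ^+ 2.
      apply: le_trans (_ : (x ^+ 2 + y ^+ 2) ^+ 2 <= _).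
        have : 0 <= x ^+ 2 * y ^+ 2 by rewrite mulr_ge0 ?sqr_ge0.
        by rewrite sqrrB sqrrD; lra.
      rewrite expr2; apply: ler_pM; rewrite ?addr_ge0 ?sqr_ge0 //.
      by apply: le_trans wL2 _; rewrite lerXn2r ?nnegrE ?(ltW L0) ?(ltW La0).
    have -> : u = (4 * y * x) / La ^+ 2 + ((x ^+ 2 - y ^+ 2) ^+ 2 - 4 * x ^+ 2 * y ^+ 2) / La ^+ 2 / La ^+ 2.
      by rewrite /u; field; rewrite gt_eqF.
    rewrite -mulrDl ler_pM2r ?invr_gt0 ?exprn_gt0 //.
    have : ((x ^+ 2 - y ^+ 2) ^+ 2 - 4 * x ^+ 2 * y ^+ 2) / La ^+ 2 <= L ^+ 2.
      by rewrite ler_pdivrMr ?exprn_gt0.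
    lra.
  apply: le_trans (ler_wpM2l (ltW ka0) u1) _.
  have k3 : ka <= 2 * La ^+ 2 / (L ^+ 2 + 1).
    rewrite /ka /eta ler_pdivlMr // mulrDl mulrAC mulVf ?gt_eqF // mul1r; lra.
  apply: le_trans (ler_wpM2r _ k3) _.
    by rewrite divr_ge0 ?sqr_ge0 // mulr_ge0 ?sqr_ge0.
  have -> : 2 * La ^+ 2 / (L ^+ 2 + 1) * (3 * L ^+ 2 / La ^+ 2) = 6 * L ^+ 2 / (L ^+ 2 + 1).
    by field; rewrite !gt_eqF.
  by rewrite ler_pdivrMr //; lra.
have xy : x + y <= 2 * cmod w.
  have : `|s * complex.Im w| = `|complex.Im w|.
    rewrite normrM (_ : `|s| = 1) ?mul1r //.
    by apply/eqP; rewrite -(eqrXn2 (n := 2)) ?normr_ge0 // expr1n real_normK ?num_real ?s1.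
  rewrite -/y ger0_norm // => ->.
  have := Re_le_cmod w; have := Im_le_cmod w; rewrite -/x (ger0_norm w1); lra.
have -> : p (newton n).[iota (w ^+ 2)] = p (newton n).[iota (w ^+ 2)] *
   expR (- e * (x + y) - ka * u) * expR (e * (x + y) + ka * u).
  by rewrite -mulrA -expRD (_ : - e * (x + y) - ka * u + _ = 0) ?expR0 ?mulr1 //; ring.
apply: le_trans (ler_wpM2r (expR_ge0 _) h) _.
rewrite -[X in _ <= X]mulrA -expRD ler_pM2l ?mulr_gt0 ?expR_gt0 // ler_expR addrC lerD //.
by rewrite [2 * e]mulrC -mulrA ler_pM2l.
Qed.

Lemma newton_exp_type e : 0 < e -> exists2 C, 0 < C &
  forall L, 0 < L -> exists n0, forall n, (n0 <= n)%N -> forall w, cmod w <= L ->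
  p (newton n).[iota (w ^+ 2)] <= C * expR (2 * e * cmod w).
Proof.
move=> e0.
have [C1 C10 h1] := newton_quadrant (expr1n _ 2) e0.
have [C2 C20 h2] := newton_quadrant (ltac:(by rewrite sqrrN expr1n) : (-1 : R) ^+ 2 = 1) e0.
exists (C1 + C2); first exact: addr_gt0.
move=> L L0; have [n1 {}h1] := h1 L L0; have [n2 {}h2] := h2 L L0.
exists (maxn n1 n2) => n; rewrite geq_max => /andP[k1 k2].
have key w : 0 <= complex.Re w -> cmod w <= L ->
  p (newton n).[iota (w ^+ 2)] <= (C1 + C2) * expR (2 * e * cmod w).
  move=> w0 wL; have [im|im] := leP 0 (complex.Im w).
    apply: le_trans (h1 n k1 w w0 _ wL) _; first by rewrite mul1r.
    by rewrite ler_wpM2r ?expR_ge0 // lerDl ltW.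
  apply: le_trans (h2 n k2 w w0 _ wL) _; first by rewrite mulN1r oppr_ge0 ltW.
  by rewrite ler_wpM2r ?expR_ge0 // lerDr ltW.
move=> w wL; have [|re] := leP 0 (complex.Re w); first by move/key; exact.
rewrite -sqrrN -(cmodN w); apply: key; last by rewrite cmodN.
by rewrite raddfN oppr_ge0 ltW.
Qed.
(* [1 / (w + i)] is uniformly approximated on the upper half disc by polynomials, the
   partial sums of a geometric series. *)
Lemma approx_inv_shift (La : R) : 0 < La -> exists F : {poly R[i]}, forall w,
  0 <= complex.Im w -> cmod w <= La ->
  1/2 <= cmod F.[w] * cmod (w + 'i) <= 2.
Proof.
move=> La0; pose T := La ^+ 2 + 1.
have T1 : 1 <= T by rewrite lerDr sqr_ge0.
have T0 : 0 < T by lra.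
pose b := 1 - T^-1.
have b0 : 0 <= b by rewrite subr_ge0 invf_le1.
have b1 : b < 1 by rewrite ltrBlDr ltrDl invr_gt0.
have : (fun n => b ^+ n) @ \oo --> (0 : R) by apply: cvg_expr; rewrite ger0_norm.
move=> /cvgrPdist_lt/(_ (1/4) _)[]; first lra.
move=> N _ /(_ N (leqnn N)); rewrite /= sub0r normrN ger0_norm ?exprn_ge0 // => hN.
pose c : R[i] := 0 +i* T.
have c0 : c != 0 by rewrite eq_complex /= eqxx /= gt_eqF.
pose xi : {poly R[i]} := 1 - c^-1%:P * ('X + 'i%:P).
pose F : {poly R[i]} := c^-1%:P * \sum_(k < N) xi ^+ k.
have xiE w : xi.[w] = 1 - (w + 'i) / c by rewrite /xi !hornerE mulrC.
have FE w : F.[w] * (w + 'i) = 1 - xi.[w] ^+ N.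
  have -> : F.[w] = c^-1 * \sum_(k < N) xi.[w] ^+ k.
    rewrite hornerM hornerC horner_sum; congr (_ * _).
    by apply: eq_bigr => k _; rewrite horner_exp.
  apply/eqP; rewrite eq_sym -opprB subrX1 eq_sym -subr_eq0 opprK.
  have -> : w + 'i = - c * (xi.[w] - 1) by rewrite xiE; field.
  by apply/eqP; field.
exists F => w w0 wL; rewrite -cmodM FE.
have hxi : cmod xi.[w] ^+ 2 <= b.
  have -> : cmod xi.[w] ^+ 2 = 1 - 2 * (complex.Im w + 1) / T + (cmod w ^+ 2 + 2 * complex.Im w + 1) / T ^+ 2.
    rewrite !sqr_cmod xiE /c; case: (w) => x y /=; field; by rewrite gt_eqF.
  have wL2 : cmod w ^+ 2 <= T - 1.
    by rewrite /T addrK lerXn2r ?nnegrE ?cmod_ge0 ?(ltW La0).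
  have : (cmod w ^+ 2 + 2 * complex.Im w + 1) / T ^+ 2 <= (1 + 2 * complex.Im w) / T.
    rewrite ler_pdivrMr ?exprn_gt0 // expr2 mulrA mulfVK ?gt_eqF //.
    have := mulr_ge0 w0 (ltac:(by lra) : 0 <= T - 1); lra.
  rewrite /b; lra.
have hN2 : cmod (xi.[w] ^+ N) <= 1/2.
  rewrite -(ler_pXn2r (n := 2)) ?nnegrE ?cmod_ge0 //.
  rewrite cmodX exprAC; apply: le_trans (_ : b ^+ N <= _).
    by rewrite lerXn2r ?nnegrE ?sqr_ge0.
  by rewrite expr2; lra.
have h1 := cmodB 1 (xi.[w] ^+ N); have h2 := cmodD (1 - xi.[w] ^+ N) (xi.[w] ^+ N).
rewrite cmod1 in h1; rewrite subrK cmod1 in h2.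
by apply/andP; split; lra.
Qed.

(** Second use of Phragmen-Lindelof, now in the half planes of [w], where [G(w ^ 2)] has exponential
    type zero. On the real axis it is at most a multiple of [(1 + w ^ 2) ^ d], which is the modulus
    of [(w + i) ^ (2 d)]; dividing by the latter, through its polynomial substitute [F], leaves a
    bounded function. The half planes are exchanged by [w -> - w]. *)
Lemma newton_half_plane : exists2 C, 0 < C & forall L, 0 < L ->
  exists n0, forall n, (n0 <= n)%N -> forall w, cmod w <= L ->
  p (newton n).[iota (w ^+ 2)] <= C * (1 + L) ^+ (2 * d).
Proof.
have [C2 C20 hpos] := newton_pos hT.
pose M := (C2 + 1) * 2 ^+ (2 * d).
have M0 : 0 < M by rewrite mulr_gt0 ?exprn_gt0 // addr_gt0.
exists (expR 1 * M * expR 6 * 2 ^+ (2 * d)).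
  apply: mulr_gt0; last by rewrite exprn_gt0.
  by rewrite mulr_gt0 ?expR_gt0 // mulr_gt0 ?expR_gt0.
move=> L L0.
have L1 : 0 < L + 1 by rewrite addr_gt0.
(* Same balance as in [newton_quadrant]: [ka <= 2 La / (L + 1)] and the harmonic function is at most
   [3 L / La] in the disc of radius [L], hence again the price 6. *)
pose e := (L + 1)^-1; have e0 : 0 < e by rewrite invr_gt0.
have [C4 C40 hgr] := newton_exp_type (divr_gt0 e0 (ltr0n _ 2)).
pose La := L + 1 + C4 * (L + 1).
have c5 : 0 < C4 * (L + 1) by rewrite mulr_gt0.
have LLa : L <= La by rewrite /La; lra.
have La0 : 0 < La by lra.
have [n1 hn1] := hgr _ La0.
have [n2 hn2] := hpos _ (sqr_ge0 La).
have [F hF] := approx_inv_shift La0.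
exists (maxn n1 n2) => n; rewrite geq_max => /andP[k1 k2].
have {hn1}hn1 w : cmod w <= La -> p (newton n).[iota (w ^+ 2)] <= C4 * expR (e * cmod w).
  by move=> hw; have := hn1 n k1 w hw; rewrite mulrCA mulfV ?mulr1.
pose ka := e * La + C4.
have ka0 : 0 < ka by rewrite addr_gt0 // mulr_gt0.
pose g : {poly R[i]} := (0 +i* (2 * ka / La))%:P * 'X
   + (- (ka / La ^+ 2) +i* 0)%:P * ('X * 'X).
have gE z : complex.Re g.[z] = - ka * (2 * complex.Im z / La +
     (complex.Re z ^+ 2 - complex.Im z ^+ 2) / La ^+ 2).
  rewrite /g !hornerE; case: z => x y /=; field.
  by rewrite gt_eqF.
pose P := (newton n \Po 'X^2) * map_poly iota (F ^+ (2 * d)).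
have PE w : p P.[iota w] = cmod F.[w] ^+ (2 * d) * p (newton n).[iota (w ^+ 2)].
  by rewrite hornerM newton_square horner_map mulrC (seminormZ hp) horner_exp cmodX.
have hbd z : disc_sector false 1 La z -> sector_boundary false La z ->
    p P.[iota z] * expR (complex.Re g.[z]) <= M.
  move=> [_ [z2 z3]] hB; rewrite mul1r in z2; rewrite PE gE.
  set x := complex.Re z; set y := complex.Im z in z2 *.
  have zm : cmod z ^+ 2 = x ^+ 2 + y ^+ 2 := sqr_cmod z.
  have /andP[_ hF2] := hF z z2 z3.
  have hFge : cmod F.[z] * cmod (z + 'i) <= 2 := hF2.
  have zi : 1 <= cmod (z + 'i).
    rewrite -(ler_pXn2r (n := 2)) ?nnegrE ?cmod_ge0 // expr1n sqr_cmod.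
    rewrite (_ : complex.Im (z + 'i) = y + 1); last by rewrite raddfD.
    have := sqr_ge0 (complex.Re (z + 'i)); have := sqr_ge0 y; rewrite sqrrD; lra.
  have F2 : cmod F.[z] <= 2.
    by apply: le_trans hF2; rewrite ler_peMr ?cmod_ge0.
  case: hB => [[//]|[yE|zL]].
  + rewrite -/y in yE.
    have zx : z ^+ 2 = (x ^+ 2)%:C.
      move: yE; rewrite /x /y; case: (z) => a b /= ->.
      by apply/eqP; rewrite expr2 eq_complex /=; apply/andP; split; apply/eqP; ring.
    have xLa : 0 <= x ^+ 2 <= La ^+ 2.
      rewrite sqr_ge0 /= -[x ^+ 2]addr0 -[X in _ + X](expr0n _ 2) -yE -zm.
      by rewrite lerXn2r ?nnegrE ?cmod_ge0 ?(ltW La0).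
    have h := hn2 n k2 _ xLa; rewrite -zx in h.
    have zi2 : cmod (z + 'i) ^+ 2 = 1 + x ^+ 2.
      by rewrite sqr_cmod !raddfD /= -/x -/y yE addr0 add0r expr1n addrC.
    have h3 : cmod F.[z] ^+ (2 * d) * p (newton n).[iota (z ^+ 2)] <= M.
      apply: le_trans (ler_wpM2l _ h) _; first by rewrite exprn_ge0 ?cmod_ge0.
      rewrite -zi2 -exprM mulrCA -exprMn.
      apply: ler_pM; rewrite ?exprn_ge0 ?mulr_ge0 ?cmod_ge0 ?(ltW C20) //.
        by rewrite lerDl.
      by rewrite lerXn2r ?nnegrE ?mulr_ge0 ?cmod_ge0.
    apply: le_trans (ler_wpM2r (expR_ge0 _) h3) _.
    rewrite -[X in _ <= X]mulr1 ler_pM2l // -expR0 ler_expR yE.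
    have : 0 <= ka * (x ^+ 2 / La ^+ 2).
      by rewrite mulr_ge0 ?(ltW ka0) // divr_ge0 ?sqr_ge0.
    by rewrite !expr0n /= !(mulr0, mul0r, add0r, addr0, subr0, sub0r); lra.
  + have h := hn1 z z3; rewrite zL in h.
    have harc := @arc_aux x y La z2 La0 _.
    have {}harc : 1 <= 2 * y / La + (x ^+ 2 - y ^+ 2) / La ^+ 2.
      by apply: harc; rewrite -zm zL.
    rewrite -mulrA; apply: le_trans (_ : 2 ^+ (2 * d) * 1 <= _); last first.
      by rewrite mulr1 /M ler_peMl ?exprn_ge0 // lerDr ltW.
    apply: ler_pM; rewrite ?exprn_ge0 ?cmod_ge0 ?mulr_ge0 ?expR_ge0 ?(seminorm_ge0 hp) //.
      by rewrite lerXn2r ?nnegrE ?cmod_ge0.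
    apply: le_trans (ler_wpM2r (expR_ge0 _) h) _; rewrite -[X in X <= _]mulrA -expRD.
    apply: le_trans (_ : expR C4 * expR (- C4) <= _).
      apply: ler_pM; rewrite ?expR_ge0 ?(ltW C40) //.
        by apply: le_trans (expR_ge1Dx _); lra.
      rewrite ler_expR.
      have := ler_wpM2l (ltW ka0) harc; rewrite mulr1 {1}/ka; lra.
    by rewrite -expRD subrr expR0.
have key w : 0 <= complex.Im w -> cmod w <= L ->
  p (newton n).[iota (w ^+ 2)] <= expR 1 * M * expR 6 * 2 ^+ (2 * d) * (1 + L) ^+ (2 * d).
  move=> w2 w3.
  have w3' := le_trans w3 LLa.
  have := phragmen_lindelof hp (P := P) (g := g) (M := M)
    (@compact_disc_sector false 1 La) (fun z => disc_sector_interior (expr1n _ 2))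
    (fun z Kz => (proj2 (proj2 Kz))).
  move=> /(_ hbd w (conj (fun h => False_ind _ (notF h)) (conj _ w3'))).
  rewrite mul1r => /(_ w2).
  rewrite PE gE.
  set x := complex.Re w; set y := complex.Im w in w2 *.
  have zm : cmod w ^+ 2 = x ^+ 2 + y ^+ 2 := sqr_cmod w.
  set u := 2 * y / La + _ => h.
  have u6 : ka * u <= 6.
    have u1 : u <= 3 * L / La.
      have h1 : y <= L.
        by apply: le_trans w3; have := Im_le_cmod w; rewrite -/y ger0_norm.
      have h2 : (x ^+ 2 - y ^+ 2) <= L * La.
        apply: le_trans (_ : cmod w ^+ 2 <= _).
          by rewrite zm; have := sqr_ge0 y; lra.
        by rewrite expr2; apply: ler_pM; rewrite ?cmod_ge0.
      have -> : u = (2 * y) / La + (x ^+ 2 - y ^+ 2) / La / La.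
        by rewrite /u; field; rewrite gt_eqF.
      rewrite -mulrDl ler_pM2r ?invr_gt0 //.
      have : (x ^+ 2 - y ^+ 2) / La <= L by rewrite ler_pdivrMr.
      lra.
    apply: le_trans (ler_wpM2l (ltW ka0) u1) _.
    have k3 : ka <= 2 * La / (L + 1).
      by rewrite /ka /e ler_pdivlMr // mulrDl mulrAC mulVf ?gt_eqF // mul1r /La; lra.
    apply: le_trans (ler_wpM2r _ k3) _.
      by rewrite divr_ge0 ?(ltW La0) // mulr_ge0 ?(ltW L0).
    have -> : 2 * La / (L + 1) * (3 * L / La) = 6 * L / (L + 1).
      by field; rewrite !gt_eqF.
    by rewrite ler_pdivrMr //; lra.
  have /andP[hF1 _] := hF w w2 w3'.
  have wi : cmod (w + 'i) <= 1 + L.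
    apply: le_trans (cmodD _ _) _.
    have -> : cmod ('i : R[i]) = 1 by rewrite cmod_sqrt /= expr0n expr1n add0r sqrtr1.
    by rewrite addrC lerD2l.
  have F1 : 1 <= cmod F.[w] * (2 * (1 + L)).
    have := ler_wpM2l (cmod_ge0 F.[w]) wi; lra.
  have F3 : p (newton n).[iota (w ^+ 2)] <= cmod F.[w] ^+ (2 * d) *
       p (newton n).[iota (w ^+ 2)] * (2 * (1 + L)) ^+ (2 * d).
    by rewrite mulrAC -exprMn ler_peMl ?(seminorm_ge0 hp) // exprn_ege1.
  apply: le_trans F3 _.
  have -> : cmod F.[w] ^+ (2 * d) * p (newton n).[iota (w ^+ 2)] =
   cmod F.[w] ^+ (2 * d) * p (newton n).[iota (w ^+ 2)] * expR (- ka * u) * expR (ka * u).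
    by rewrite -[RHS]mulrA -expRD mulNr addNr expR0 mulr1.
  rewrite exprMn mulrA ler_pM2r ?exprn_gt0 ?addr_gt0 // ler_pM2r ?exprn_gt0 //.
  by apply: ler_pM; rewrite ?mulr_ge0 ?exprn_ge0 ?cmod_ge0 ?(seminorm_ge0 hp) ?expR_ge0 ?ler_expR.
move=> w w3; have [|im] := leP 0 (complex.Im w); first by move/key; exact.
rewrite -sqrrN; apply: key; last by rewrite cmodN.
by rewrite raddfN oppr_ge0 ltW.
Qed.
Lemma sum_half n : \sum_(i < n) (1/2 : R) ^+ i <= 2.
Proof.
suff -> : \sum_(i < n) (1/2 : R) ^+ i = 2 - 2 * (1/2) ^+ n.
  by rewrite gerBl mulr_ge0 // exprn_ge0 //; lra.
elim: n => [|n ih]; first by rewrite big_ord0 expr0; ring.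
by rewrite big_ord_recr ih exprS /=; field.
Qed.

Lemma difference_bound (P : {poly A}) z (M r rho : R) : 2 <= rho ->
  (forall v, cmod v <= r -> p P.[iota v] <= M) -> cmod z + rho <= r ->
  p (P.[iota (z + 1)] - P.[iota z]) <= M * (2 / rho).
Proof.
move=> rho2 hP hz; have rho0 : 0 < rho by lra.
have M0 : 0 <= M.
  by apply: le_trans (hP z _); [exact: seminorm_ge0 hp _ | lra].
have hk k : p P^`N(k).[iota z] <= M / rho ^+ k.
  rewrite ler_pdivlMr ?exprn_gt0 //.
  apply: (cauchy_estimate hp _ rho0) => h hh.
  rewrite -rmorphD /=; apply: hP; apply: le_trans (cmodD _ _) _; by rewrite hh.
rewrite rmorphD /= (nderiv_taylor_wide (n := (size P).+1)) //; last exact: mulrC.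
rewrite big_ord_recl /= nderivn0 expr0 mulr1 addrC addKr.
apply: le_trans (seminorm_sum hp _ _ _) _.
apply: le_trans (_ : \sum_(i < size P) M / rho * (1/2) ^+ i <= _); last first.
  rewrite -mulr_sumr (_ : M * (2 / rho) = M / rho * 2); last by rewrite mulrA mulrAC.
  by rewrite ler_wpM2l ?sum_half // divr_ge0 // ltW.
apply: ler_sum => i _; rewrite rmorph1 expr1n mulr1.
apply: le_trans (hk _) _; rewrite /bump /= add1n exprS invfM mulrA ler_wpM2l //.
  by rewrite divr_ge0 // ltW.
rewrite -exprVn lerXn2r ?nnegrE ?invr_ge0 ?(ltW rho0) //.
by rewrite mul1r lef_pV2 ?posrE.
Qed.

(** By [newtonS], a unit difference of a truncation is [q] times the preceding truncation, so that
    [q ^ k] is a [k]-th difference at 0. Each difference over a disc that shrinks by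
    [rho = L ^ 2 / k] gains a factor [2 / rho]; against growth of order [L ^ (2 d)] the total gain
    [L ^ (- 2 k)] wins when [k > d]. *)
Theorem nilpotent_of_growth k : (d < k)%N -> p (q ^+ k) = 0.
Proof.
move=> dk; have k0 : (0 < k)%N by apply: leq_ltn_trans dk.
have [C C0' hC] := newton_half_plane.
have main L : 1 <= L -> 2 * k%:R <= L ^+ 2 ->
    p (q ^+ k) <= C * (1 + L) ^+ (2 * d) * (2 * k%:R / L ^+ 2) ^+ k.
  move=> L1 kL; have L0 : 0 < L by lra.
  have [n0 hn0] := hC L L0.
  pose rho := L ^+ 2 / k%:R.
  have kr : 0 < k%:R :> R by rewrite ltr0n.
  have rho2 : 2 <= rho by rewrite ler_pdivlMr.
  have rho0 : 0 < rho by lra.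
  have ind i : forall m, (n0 <= m)%N -> forall z, cmod z + i%:R * rho <= L ^+ 2 ->
      p (q ^+ i * (newton m).[iota z]) <= C * (1 + L) ^+ (2 * d) * (2 / rho) ^+ i.
    elim: i => [|i ih] m hm z hz.
      rewrite !expr0 mul1r mulr1 -[z]sqr_sqrtc; apply: hn0 => //.
      rewrite -(ler_pXn2r (n := 2)) ?nnegrE ?cmod_ge0 ?(ltW L0) //.
      by rewrite -cmodX sqr_sqrtc; move: hz; rewrite mul0r addr0.
    have E : q ^+ i.+1 * (newton m).[iota z] =
       ((q ^+ i)%:P * newton m.+1).[iota (z + 1)] - ((q ^+ i)%:P * newton m.+1).[iota z].
      by rewrite !hornerM !hornerC newtonS exprS; ring.
    rewrite E exprSr [X in _ <= X]mulrA.
    apply: (@difference_bound _ _ _ (L ^+ 2 - i%:R * rho)) => //.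
      move=> v hv; rewrite hornerM hornerC; apply: ih; first exact: leq_trans (leqnSn _).
      by rewrite -lerBrDr.
    by move: hz; rewrite mulrSr mulrDl mul1r; lra.
  have := ind k n0 (leqnn _) 0; rewrite newton0 mulr1 cmod0 add0r.
  rewrite (_ : 2 / rho = 2 * k%:R / L ^+ 2); last by rewrite /rho invf_div mulrA.
  by apply; rewrite /rho mulrCA mulfV ?mulr1 ?gt_eqF.
apply/eqP; rewrite eq_le (seminorm_ge0 hp) andbT leNgt; apply/negP => pk.
pose K := C * 2 ^+ (2 * d) * (2 * k%:R) ^+ k.
have K0 : 0 <= K by rewrite !mulr_ge0 ?exprn_ge0 ?mulr_ge0 // ltW.
(* Large enough for [2 k <= L ^ 2] and for [K / L ^ 2 < p (q ^ k)], which contradicts the estimate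
   [main]. *)
pose L := 1 + 2 * k%:R + K / p (q ^+ k).
have Kp : 0 <= K / p (q ^+ k) by rewrite divr_ge0 // ltW.
have k0r : 0 <= k%:R :> R by [].
have L1 : 1 <= L by rewrite /L; lra.
have L0 : 0 < L by lra.
have L2 : L <= L ^+ 2 by rewrite expr2 ler_peMl // ltW.
have := main L L1; rewrite (le_trans _ L2); last by rewrite /L; lra.
move=> /(_ isT) h.
have : p (q ^+ k) <= K / L ^+ 2.
  apply: le_trans h _.
  apply: le_trans (_ : C * (2 * L) ^+ (2 * d) * (2 * k%:R / L ^+ 2) ^+ k <= _).
    rewrite ler_wpM2r ?exprn_ge0 ?divr_ge0 ?mulr_ge0 ?exprn_ge0 ?(ltW L0) //.
    rewrite ler_pM2l // lerXn2r ?nnegrE; lra.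
  have -> : k = (d + (k - d.+1).+1)%N by rewrite addnS -addSn subnKC.
  set j := (k - d.+1)%N.
  rewrite [(2 * L) ^+ _]exprMn expr_div_n.
  have -> : (L ^+ 2) ^+ (d + j.+1) = L ^+ (2 * d) * (L ^+ (2 * j) * L ^+ 2).
    by rewrite -exprM mulnDr exprD mulnS [(2 + _)%N]addnC exprD.
  rewrite /K -/j (_ : k = (d + j.+1)%N); last by rewrite /j addnS -addSn subnKC.
  set X := (2 * _) ^+ (d + j.+1).
  have -> : C * (2 ^+ (2 * d) * L ^+ (2 * d)) * (X / (L ^+ (2 * d) * (L ^+ (2 * j) * L ^+ 2)))
     = C * 2 ^+ (2 * d) * X / L ^+ 2 / L ^+ (2 * j).
    by field; rewrite !expf_neq0 // gt_eqF.
  have X0 : 0 <= X by rewrite exprn_ge0 // mulr_ge0.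
  rewrite ler_pdivrMr ?exprn_gt0 // ler_peMr ?exprn_ege1 //.
  by rewrite divr_ge0 ?sqr_ge0 // !mulr_ge0 ?exprn_ge0 // ltW.
rewrite leNgt => /negP; apply.
rewrite ltr_pdivrMr ?exprn_gt0 // mulrC -ltr_pdivrMr //.
by apply: lt_le_trans L2; rewrite /L; lra.
Qed.

End Growth.
End NewtonSeries.

(** * The Gelfand-Hille theorem with a real exponent *)

Section GelfandHille.
Context {R : realType} {A : comNzRingType} (iota : {rmorphism R[i] -> A}).
Context (p : A -> R) (hp : seminorm_axioms iota p).

Lemma exprD1_expansion (q : A) n : exists y,
  (1 + q) ^+ n = 1 + n%:R * q + q ^+ 2 * y.
Proof.
elim: n => [|n [y ih]]; first by exists 0; rewrite expr0 mul0r mulr0 !addr0.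
by exists (n%:R + y + y * q); rewrite exprS ih mulrSr; ring.
Qed.

Lemma exprD_expansion (a b : A) n : exists y, (a + b) ^+ n = a ^+ n + b * y.
Proof.
elim: n => [|n [y ih]]; first by exists 0; rewrite !expr0 mulr0 addr0.
by exists (a * y + a ^+ n + b * y); rewrite !exprS ih; ring.
Qed.

Lemma natr_powR_unbounded (K r : R) : 0 < r -> exists2 n, (0 < n)%N & K < n%:R `^ r.
Proof.
move=> r0; pose X := (`|K| + 1) `^ r^-1.
exists (Num.truncn X).+1 => //.
have K1 : 0 <= `|K| + 1 by rewrite addr_ge0.
apply: lt_le_trans (_ : `|K| + 1 <= _).
  by apply: le_lt_trans (ler_norm K) _; rewrite ltrDl.
have -> : `|K| + 1 = X `^ r by rewrite -powRrM mulVf ?gt_eqF // powRr1.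
apply: ge0_ler_powR; rewrite ?nnegrE ?powR_ge0 ?(ltW r0) //.
exact: ltW (truncnS_gt X).
Qed.

(** [nilpotent_of_growth] wants an integer exponent; used with [m] it only gives
    [p (q ^ (m + 1)) = 0]. Then [((1 + q) ^ n - 1) ^ m] equals [n ^ m q ^ m] modulo [q ^ (m + 1)];
    since the left-hand side grows like [n ^ s] with [s < m], the seminorm of [q ^ m] is 0 as
    well. *)
Theorem gelfand_hille (q S : A) (C0 s : R) m : 0 <= s -> s < m%:R ->
  (forall w, approx_unit p (1 - iota w * q)) ->
  (1 + q) * S = 1 ->
  (forall n, p ((1 + q) ^+ n) <= C0 * (1 + n%:R) `^ s) ->
  (forall e, 0 < e -> exists C, forall n, p (S ^+ n) <= C * expR (e * Num.sqrt n%:R)) ->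
  p (q ^+ m) = 0.
Proof.
move=> s0 sm hinv TS hT hS.
have hq := quasinilpotent_exprn hp hinv.
have C00 : 0 <= C0.
  have := hT 0%N; rewrite addr0 powR1 mulr1; apply: le_trans; exact: seminorm_ge0 hp _.
have hT' n : p ((1 + q) ^+ n) <= C0 * (1 + n%:R) ^+ m.
  apply: le_trans (hT n) _; rewrite ler_wpM2l // -powR_mulrn ?addr_ge0 //.
  by apply: ler_powR; [rewrite lerDl | exact: ltW].
have h0 := nilpotent_of_growth hp hq TS hT' hS (ltnSn m).
have hx x : p (q ^+ m.+1 * x) = 0.
  apply/eqP; rewrite eq_le (seminorm_ge0 hp) andbT.
  by apply: le_trans (seminormM hp _ _) _; rewrite h0 mul0r.
pose K := m.+1%:R * 2 ^+ m * C0 * (m.+1)%:R `^ s.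
have key n : (0 < n)%N -> n%:R ^+ m * p (q ^+ m) <= K * n%:R `^ s.
  move=> n0.
  have [y hy] := exprD1_expansion q n.
  have [z hz] := exprD_expansion n%:R (q * y) m.
  have E : ((1 + q) ^+ n - 1) ^+ m = n%:R ^+ m * q ^+ m + q ^+ m.+1 * (y * z).
    have -> : (1 + q) ^+ n - 1 = q * (n%:R + q * y) by rewrite hy; ring.
    by rewrite exprMn hz exprS; ring.
  have -> : n%:R ^+ m * p (q ^+ m) = p (n%:R ^+ m * q ^+ m).
    by rewrite -(rmorph_nat iota) -rmorphXn /= (seminormZ hp) cmodX cmod_nat.
  have -> : n%:R ^+ m * q ^+ m = ((1 + q) ^+ n - 1) ^+ m - q ^+ m.+1 * (y * z).
    by rewrite E addrK.
  apply: le_trans (seminormB hp _ _) _; rewrite hx addr0 exprBn.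
  apply: le_trans (seminorm_sum hp _ _ _) _.
  have -> : K * n%:R `^ s = \sum_(i < m.+1) 2 ^+ m * (C0 * ((m.+1)%:R `^ s * n%:R `^ s)).
    by rewrite sumr_const card_ord -[RHS]mulr_natl /K !mulrA.
  apply: ler_sum => i _.
  rewrite -mulr_natl -(rmorph_nat iota) (seminormZ hp) cmod_nat.
  apply: ler_pM; rewrite ?(seminorm_ge0 hp) //.
    rewrite -natrX ler_nat; have hi := ltn_ord i; rewrite ltnS in hi.
    rewrite -[2%N]/(1 + 1)%N expnDn.
    rewrite (bigD1 (Ordinal (ltn_ord i))) //= !exp1n !muln1; exact: leq_addr.
  rewrite expr1n mulr1.
  have -> : p ((-1) ^+ i * (1 + q) ^+ n ^+ (m - i)) = p ((1 + q) ^+ (n * (m - i))).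
    rewrite -exprM -[-1](rmorphN1 iota) -rmorphXn /= (seminormZ hp) cmodX cmodN cmod1.
    by rewrite expr1n mul1r.
  apply: le_trans (hT _) _; rewrite ler_wpM2l // -powRM //.
  apply: ge0_ler_powR; rewrite ?nnegrE ?addr_ge0 ?mulr_ge0 //.
  rewrite -natrM -(natrD _ 1) ler_nat mulSn addnC; apply: leq_trans (_ : n * m + n <= _)%N.
    by apply: leq_add => //; rewrite leq_mul2l leq_subr orbT.
  by rewrite mulnC addnC.
apply/eqP; rewrite eq_le (seminorm_ge0 hp) andbT leNgt; apply/negP => pk.
have sm0 : 0 < m%:R - s by rewrite subr_gt0.
have [n n0 hn] := natr_powR_unbounded (K / p (q ^+ m)) sm0.
have nr : 0 < n%:R :> R by rewrite ltr0n.
have := key n n0; rewrite leNgt => /negP; apply.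
move: hn; rewrite powRB ?gt_eqF // ?implybT //.
rewrite powR_mulrn // ltr_pdivrMr // => hn.
rewrite -ltr_pdivlMr ?powR_gt0 //.
by rewrite mulrAC.
Qed.

End GelfandHille.

(** * Fourier coefficients of continuous functions *)

Section CircleTopology.
Context {R : realType}.
Implicit Types (z w : circle R) (f g : circle R -> R[i]).

Lemma nbhs_cmodP (x : R[i]) (P : set R[i]) :
  nbhs x P <-> exists2 d : R, 0 < d & forall y, cmod (x - y) < d -> P y.
Proof.
split.
  move=> /nbhs_ballP[e /= e0 h].
  have eE : e = (complex.Re e)%:C.
    by rewrite RRe_real // ger0_real // ltW.
  exists (complex.Re e); first by rewrite -ltcR -eE.
  by move=> y hy; apply: h; rewrite /ball /= cmodE eE ltcR.
move=> [d d0 h]; apply/nbhs_ballP; exists d%:C => /=; first by rewrite ltcR.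
by move=> y; rewrite /ball /= cmodE ltcR => /h.
Qed.

Lemma nbhs_circleP z (P : set (circle R)) :
  nbhs z P <-> exists2 d : R, 0 < d & forall w, cmod (set_val z - set_val w) < d -> P w.
Proof.
split.
  rewrite nbhsE => -[B [[U oU UB] Bz] hB].
  rewrite -UB in Bz hB.
  have /nbhs_cmodP[d d0 h] : nbhs (set_val z : R[i]) U by apply: open_nbhs_nbhs.
  by exists d => // w /h Uw; apply: hB.
move=> [d d0 h].
have : nbhs (set_val z) [set y | cmod (set_val z - y) < d].
  by apply/nbhs_cmodP; exists d.
move=> /(@initial_continuous _ _ (set_val : circle R -> R[i]) z).
move=> H; have {}H : nbhs z ((set_val : circle R -> R[i]) @^-1` [set y | cmod (set_val z - y) < d]) := H.
by apply: (filterS _ H) => w /h.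
Qed.

Lemma continuous_circleP f : continuous f <-> forall z (e : R), 0 < e ->
  exists2 d : R, 0 < d & forall w, cmod (set_val z - set_val w) < d -> cmod (f z - f w) < e.
Proof.
split=> [cf z e e0|h z P].
  have : nbhs (f z) [set y | cmod (f z - y) < e] by apply/nbhs_cmodP; exists e.
  by move=> /cf /nbhs_circleP.
move=> /nbhs_cmodP[e e0 he]; apply/nbhs_circleP.
by have [d d0 hd] := h z e e0; exists d => // w /hd /he.
Qed.

Lemma cmod_circle z : cmod (set_val z) = 1.
Proof. by have /set_mem := svalP z; rewrite /circle /= /cmod => ->. Qed.

Lemma circle_neq0 z : set_val z != 0 :> R[i].
Proof. by rewrite -cmod_eq0 cmod_circle oner_eq0. Qed.

Lemma circle_inj z w : set_val z = set_val w :> R[i] -> z = w.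
Proof. exact: val_inj. Qed.

Lemma circle_of (x : R[i]) : cmod x = 1 -> exists z : circle R, set_val z = x.
Proof.
move=> h; have hx : x \in circle R by rewrite inE /circle /= cmodE h.
by exists (exist _ x hx).
Qed.

Lemma val_expi (t : R) : set_val (expi t) = cos t +i* sin t.
Proof. by []. Qed.

Lemma expi_surj z : exists2 t, 0 <= t <= 2 * pi & z = expi t.
Proof.
have := cmod_circle z; set x := set_val z => h1.
have h2 : complex.Re x ^+ 2 + complex.Im x ^+ 2 = 1 by rewrite -sqr_cmod h1 expr1n.
have hx : -1 <= complex.Re x <= 1.
  by rewrite -ler_norml -h1 Re_le_cmod.
have c0 := acos_ge0 hx; have c1 := acos_lepi hx.
have s2 : sin (acos (complex.Re x)) = `|complex.Im x|.
  by rewrite sin_acos // -h2 addrAC subrr add0r sqrtr_sqr.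
have p0 := pi_ge0 R.
have [y0|y0] := leP 0 (complex.Im x).
  exists (acos (complex.Re x)); first by apply/andP; split; lra.
  apply: circle_inj; rewrite val_expi acosK // s2 ger0_norm //.
  by rewrite -/x; case: (x).
exists (2 * pi - acos (complex.Re x)); first by apply/andP; split; lra.
apply: circle_inj; rewrite val_expi.
have -> : cos (2 * pi - acos (complex.Re x)) = complex.Re x.
  by rewrite mulr_natl addrC cosD2pi cosN acosK.
have -> : sin (2 * pi - acos (complex.Re x)) = complex.Im x.
  by rewrite mulr_natl addrC sinD2pi sinN s2 ltr0_norm // opprK.
by rewrite -/x; case: (x).
Qed.

Lemma expi_mul (s t : R) :
  set_val (expi (s + t)) = set_val (expi s) * set_val (expi t) :> R[i].
Proof.
rewrite !val_expi cosD sinD; apply/eqP; rewrite eq_complex /=.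
by apply/andP; split; apply/eqP; ring.
Qed.

Lemma expi0 : set_val (expi 0) = 1 :> R[i].
Proof. by rewrite val_expi cos0 sin0. Qed.

Lemma expi_nat (t : R) (n : nat) : set_val (expi (n%:R * t)) = set_val (expi t) ^+ n :> R[i].
Proof.
elim: n => [|n ih]; first by rewrite mul0r expi0.
by rewrite mulrSr mulrDl mul1r expi_mul ih exprSr.
Qed.

Lemma expiN (t : R) : set_val (expi (- t)) = (set_val (expi t))^-1 :> R[i].
Proof.
have := expi_mul t (- t); rewrite subrr expi0 => h.
by apply: (mulfI (circle_neq0 (expi t))); rewrite -h mulfV // circle_neq0.
Qed.

Lemma expi_int (t : R) (n : int) : set_val (expi (n%:~R * t)) = set_val (expi t) ^ n :> R[i].
Proof.
case: n => n; first by rewrite -exprnP expi_nat.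
by rewrite NegzE mulrNz mulNr expiN -exprnN expi_nat.
Qed.

Lemma continuous_expi : continuous (@expi R).
Proof.
move=> t P /nbhs_circleP[d d0 hd].
have : \forall s \near t, `|cos t - cos s| < d / 2 /\ `|sin t - sin s| < d / 2.
  near=> s; split; near: s.
    by have /cvgrPdist_lt/(_ (d/2)) := @continuous_cos R t; apply; rewrite divr_gt0.
  by have /cvgrPdist_lt/(_ (d/2)) := @continuous_sin R t; apply; rewrite divr_gt0.
apply: filterS => s [h1 h2]; apply: hd.
by apply: le_lt_trans (cmod_le_ReIm _) _; rewrite /= (splitr d) ltrD.
Unshelve. all: by end_near. Qed.

(** Compactness of the circle in its near-covering form, transported from [[0, 2 pi]] by [expi]. *)
Lemma circle_near_covering (I : Type) (F : set_system I) (P : I -> circle R -> Prop) :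
  Filter F ->
  (forall z, exists2 d : R, 0 < d & exists2 A, F A &
     forall i w, A i -> cmod (set_val z - set_val w) < d -> P i w) ->
  exists2 A, F A & forall i, A i -> forall w, P i w.
Proof.
move=> FF h.
have := @segment_compact R 0 (2 * pi).
move=> /compact_near_coveringP/(_ I F (fun i t => P i (expi t)) FF).
move=> hcov; exists [set i | `[0, 2 * pi] `<=` (fun t => P i (expi t))]; last first.
  by move=> i hi w; have [t ht ->] := expi_surj w; apply: hi; rewrite /= in_itv.
apply: hcov => t _; have [d d0 [A FA hA]] := h (expi t).
have ht : nbhs t [set s | cmod (set_val (expi t) - set_val (expi s)) < d].
  by apply: (@continuous_expi t [set w | cmod (set_val (expi t) - set_val w) < d]); apply/nbhs_circleP; exists d.
exists ([set s | cmod (set_val (expi t) - set_val (expi s)) < d], A) => //.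
by move=> [s i] /= [hs Ai]; exact: hA hs.
Qed.

Lemma circle_uniform_continuous f : continuous f -> forall e : R, 0 < e ->
  exists2 d : R, 0 < d & forall z w, cmod (set_val z - set_val w) < d -> cmod (f z - f w) < e.
Proof.
move=> /continuous_circleP cf e e0.
have [|A] := @circle_near_covering R (at_right 0) (fun d z =>
  forall w, cmod (set_val z - set_val w) < d -> cmod (f z - f w) < e) _.
  move=> z; have [d d0 hd] := cf z (e/2) (ltac:(by rewrite divr_gt0)).
  exists (d / 2); first by rewrite divr_gt0.
  exists [set x | x < d / 2].
    by apply: nbhs_right_lt; rewrite divr_gt0.
  move=> x w /= xd hw v hv.
  have -> : f w - f v = (f z - f v) - (f z - f w) by ring.
  apply: le_lt_trans (cmodB _ _) _; rewrite (splitr e) ltrD // hd //; last first.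
    by apply: lt_trans hw _; rewrite ltr_pdivrMr // ltr_pMr // ltr1n.
  have -> : set_val z - set_val v = (set_val z - set_val w) + (set_val w - set_val v) :> R[i] by ring.
  apply: le_lt_trans (cmodD _ _) _; rewrite (splitr d) ltrD //.
  exact: lt_trans hv _.
move=> FA hA.
have [d [/= d0 Ad]] : exists d : R, 0 < d /\ A d.
  have : \forall x \near 0^'+, 0 < x /\ A x.
    by near=> x; split; near: x => //; exact: nbhs_right_gt.
  by move=> /filter_ex.
by exists d => // z w; exact: hA.
Unshelve. all: by end_near. Qed.

Lemma circle_bounded f : continuous f -> exists2 M : R, 0 < M & forall z, cmod (f z) <= M.
Proof.
move=> /continuous_circleP cf.
have [|A [M [_ hM]] hA] := @circle_near_covering R +oo (fun M z => cmod (f z) <= M) _.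
  move=> z; have [d d0 hd] := cf z 1 ltr01; exists d => //.
  exists [set x | cmod (f z) + 1 < x].
    by exists (cmod (f z) + 1); split => //; rewrite num_real.
  move=> x w /= hx /hd h; apply: ltW; apply: le_lt_trans hx.
  have -> : f w = f z - (f z - f w) by ring.
  by apply: le_trans (cmodB _ _) _; rewrite lerD2l ltW.
pose K := `|M| + 1.
have K0 : 0 < K by rewrite ltr_wpDl.
exists K => // z; apply: hA; apply: hM => /=.
by apply: le_lt_trans (ler_norm _) _; rewrite ltrDl.
Qed.

End CircleTopology.

(** * Uniform continuity and mean values on the circle *)

Section Mean.
Context {R : realType}.
Implicit Types (z w : circle R) (f g : circle R -> R[i]) (h k : circle R -> R).

(** On the compact circle this uniform continuity is equivalent to continuity ([ccontP]); it is
    stated with the real-valued modulus so that its stability properties are elementary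
    estimates. *)
Definition ccont f : Prop := forall e : R, 0 < e -> exists2 d : R, 0 < d &
  forall z w, cmod (set_val z - set_val w) < d -> cmod (f z - f w) < e.

Definition rcont h : Prop := forall e : R, 0 < e -> exists2 d : R, 0 < d &
  forall z w, cmod (set_val z - set_val w) < d -> `|h z - h w| < e.

Lemma ccontP f : continuous f <-> ccont f.
Proof.
split; first by move=> cf e e0; exact: circle_uniform_continuous.
move=> cf; apply/continuous_circleP => z e e0.
by have [d d0 hd] := cf e e0; exists d => // w; exact: hd.
Qed.

Lemma ccont_Re f : ccont f -> rcont (fun z => complex.Re (f z)).
Proof.
move=> cf e e0; have [d d0 hd] := cf e e0; exists d => // z w /hd.
by apply: le_lt_trans; rewrite -raddfB; exact: Re_le_cmod.
Qed.

Lemma ccont_Im f : ccont f -> rcont (fun z => complex.Im (f z)).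
Proof.
move=> cf e e0; have [d d0 hd] := cf e e0; exists d => // z w /hd.
by apply: le_lt_trans; rewrite -raddfB; exact: Im_le_cmod.
Qed.

Lemma ler_dist_cmod (x y : R[i]) : `|cmod x - cmod y| <= cmod (x - y).
Proof.
rewrite ler_norml; apply/andP; split.
  have := cmodD (y - x) x; rewrite subrK cmodBC; lra.
by have := cmodD (x - y) y; rewrite subrK; lra.
Qed.

Lemma ccont_lift h : rcont h -> ccont (fun z => (h z)%:C : R[i]).
Proof.
move=> cf e e0; have [d d0 hd] := cf e e0; exists d => // z w /hd.
by rewrite -rmorphB cmod_real.
Qed.

Lemma ccont_cst (c : R[i]) : ccont (fun=> c).
Proof. by move=> e e0; exists 1 => // z w _; rewrite subrr cmod0. Qed.

Lemma rcont_cst (c : R) : rcont (fun=> c).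
Proof. by move=> e e0; exists 1 => // z w _; rewrite subrr normr0. Qed.

Lemma ccont_val : ccont (fun z => set_val z).
Proof. by move=> e e0; exists e. Qed.

Lemma ccontD f g : ccont f -> ccont g -> ccont (fun z => f z + g z).
Proof.
move=> cf cg e e0; have e2 : 0 < e / 2 by rewrite divr_gt0.
have [d1 d10 h1] := cf _ e2; have [d2 d20 h2] := cg _ e2.
exists (Num.min d1 d2); first by rewrite lt_min d10.
move=> z w; rewrite lt_min => /andP[/h1 k1 /h2 k2].
by rewrite opprD addrACA; apply: le_lt_trans (cmodD _ _) _; rewrite (splitr e) ltrD.
Qed.

Lemma ccont_bounded f : ccont f -> exists2 M : R, 0 < M & forall z, cmod (f z) <= M.
Proof. by move=> /ccontP; exact: circle_bounded. Qed.

Lemma ccontM f g : ccont f -> ccont g -> ccont (fun z => f z * g z).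
Proof.
move=> cf cg; have [M M0 hM] := ccont_bounded cf; have [N N0 hN] := ccont_bounded cg.
move=> e e0; have e1 : 0 < e / 2 / N by rewrite !divr_gt0.
have e2 : 0 < e / 2 / M by rewrite !divr_gt0.
have [d1 d10 h1] := cf _ e1; have [d2 d20 h2] := cg _ e2.
exists (Num.min d1 d2); first by rewrite lt_min d10.
move=> z w; rewrite lt_min => /andP[/h1 k1 /h2 k2].
have -> : f z * g z - f w * g w = (f z - f w) * g z + f w * (g z - g w) by ring.
apply: le_lt_trans (cmodD _ _) _; rewrite !cmodM (splitr e); apply: ltrD.
  apply: le_lt_trans (ler_wpM2l (cmod_ge0 _) (hN z)) _.
  by rewrite -ltr_pdivlMr.
apply: le_lt_trans (ler_wpM2r (cmod_ge0 _) (hM w)) _.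
by rewrite mulrC -ltr_pdivlMr.
Qed.

Lemma rcont_comp_Re h : rcont h <-> ccont (fun z => (h z)%:C).
Proof. by split=> [/ccont_lift|/ccont_Re]. Qed.

Lemma rcontD h k : rcont h -> rcont k -> rcont (fun z => h z + k z).
Proof.
move=> /ccont_lift ch /ccont_lift ck; have := ccont_Re (ccontD ch ck).
by apply.
Qed.

Lemma rcontZ (c : R) h : rcont h -> rcont (fun z => c * h z).
Proof.
move=> /ccont_lift ch; apply/rcont_comp_Re.
have := ccontM (ccont_cst c%:C) ch; congr ccont; apply/funext => z.
by rewrite rmorphM.
Qed.

Lemma ccontX f n : ccont f -> ccont (fun z => f z ^+ n).
Proof.
move=> cf; elim: n => [|n ih]; first exact: (ccont_cst 1).
have := ccontM cf ih; congr ccont; apply/funext => z.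
by rewrite exprS.
Qed.

Lemma circle_inv z : (set_val z)^-1 = ((set_val z)^*)%C :> R[i].
Proof.
apply: (mulfI (circle_neq0 z)); rewrite mulfV ?circle_neq0 // -sqr_normc.
by rewrite cmodE cmod_circle expr1n.
Qed.

Lemma ccont_inv : ccont (fun z => (set_val z)^-1).
Proof.
move=> e e0; exists e => // z w.
by rewrite !circle_inv -rmorphB /= /cmod normcJ.
Qed.

Lemma ccont_char n : ccont (fun z => set_val z ^ n).
Proof.
case: n => n; first exact: (ccontX n ccont_val).
have := ccontX n.+1 ccont_inv; congr ccont; apply/funext => z.
by rewrite NegzE -exprnN exprVn.
Qed.

Lemma ccont_sum (I : Type) (r : seq I) (F : I -> circle R -> R[i]) :
  (forall i, ccont (F i)) -> ccont (fun z => \sum_(i <- r) F i z).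
Proof.
move=> h; elim: r => [|i r ih].
  have := ccont_cst 0; congr ccont; apply/funext => z; by rewrite big_nil.
have := ccontD (h i) ih; congr ccont; apply/funext => z.
by rewrite big_cons.
Qed.

Lemma ccont_uniform_limit f :
  (forall e : R, 0 < e -> exists2 g, ccont g & forall z, cmod (f z - g z) <= e) -> ccont f.
Proof.
move=> H e e0; have e4 : 0 < e / 4 by rewrite divr_gt0.
have [g cg hg] := H _ e4; have [d d0 hd] := cg _ e4.
exists d => // z w /hd h.
have -> : f z - f w = (f z - g z) + (g z - g w) - (f w - g w) by ring.
have := cmodB (f z - g z + (g z - g w)) (f w - g w).
have := cmodD (f z - g z) (g z - g w).
have := hg z; have := hg w; lra.
Qed.

Definition rmean h : R :=
  (2 * pi)^-1 * \int[lebesgue_measure]_(t in `[0, 2 * pi]) h (expi t).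

Definition mean f : R[i] :=
  rmean (fun z => complex.Re (f z)) +i* rmean (fun z => complex.Im (f z)).

Lemma fourier_coefE f n : fourier_coef f n = mean (fun z => f z * set_val z ^ (- n)).
Proof.
rewrite /fourier_coef /mean /rmean.
have E t : set_val (expi (- (n%:~R * t))) = set_val (expi t) ^ (- n) :> R[i].
  by rewrite -mulNr -mulrNz expi_int.
under eq_Rintegral => t _ do rewrite E.
under [X in _ * (_ +i* X)]eq_Rintegral => t _ do rewrite E.
by apply/eqP; rewrite eq_complex /= !(mul0r, subr0, addr0) !eqxx.
Qed.

Lemma rcont_continuous h : rcont h -> continuous h.
Proof.
move=> ch z P /nbhs_ballP[e /= e0 he]; apply/nbhs_circleP.
by have [d d0 hd] := ch e e0; exists d => // w /hd /he.
Qed.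

Lemma integrable_circle h : rcont h ->
  lebesgue_measure.-integrable `[0, 2 * pi] (EFin \o (fun t => h (expi t))).
Proof.
move=> ch; apply: continuous_compact_integrable; first exact: segment_compact.
apply: continuous_subspaceT => t.
apply: (@continuous_comp _ _ _ (@expi R) h); first exact: continuous_expi.
exact: rcont_continuous.
Qed.

Lemma pi2_gt0 : 0 < 2 * pi :> R.
Proof. by rewrite mulr_gt0 // pi_gt0. Qed.

Lemma rmeanD h k : rcont h -> rcont k ->
  rmean (fun z => h z + k z) = rmean h + rmean k.
Proof.
move=> /integrable_circle ch /integrable_circle ck.
by rewrite /rmean (RintegralD _ ch ck) // mulrDr.
Qed.

Lemma rmeanZ (c : R) h : rcont h -> rmean (fun z => c * h z) = c * rmean h.
Proof.
move=> /integrable_circle ch.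
by rewrite /rmean RintegralZl // mulrCA.
Qed.

Lemma ler_rmean h k : rcont h -> rcont k -> (forall z, h z <= k z) ->
  rmean h <= rmean k.
Proof.
move=> /integrable_circle ch /integrable_circle ck hk.
rewrite ler_pM2l ?invr_gt0 ?pi2_gt0 //.
by apply: le_Rintegral.
Qed.

Lemma rmean_cst (c : R) : rmean (fun=> c) = c.
Proof.
rewrite /rmean Rintegral_cst //= lebesgue_measure_itv /= lte_fin pi2_gt0 /=.
by rewrite subr0 mulrCA mulVf ?mulr1 // gt_eqF // pi2_gt0.
Qed.

Lemma meanD f g : ccont f -> ccont g ->
  mean (fun z => f z + g z) = mean f + mean g.
Proof.
move=> cf cg; apply/eqP; rewrite eq_complex /=.
rewrite -(rmeanD (ccont_Re cf) (ccont_Re cg)) -(rmeanD (ccont_Im cf) (ccont_Im cg)).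
by apply/andP; split; apply/eqP; congr rmean; apply/funext => z; rewrite raddfD.
Qed.

Lemma meanZ (c : R[i]) f : ccont f -> mean (fun z => c * f z) = c * mean f.
Proof.
case: c => a b cf; apply/eqP; rewrite eq_complex /=.
have cR := ccont_Re cf; have cI := ccont_Im cf.
rewrite -(rmeanZ a cR) -(rmeanZ b cR) -(rmeanZ a cI) -(rmeanZ b cI) -mulN1r.
rewrite -(rmeanZ (-1) (rcontZ b cI)).
rewrite -(rmeanD (rcontZ a cR) (rcontZ (-1) (rcontZ b cI))).
rewrite -(rmeanD (rcontZ a cI) (rcontZ b cR)).
apply/andP; split; apply/eqP; congr rmean; apply/funext => z.
  by case: (f z) => x y /=; ring.
by case: (f z) => x y /=; ring.
Qed.

(** The mean being taken componentwise, the usual rotation is needed: for [m = mean f], the square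
    of [cmod m] is the mean of the real part of the conjugate of [m] times [f], which is at most
    [cmod m * h]. *)
Lemma cmod_mean_le f h : ccont f -> rcont h ->
  (forall z, cmod (f z) <= h z) -> cmod (mean f) <= rmean h.
Proof.
move=> cf ch hf; set m := mean f.
have [m0|m0] := eqVneq (cmod m) 0.
  rewrite m0 -(rmean_cst 0); apply: ler_rmean => //; first exact: rcont_cst.
  by move=> z; apply: le_trans (hf z); exact: cmod_ge0.
have mp : 0 < cmod m by rewrite lt_neqAle eq_sym m0 cmod_ge0.
rewrite -(ler_pM2l mp) -expr2.
have -> : cmod m ^+ 2 = complex.Re ((m^*)%C * m).
  by rewrite sqr_cmod; case: (m) => x y /=; rewrite mulNr opprK !expr2.
rewrite -(meanZ (m^*)%C cf) /= -(rmeanZ _ ch).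
have := ccont_Re (ccontM (ccont_cst (m^*)%C) cf) => cm.
apply: (ler_rmean cm (rcontZ _ ch)) => z.
apply: le_trans (ler_norm _) _; apply: le_trans (Re_le_cmod _) _.
by rewrite cmodM {1}/cmod normcJ -/(cmod m) ler_pM2l.
Qed.

Lemma mean_char n : mean (fun z => set_val z ^ n) = (n == 0)%:R.
Proof.
have [->|n0] := eqVneq n 0.
  by rewrite /mean !rmean_cst.
have nr : n%:~R != 0 :> R by rewrite intr_eq0.
have E t : set_val (expi t) ^ n = cos (n%:~R * t) +i* sin (n%:~R * t) :> R[i].
  by rewrite -expi_int val_expi.
have p2 (k : int) : cos (k%:~R * (2 * pi)) = 1 :> R /\ sin (k%:~R * (2 * pi)) = 0 :> R.
  have : set_val (expi (k%:~R * (2 * pi))) = 1 :> R[i].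
    rewrite expi_int val_expi mulr_natl -[pi *+ 2]add0r cosD2pi sinD2pi cos0 sin0.
    by rewrite exp1rz.
  by rewrite val_expi => -[].
have cn (F : R -> R) : continuous F -> continuous (fun t : R => F (n%:~R * t)).
  move=> cF t; apply: (@continuous_comp _ _ _ (fun t : R => n%:~R * t) F); last exact: cF.
  by apply: cvgMr; exact: cvg_id.
have dn (F F' : R -> R) : (forall t : R, is_derive t 1 F (F' t)) ->
  forall t : R, is_derive t (1 : R) (fun t => n%:~R^-1 * F (n%:~R * t)) (F' (n%:~R * t)).
  move=> dF t.
  have h1 : is_derive t (1 : R) (fun t => n%:~R * t) n%:~R.
    have := @is_deriveZ R R R id (n%:~R) t 1 1 (is_derive_id _ _).
    by rewrite /GRing.scale /= mulr1.
  have h2 := @is_derive1_comp R F (fun t => n%:~R * t) t _ _ (dF (n%:~R * t)) h1.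
  have := @is_deriveZ R R R _ (n%:~R^-1) t 1 _ h2.
  rewrite /GRing.scale /= mulrCA mulVf // mulr1; exact.
have FTC (F F' : R -> R) : (forall t : R, is_derive t 1 F (F' t)) -> continuous F' ->
  F (n%:~R * (2 * pi)) = F 0 ->
  \int[lebesgue_measure]_(t in `[0, 2 * pi]) F' (n%:~R * t) = 0.
  move=> dF cF' hF.
  have d1 := dn _ _ dF.
  have dd (t : R) : derivable (fun t : R => n%:~R^-1 * F (n%:~R * t)) t 1 by case: (d1 t).
  have cc : continuous (fun t : R => n%:~R^-1 * F (n%:~R * t)).
    by move=> t; apply: differentiable_continuous; apply/derivable1_diffP.
  rewrite /Rintegral (@continuous_FTC2 _ _ (fun t : R => n%:~R^-1 * F (n%:~R * t))) //.
  - by rewrite hF mulr0 -EFinB /= subrr.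
  - exact: pi2_gt0.
  - by apply: continuous_subspaceT; exact: cn.
  - split; first by move=> t _.
      by apply: cvg_at_right_filter; exact: cc.
    by apply: cvg_at_left_filter; exact: cc.
  - by move=> t _; rewrite derive1E; case: (d1 t).
have [c2 s2] := p2 n.
apply/eqP; rewrite eq_complex /=; apply/andP; split; apply/eqP.
  rewrite /rmean; under eq_Rintegral => t _ do rewrite E /=.
  rewrite (FTC sin cos) ?mulr0 //; first exact: continuous_cos.
  by rewrite s2 sin0.
rewrite /rmean; under eq_Rintegral => t _ do rewrite E /=.
have dc (t : R) : is_derive t 1 (fun t : R => - cos t) (sin t).
  by rewrite -[sin t]opprK; exact: is_deriveN.
have c0 : - cos (n%:~R * (2 * pi)) = - cos 0 :> R by rewrite c2 cos0.
by rewrite (FTC _ _ dc (@continuous_sin R) c0) mulr0.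
Qed.

End Mean.

Section FourierCoefficients.
Context {R : realType}.
Implicit Types (z w : circle R) (f g : circle R -> R[i]) (n m : int).

Lemma ccont_mulchar f n : ccont f -> ccont (fun z => f z * set_val z ^ n).
Proof. by move=> cf; apply: (ccontM cf); exact: ccont_char. Qed.

Lemma eq_fourier_coef f g n : f =1 g -> fourier_coef f n = fourier_coef g n.
Proof. by move=> /funext ->. Qed.

Lemma fourier_coefD f g n : ccont f -> ccont g ->
  fourier_coef (fun z => f z + g z) n = fourier_coef f n + fourier_coef g n.
Proof.
move=> cf cg; rewrite !fourier_coefE -meanD; try exact: ccont_mulchar.
by congr mean; apply/funext => z; rewrite mulrDl.
Qed.

Lemma fourier_coefZ (c : R[i]) f n : ccont f ->
  fourier_coef (fun z => c * f z) n = c * fourier_coef f n.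
Proof.
move=> cf; rewrite !fourier_coefE -meanZ; last exact: ccont_mulchar.
by congr mean; apply/funext => z; rewrite mulrA.
Qed.

Lemma ccontZ (c : R[i]) f : ccont f -> ccont (fun z => c * f z).
Proof. by move=> cf; apply: ccontM => //; exact: ccont_cst. Qed.

Lemma ccontB f g : ccont f -> ccont g -> ccont (fun z => f z - g z).
Proof.
move=> cf cg; have := ccontD cf (ccontZ (-1) cg); congr ccont.
by apply/funext => z; rewrite mulN1r.
Qed.

Lemma fourier_coefB f g n : ccont f -> ccont g ->
  fourier_coef (fun z => f z - g z) n = fourier_coef f n - fourier_coef g n.
Proof.
move=> cf cg; rewrite -[X in _ - X]mul1r -mulNr -fourier_coefZ // -fourier_coefD //.
  by apply: eq_fourier_coef => z; rewrite mulN1r.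
exact: ccontZ.
Qed.

Lemma fourier_coef_cst0 n : fourier_coef (fun _ : circle R => 0) n = 0.
Proof.
have E := @fourier_coefZ 0 (fun=> 0) n (ccont_cst 0).
rewrite -[RHS](mul0r (fourier_coef (fun _ : circle R => 0) n)) -E.
by apply: eq_fourier_coef => z; rewrite mul0r.
Qed.

Lemma fourier_coef_sum (I : Type) (r : seq I) (F : I -> circle R -> R[i]) n :
  (forall i, ccont (F i)) ->
  fourier_coef (fun z => \sum_(i <- r) F i z) n = \sum_(i <- r) fourier_coef (F i) n.
Proof.
move=> cF; elim: r => [|i r ih].
  rewrite big_nil -[RHS](fourier_coef_cst0 n); apply: eq_fourier_coef => z.
  by rewrite big_nil.
rewrite big_cons -ih -fourier_coefD //; last exact: ccont_sum.
by apply: eq_fourier_coef => z; rewrite big_cons.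
Qed.

Lemma fourier_coef_mulchar f m n :
  fourier_coef (fun z => set_val z ^ m * f z) n = fourier_coef f (n - m).
Proof.
rewrite !fourier_coefE; congr mean; apply/funext => z.
rewrite mulrAC mulrC -expfzDr ?circle_neq0 //; congr (_ * _ ^ _).
by rewrite opprB addrC.
Qed.

Lemma fourier_coef_char m n :
  fourier_coef (fun z : circle R => set_val z ^ m) n = (m == n)%:R.
Proof.
rewrite fourier_coefE (_ : (fun z => _) = (fun z => set_val z ^ (m - n))).
  by rewrite mean_char subr_eq0.
by apply/funext => z; rewrite -expfzDr ?circle_neq0.
Qed.

Lemma cmod_charz z n : cmod (set_val z ^ n) = 1.
Proof. by rewrite cmodXz cmod_circle exp1rz. Qed.

Lemma cmod_fourier_coef_le f (M : R) n : ccont f -> (forall z, cmod (f z) <= M) ->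
  cmod (fourier_coef f n) <= M.
Proof.
move=> cf hM; rewrite fourier_coefE -(rmean_cst M).
apply: cmod_mean_le; [exact: ccont_mulchar | exact: rcont_cst |].
by move=> z; rewrite cmodM cmod_charz mulr1.
Qed.

End FourierCoefficients.

(** * Uniform approximation by a positive trigonometric kernel *)

Section Kernel.
Context {R : realType}.
Implicit Types (z : circle R) (f : circle R -> R[i]) (n : nat).

(* Coefficients of the kernel [|1 + v| ^ (2 n)] normalized to have mean [1]; as they are at
   most [1], convolution with it does not increase the weighted norms. *)
Definition kercoef (n : nat) (j : nat) : R := 'C(n.*2, j)%:R / 'C(n.*2, n)%:R.

Lemma bin_mid_gt0 n : 0 < 'C(n.*2, n)%:R :> R.
Proof. by rewrite ltr0n bin_gt0 -addnn leq_addr. Qed.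

Lemma bin_mid_max (k j : nat) : ('C(k.*2, j) <= 'C(k.*2, k))%N.
Proof.
have up i : (i < k)%N -> ('C(k.*2, i) <= 'C(k.*2, i.+1))%N.
  move=> ik; rewrite -(leq_pmul2l (ltn0Sn i)) mul_bin_left.
  by rewrite leq_mul2r -[k.*2]addnn; apply/orP; right; lia.
have low i d : (i + d = k)%N -> ('C(k.*2, i) <= 'C(k.*2, k))%N.
  elim: d i => [|d ih] i hi; first by rewrite -hi addn0.
  by apply: leq_trans (up i _) (ih i.+1 _); lia.
have [jk|jk] := leqP j k; first by apply: (low j (k - j)%N); rewrite subnKC.
have [jk2|jk2] := leqP j k.*2; last by rewrite bin_small.
rewrite -bin_sub //; apply: (low _ (j - k)%N); rewrite -addnn in jk2 *; lia.
Qed.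

Lemma kercoef_ge0 n j : 0 <= kercoef n j.
Proof. by rewrite divr_ge0. Qed.

Lemma kercoef_le1 n j : kercoef n j <= 1.
Proof. by rewrite ler_pdivrMr ?bin_mid_gt0 // mul1r ler_nat bin_mid_max. Qed.

Lemma kercoef_mid n : kercoef n n = 1.
Proof. by rewrite /kercoef mulfV // gt_eqF ?bin_mid_gt0. Qed.

Lemma bin_mid_lb n : 4 ^+ n <= (n.*2.+1)%:R * 'C(n.*2, n)%:R :> R.
Proof.
rewrite -natrX -natrM ler_nat.
have -> : (4 ^ n = (1 + 1) ^ n.*2)%N by rewrite -mul2n expnM.
rewrite expnDn.
apply: leq_trans (_ : \sum_(i < n.*2.+1) 'C(n.*2, n) <= _)%N; last first.
  by rewrite sum_nat_const card_ord.
by apply: leq_sum => i _; rewrite !exp1n !muln1 bin_mid_max.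
Qed.

Definition kersum n f : circle R -> R[i] := fun z =>
  \sum_(j < n.*2.+1) ((kercoef n j)%:C * fourier_coef f (j%:Z - n%:Z)) *
     set_val z ^ (j%:Z - n%:Z).

Lemma kernelE n (v : circle R) :
  \sum_(j < n.*2.+1) (kercoef n j)%:C * set_val v ^ (j%:Z - n%:Z) =
  (cmod (1 + set_val v) ^+ n.*2 / 'C(n.*2, n)%:R)%:C.
Proof.
have v0 := circle_neq0 v.
have E : (cmod (1 + set_val v) ^+ 2)%:C = (1 + set_val v) ^+ 2 / set_val v.
  rewrite rmorphXn /= -cmodE sqr_normc.
  have -> : ((1 + set_val v)^*)%C = 1 + (set_val v)^-1.
    by rewrite circle_inv rmorphD rmorph1.
  by field.
rewrite -mul2n exprM rmorphM rmorphXn fmorphV rmorph_nat /= E.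
rewrite expr_div_n -exprM mul2n exprDn !mulr_suml.
apply: eq_bigr => j _; rewrite expr1n mul1r /kercoef rmorphM fmorphV !rmorph_nat /=.
rewrite expfzDr // -exprnP -exprnN -[in RHS]mulr_natl.
by ring.
Qed.

(** On the circle the squares of [cmod (1 + v)] and [cmod (1 - v)] add up to 4, and the central
    binomial coefficient is at least [4 ^ n / (2 n + 1)]. Hence the kernel decays geometrically away
    from [v = 1]. *)
Lemma kernel_bound n (v : circle R) :
  cmod (1 + set_val v) ^+ n.*2 / 'C(n.*2, n)%:R <=
  n.*2.+1%:R * (1 - cmod (1 - set_val v) ^+ 2 / 4) ^+ n.
Proof.
have E : cmod (1 + set_val v) ^+ 2 = 4 * (1 - cmod (1 - set_val v) ^+ 2 / 4).
  have := cmod_circle v => /(congr1 (fun x => x ^+ 2)); rewrite expr1n !sqr_cmod.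
  by case: (set_val v) => a b /= h; lra.
rewrite ler_pdivrMr ?bin_mid_gt0 // -mul2n exprM E exprMn mul2n.
rewrite [X in _ <= X]mulrAC ler_wpM2r ?bin_mid_lb //.
by rewrite exprn_ge0 // -(pmulr_rge0 _ (ltr0n R 4)) -E sqr_ge0.
Qed.

Lemma poly_geometric_cvg0 (q e : R) : 0 <= q -> q < 1 -> 0 < e ->
  exists n : nat, n.*2.+1%:R * q ^+ n < e.
Proof.
move=> q0 q1 e0.
have [qz|qp] := eqVneq q 0.
  by exists 1%N; rewrite qz expr1 mulr0.
have {qp}qp : 0 < q by rewrite lt_neqAle eq_sym qp.
pose r := Num.sqrt q.
have r0 : 0 < r by rewrite sqrtr_gt0.
have rq : r ^+ 2 = q by rewrite sqr_sqrtr.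
have r1 : r < 1.
  by rewrite -(ltr_pXn2r (n := 2)) ?nnegrE ?(ltW r0) // rq expr1n.
pose x := r^-1 - 1.
have x0 : 0 < x by rewrite subr_gt0 invf_gt1.
have h n : n.*2.+1%:R * r ^+ n <= 1 + 2 / x.
  have rn : 0 < r ^+ n by rewrite exprn_gt0.
  rewrite -ler_pdivlMr // -exprVn.
  have -> : r^-1 = 1 + x by rewrite /x addrC subrK.
  have b : 1 + x *+ n <= (1 + x) ^+ n.
    elim: n {rn} => [|n ih]; first by rewrite mulr0n addr0 expr0.
    rewrite exprS mulrSr; apply: le_trans (_ : (1 + x) * (1 + x *+ n) <= _).
      have : 0 <= x * (x *+ n) by rewrite mulr_ge0 ?mulrn_wge0 // ltW.
      lra.
    by rewrite ler_wpM2l // addr_ge0 // ltW.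
  have c0 : 0 <= 1 + 2 / x by rewrite addr_ge0 // divr_ge0 // ltW.
  apply: le_trans (ler_wpM2l c0 b); rewrite -[x *+ n]mulr_natr.
  have -> : (1 + 2 / x) * (1 + x * n%:R) = 1 + 2 * n%:R + (2 / x + x * n%:R).
    by field; rewrite gt_eqF.
  rewrite -addn1 -mul2n natrD natrM addrC lerDl addr_ge0 ?divr_ge0 ?mulr_ge0 //.
    exact: ltW.
  exact: ltW.
have c0 : 0 < 1 + 2 / x by rewrite addr_gt0 // divr_gt0.
have : (fun n => r ^+ n) @ \oo --> (0 : R) by apply: cvg_expr; rewrite ger0_norm // ltW.
move=> /cvgrPdist_lt/(_ (e / (1 + 2 / x)) (divr_gt0 e0 c0))[] N _ /(_ N (leqnn N)).
rewrite /= sub0r normrN ger0_norm ?exprn_ge0 ?(ltW r0) // => hN.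
exists N; rewrite -rq exprAC expr2 mulrA.
apply: le_lt_trans (ler_wpM2r (exprn_ge0 _ (ltW r0)) (h N)) _.
by rewrite mulrC -ltr_pdivlMr.
Qed.

Theorem kersum_approx f (e : R) : ccont f -> 0 < e ->
  exists n, forall z, cmod (f z - kersum n f z) <= e.
Proof.
move=> cf e0; have e2 : 0 < e / 2 by rewrite divr_gt0.
have [d d0 hd] := cf _ e2; have [M M0 hM] := ccont_bounded cf.
(* The cut at 1 makes the ratio [q] below nonnegative. *)
pose d' := Num.min d 1.
have d'0 : 0 < d' by rewrite lt_min d0 ltr01.
have d'1 : d' <= 1 by rewrite ge_min lexx orbT.
have d'd : d' <= d by rewrite ge_min lexx.
pose q := 1 - d' ^+ 2 / 4.
have d2 : 0 < d' ^+ 2 by rewrite exprn_gt0.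
have d3 : d' ^+ 2 <= 1 by rewrite exprn_ile1 // ltW.
have q0 : 0 <= q by rewrite /q; lra.
have q1 : q < 1 by rewrite /q; lra.
have M2 : 0 < e / 2 / (2 * M) by rewrite divr_gt0 // mulr_gt0.
have [n hn] := poly_geometric_cvg0 q0 q1 M2.
exists n => z.
have [zi zi'] : exists zi : circle R, set_val zi = (set_val z)^-1 :> R[i].
  by apply: circle_of; rewrite cmodV cmod_circle invr1.
pose rot (u : circle R) := set_val u * set_val zi : R[i].
have rot_circle u : exists v : circle R, set_val v = (rot u)^-1.
  by apply: circle_of; rewrite cmodV cmodM !cmod_circle mulr1 invr1.
pose ker (u : circle R) := \sum_(j < n.*2.+1) ((kercoef n j)%:C * set_val z ^ (j%:Z - n%:Z)) *
   set_val u ^ (- (j%:Z - n%:Z)).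
have kerE u : exists2 v : circle R, cmod (1 - set_val v) = cmod (set_val z - set_val u) &
    ker u = (cmod (1 + set_val v) ^+ n.*2 / 'C(n.*2, n)%:R)%:C.
  have [v hv] := rot_circle u; exists v.
    rewrite hv /rot zi' invfM invrK.
    have -> : 1 - (set_val u)^-1 * set_val z = (set_val u)^-1 * (set_val u - set_val z).
      by rewrite mulrBr mulVf // circle_neq0.
    by rewrite cmodM cmodV cmod_circle invr1 mul1r cmodBC.
  rewrite -kernelE; apply: eq_bigr => j _; rewrite -mulrA; congr (_ * _).
  rewrite hv /rot zi' invfM invrK exprzMl ?unitfE ?invr_eq0 ?circle_neq0 //.
  by rewrite mulrC exprz_inv.
have cker : ccont ker.
  by apply: ccont_sum => j; apply: ccontZ; exact: ccont_char.
have mker : mean ker = 1.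
  have -> : mean ker = fourier_coef ker 0.
    by rewrite fourier_coefE; congr mean; apply/funext => u; rewrite oppr0 mulr1.
  rewrite fourier_coef_sum => [|j]; last by apply: ccontZ; exact: ccont_char.
  have nlt : (n < n.*2.+1)%N by rewrite ltnS -addnn leq_addr.
  rewrite (bigD1 (Ordinal nlt)) //= big1 => [|j jn].
    rewrite fourier_coefZ ?fourier_coef_char; last exact: ccont_char.
    by rewrite subrr oppr0 eqxx kercoef_mid expr0z !mulr1 addr0.
  rewrite fourier_coefZ ?fourier_coef_char; last exact: ccont_char.
  rewrite oppr_eq0 subr_eq0 eqz_nat; move: jn; rewrite -val_eqE /= => /negPf ->.
  by rewrite mulr0.
have -> : f z - kersum n f z = mean (fun u => (f z - f u) * ker u).
  have -> : (fun u => (f z - f u) * ker u) = (fun u => f z * ker u + (- 1) * (f u * ker u)).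
    by apply/funext => u; ring.
  have cfk : ccont (fun u => f u * ker u) by exact: ccontM.
  rewrite meanD; [|exact: ccontZ|exact: ccontZ].
  rewrite (meanZ _ cker) (meanZ _ cfk) mker mulr1.
  rewrite mulN1r; congr (_ - _).
  have -> : mean (fun u => f u * ker u) = fourier_coef (fun u => f u * ker u) 0.
    by rewrite fourier_coefE; congr mean; apply/funext => u; rewrite oppr0 mulr1.
  rewrite (_ : (fun u => f u * ker u) = fun u => \sum_(j < n.*2.+1)
    ((kercoef n j)%:C * set_val z ^ (j%:Z - n%:Z)) * (set_val u ^ (- (j%:Z - n%:Z)) * f u)).
    rewrite fourier_coef_sum => [|j].
      apply: eq_bigr => j _; rewrite fourier_coefZ ?fourier_coef_mulchar ?sub0r ?opprK.
        by rewrite mulrAC.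
      by apply: ccontM => //; exact: ccont_char.
    by apply: ccontZ; apply: ccontM => //; exact: ccont_char.
  by apply/funext => u; rewrite mulr_sumr; apply: eq_bigr => j _; rewrite mulrC mulrA.
have rker : rcont (fun u => complex.Re (ker u)) by exact: ccont_Re.
have mre : rmean (fun u => complex.Re (ker u)) = 1 by have := congr1 (@complex.Re R) mker.
(* The first term dominates the integrand near [z], by continuity of [f], the second one far from
   [z], by smallness of the kernel. As the kernel has mean 1, the mean of [h] is [e]. *)
pose h u := e / 2 * complex.Re (ker u) + e / 2.
have ch : rcont h by apply: rcontD; [exact: rcontZ | exact: rcont_cst].
have -> : e = rmean h.
  rewrite /h rmeanD; [|exact: rcontZ|exact: rcont_cst].
  by rewrite (rmeanZ _ rker) mre rmean_cst mulr1 -splitr.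
apply: cmod_mean_le => //.
  by apply: ccontM => //; apply: ccontB => //; exact: ccont_cst.
move=> u; have [v v1 v2] := kerE u; rewrite cmodM /h v2 /=.
set k := _ / _ in v2 *.
have k0 : 0 <= k by rewrite divr_ge0 ?exprn_ge0 ?cmod_ge0.
rewrite cmod_real ger0_norm //.
have [zu|zu] := ltP (cmod (set_val z - set_val u)) d'.
  have : cmod (f z - f u) * k <= e / 2 * k.
    by rewrite ler_wpM2r // ltW // hd // (lt_le_trans zu).
  lra.
have k1 : k <= n.*2.+1%:R * q ^+ n.
  apply: le_trans (kernel_bound _ _) _; rewrite v1 ler_wpM2l //.
  have dz : d' ^+ 2 <= cmod (set_val z - set_val u) ^+ 2.
    by rewrite lerXn2r ?nnegrE ?cmod_ge0 ?(ltW d'0).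
  have z2 : cmod (set_val z - set_val u) ^+ 2 <= 4.
    rewrite (_ : 4 = 2 ^+ 2); last by ring.
    rewrite lerXn2r ?nnegrE ?cmod_ge0 //.
    by apply: le_trans (cmodB _ _) _; rewrite !cmod_circle.
  by rewrite lerXn2r ?nnegrE //; rewrite /q; lra.
have : cmod (f z - f u) * k <= 2 * M * (e / 2 / (2 * M)).
  apply: ler_pM; rewrite ?cmod_ge0 //.
    by apply: le_trans (cmodB _ _) _; have := hM z; have := hM u; lra.
  by apply: le_trans k1 (ltW hn).
rewrite [X in _ <= X]mulrC mulfVK; last by rewrite gt_eqF // mulr_gt0.
have : 0 <= e / 2 * k by rewrite mulr_ge0 // ltW.
lra.
Qed.

End Kernel.

(** * Weighted norms and derivatives *)

Section WeightedNorm.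
Context {R : realType}.
Implicit Types (z w : circle R) (f g : circle R -> R[i]) (n : int) (s : seq int).
Implicit Types (om : int -> R) (M : R).

(* Unconditional summability is used only through sums over duplicate-free
   finite sequences. *)
Definition coef_bound om f M : Prop := forall s, uniq s ->
  \sum_(n <- s) cmod (fourier_coef f n) * om n <= M.

Definition calg om f : Prop := ccont f /\ exists M, coef_bound om f M.

(** An infinite norm is sent to 0, so that upper bounds by [nrm] are meaningful only under [calg] or
    [coef_bound]. *)
Definition nrm om f : R := fine (beurling_norm om f).

Lemma coef_boundP om f M : coef_bound om f M <-> (beurling_norm om f <= M%:E)%E.
Proof.
rewrite /beurling_norm /esum; split=> [h|h s us].
  apply: ge_ereal_sup => _ [X [fX _] <-].
  by rewrite fsbig_finite // sumEFin lee_fin; apply: h; exact: finmap.fset_uniq.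
rewrite -lee_fin; apply: le_trans h; apply: ereal_sup_ge.
exists (\sum_(n <- s) (cmod (fourier_coef f n) * om n)%:E)%E; last by rewrite sumEFin.
exists [set` s]; first by split => //; exact: finite_seq.
by rewrite -fsbig_seq.
Qed.

Lemma beurling_norm_ge0 om f : (0 <= beurling_norm om f)%E.
Proof.
apply: ereal_sup_ge; exists 0%E => //.
by exists set0; [exact: fsets_set0 | rewrite fsbig_set0].
Qed.

Lemma nrm_ge0 om f : 0 <= nrm om f.
Proof. by rewrite fine_ge0 // beurling_norm_ge0. Qed.

Lemma nrm_le om f M : coef_bound om f M -> nrm om f <= M.
Proof.
move=> /coef_boundP h; have h0 := beurling_norm_ge0 om f.
have fn : beurling_norm om f \is a fin_num.
  by rewrite ge0_fin_numE //; apply: le_lt_trans h (ltry _).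
by rewrite -lee_fin fineK.
Qed.

Lemma beurling_normE om f : calg om f -> beurling_norm om f = (nrm om f)%:E.
Proof.
move=> [_ [M /coef_boundP h]]; rewrite fineK // ge0_fin_numE ?beurling_norm_ge0 //.
exact: le_lt_trans h (ltry _).
Qed.

Lemma nrm_bound om f : calg om f -> coef_bound om f (nrm om f).
Proof. by move=> hf; apply/coef_boundP; rewrite beurling_normE. Qed.

Lemma calgP om f : beurling_algebra om f <-> calg om f.
Proof.
split=> [[/ccontP cf h]|hf].
  split=> //; exists (nrm om f); apply/coef_boundP.
  by rewrite fineK // ge0_fin_numE // beurling_norm_ge0.
split; first by apply/ccontP; case: hf.
by rewrite beurling_normE // ltry.
Qed.

Lemma calg_bound om f M : ccont f -> coef_bound om f M -> calg om f.
Proof. by move=> cf h; split=> //; exists M. Qed.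

Lemma calg_ccont om f : calg om f -> ccont f. Proof. by case. Qed.

Lemma coef_boundD om f g M N : (forall n, 0 <= om n) -> ccont f -> ccont g ->
  coef_bound om f M -> coef_bound om g N -> coef_bound om (fun z => f z + g z) (M + N).
Proof.
move=> om0 cf cg hf hg s us; apply: le_trans (lerD (hf s us) (hg s us)).
rewrite -big_split /=; apply: ler_sum => n _.
by rewrite fourier_coefD // -mulrDl ler_wpM2r // cmodD.
Qed.

Lemma coef_boundZ om f (c : R[i]) M : ccont f ->
  coef_bound om f M -> coef_bound om (fun z => c * f z) (cmod c * M).
Proof.
move=> cf hf s us; apply: le_trans (ler_wpM2l (cmod_ge0 c) (hf s us)).
by rewrite mulr_sumr; apply: ler_sum => n _; rewrite fourier_coefZ // cmodM mulrA.
Qed.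

Lemma coef_bound_mulchar om f M k : weight om ->
  coef_bound om f M -> coef_bound om (fun z => set_val z ^ k * f z) (om k * M).
Proof.
move=> [om1 omM] hf s us.
have ok : 0 <= om k by apply: le_trans (om1 k).
have us' : uniq [seq n - k | n <- s] by rewrite map_inj_uniq //; exact: addIr.
apply: le_trans (ler_wpM2l ok (hf _ us')); rewrite mulr_sumr big_map.
apply: ler_sum => n _; rewrite fourier_coef_mulchar mulrCA ler_wpM2l ?cmod_ge0 //.
by rewrite -{1}(subrK k n) addrC omM.
Qed.

Lemma calgD om f g : (forall n, 0 <= om n) -> calg om f -> calg om g ->
  calg om (fun z => f z + g z).
Proof.
move=> om0 [cf [M hM]] [cg [N hN]]; apply: (calg_bound (M := M + N)).
  exact: ccontD.
exact: coef_boundD.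
Qed.

Lemma nrmD om f g : (forall n, 0 <= om n) -> calg om f -> calg om g ->
  nrm om (fun z => f z + g z) <= nrm om f + nrm om g.
Proof.
move=> om0 hf hg; apply/nrm_le/coef_boundD => //; try exact: nrm_bound.
  exact: calg_ccont hf.
exact: calg_ccont hg.
Qed.

Lemma calgZ om f c : calg om f -> calg om (fun z => c * f z).
Proof.
move=> [cf [M hM]]; apply: (calg_bound (M := cmod c * M)); first exact: ccontZ.
exact: coef_boundZ.
Qed.

Lemma nrmZ_le om f c : calg om f -> nrm om (fun z => c * f z) <= cmod c * nrm om f.
Proof.
by move=> hf; apply/nrm_le/coef_boundZ; [exact: calg_ccont hf | exact: nrm_bound].
Qed.

Lemma calgB om f g : (forall n, 0 <= om n) -> calg om f -> calg om g ->
  calg om (fun z => f z - g z).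
Proof.
move=> om0 hf hg; have := calgD om0 hf (calgZ (-1) hg).
by congr calg; apply/funext => z; rewrite mulN1r.
Qed.

Lemma nrmB om f g : (forall n, 0 <= om n) -> calg om f -> calg om g ->
  nrm om (fun z => f z - g z) <= nrm om f + nrm om g.
Proof.
move=> om0 hf hg; have := nrmD om0 hf (calgZ (-1) hg).
have -> : (fun z => f z + -1 * g z) = (fun z => f z - g z).
  by apply/funext => z; rewrite mulN1r.
by move=> h; apply: le_trans h _; rewrite lerD2l; have := nrmZ_le (-1) hg; rewrite cmodN cmod1 mul1r.
Qed.

Lemma calg0 om : calg om (fun=> 0).
Proof.
apply: (calg_bound (M := 0)); first exact: ccont_cst.
move=> s _; rewrite big1 // => n _.
by rewrite fourier_coef_cst0 cmod0 mul0r.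
Qed.

Lemma nrm0 om : nrm om (fun=> 0) = 0.
Proof.
apply/eqP; rewrite eq_le nrm_ge0 andbT; apply: nrm_le => s _.
by rewrite big1 // => n _; rewrite fourier_coef_cst0 cmod0 mul0r.
Qed.

Lemma coef_bound_char om k : 0 <= om k -> coef_bound om (fun z => set_val z ^ k) (om k).
Proof.
move=> ok s us; have [ks|ks] := boolP (k \in s).
  rewrite (bigD1_seq k) //= fourier_coef_char eqxx cmod1 mul1r big1 ?addr0 // => n nk.
  by rewrite fourier_coef_char eq_sym (negPf nk) cmod0 mul0r.
rewrite big_seq big1 // => n ns; rewrite fourier_coef_char.
by have [kn|] := eqVneq k n; [rewrite kn ns in ks | rewrite cmod0 mul0r].
Qed.

Lemma calg_char om k : 0 <= om k -> calg om (fun z => set_val z ^ k).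
Proof. by move=> ok; apply: calg_bound (coef_bound_char ok); exact: ccont_char. Qed.

Lemma nrm_char om k : 0 <= om k -> nrm om (fun z => set_val z ^ k) <= om k.
Proof. by move=> ok; apply/nrm_le/coef_bound_char. Qed.

Lemma calg_sum om (T : Type) (r : seq T) (F : T -> circle R -> R[i]) :
  (forall n, 0 <= om n) -> (forall i, calg om (F i)) ->
  calg om (fun z => \sum_(i <- r) F i z).
Proof.
move=> om0 h; elim: r => [|i r ih].
  have := calg0 om; congr calg; apply/funext => z; by rewrite big_nil.
have := calgD om0 (h i) ih; congr calg; apply/funext => z.
by rewrite big_cons.
Qed.

Lemma nrm_sum om (T : Type) (r : seq T) (F : T -> circle R -> R[i]) :
  (forall n, 0 <= om n) -> (forall i, calg om (F i)) ->
  nrm om (fun z => \sum_(i <- r) F i z) <= \sum_(i <- r) nrm om (F i).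
Proof.
move=> om0 h; elim: r => [|i r ih].
  rewrite big_nil -(nrm0 om) le_eqVlt; apply/orP; left; apply/eqP.
  by congr nrm; apply/funext => z; rewrite big_nil.
rewrite big_cons; apply: le_trans (lerD (lexx _) ih).
apply: le_trans (nrmD om0 (h i) (calg_sum r om0 h)).
rewrite le_eqVlt; apply/orP; left; apply/eqP.
by congr nrm; apply/funext => z; rewrite big_cons.
Qed.

Lemma eq_calg om f g : f =1 g -> calg om f -> calg om g.
Proof. by move=> /funext ->. Qed.

Lemma eq_nrm om f g : f =1 g -> nrm om f = nrm om g.
Proof. by move=> /funext ->. Qed.

Lemma calg_mulchar om f k : weight om -> calg om f -> calg om (fun z => set_val z ^ k * f z).
Proof.
move=> hom [cf [M hM]]; apply: calg_bound (coef_bound_mulchar k hom hM).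
by apply: ccontM => //; exact: ccont_char.
Qed.

Lemma nrm_mulchar om f k : weight om -> calg om f ->
  nrm om (fun z => set_val z ^ k * f z) <= om k * nrm om f.
Proof. by move=> hom hf; apply: nrm_le; apply: coef_bound_mulchar => //; exact: nrm_bound. Qed.

Definition partial s f : circle R -> R[i] :=
  fun z => \sum_(n <- s) fourier_coef f n * set_val z ^ n.

Lemma ccont_partial s f : ccont (partial s f).
Proof. by apply: ccont_sum => n; apply: ccontZ; exact: ccont_char. Qed.

Lemma fourier_coef_partial s f n : uniq s ->
  fourier_coef (partial s f) n = if n \in s then fourier_coef f n else 0.
Proof.
move=> us; rewrite fourier_coef_sum => [|k]; last by apply: ccontZ; exact: ccont_char.
have E k : fourier_coef (fun z => fourier_coef f k * set_val z ^ k) n =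
    fourier_coef f k * (k == n)%:R.
  by rewrite fourier_coefZ ?fourier_coef_char //; exact: ccont_char.
rewrite (eq_bigr _ (fun k _ => E k)); case: ifPn => ns.
  rewrite (bigD1_seq n) //= eqxx mulr1 big1 ?addr0 // => k kn.
  by rewrite (negPf kn) mulr0.
rewrite big_seq big1 // => k ks; case: eqP => [kn|]; last by rewrite mulr0.
by rewrite -kn ks in ns.
Qed.

Lemma partial_approx om f (e : R) : (forall n, 0 <= om n) -> calg om f -> 0 < e ->
  exists2 s, uniq s & coef_bound om (fun z => f z - partial s f z) e.
Proof.
move=> om0 hf e0; have h0 := beurling_norm_ge0 om f.
have : ((nrm om f - e)%:E < beurling_norm om f)%E.
  by rewrite beurling_normE // lte_fin ltrBlDr ltrDl.
move=> /ereal_sup_gt[_ [X [fX _] <-]].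
rewrite fsbig_finite // sumEFin lte_fin => hX.
exists (finmap.enum_fset (fset_set X)) => [|t ut]; first exact: finmap.fset_uniq.
set r : seq int := finmap.enum_fset (fset_set X) in hX *.
have ur : uniq r by exact: finmap.fset_uniq.
have urt : uniq (r ++ [seq n <- t | n \notin r]).
  rewrite cat_uniq ur filter_uniq // andbT; apply/hasPn => n.
  by rewrite mem_filter => /andP[].
have := nrm_bound hf urt; rewrite big_cat /=.
have -> : \sum_(n <- t) cmod (fourier_coef (fun z => f z - partial r f z) n) * om n =
    \sum_(n <- [seq n <- t | n \notin r]) cmod (fourier_coef f n) * om n.
  rewrite [RHS]big_filter [RHS]big_mkcond; apply: eq_bigr => n _.
  rewrite fourier_coefB ?fourier_coef_partial //; [|exact: calg_ccont hf|exact: ccont_partial].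
  by case: ifPn; rewrite ?subr0 ?subrr ?cmod0 ?mul0r.
by move: hX; rewrite /r; lra.
Qed.

Lemma calg_partial om s f : (forall n, 0 <= om n) -> calg om (partial s f).
Proof.
move=> om0; apply: calg_sum => // n; apply: calgZ; exact: calg_char.
Qed.

End WeightedNorm.

(** * Uniqueness of Fourier coefficients and submultiplicativity *)

Section Kersum.
Context {R : realType}.
Implicit Types (z w : circle R) (f g : circle R -> R[i]) (s : seq int).
Implicit Types (om : int -> R) (M : R).

Lemma ccont_kersum n f : ccont (kersum n f).
Proof. by apply: ccont_sum => n'; apply: ccontZ; exact: ccont_char. Qed.

Lemma uniq_window n : uniq [seq (j : nat)%:Z - n%:Z | j <- index_iota 0 n.*2.+1].
Proof.
rewrite map_inj_uniq ?iota_uniq // => i j /addIr; exact: (fun h => congr1 absz h).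
Qed.

Lemma cmod_kersum_le om f M n z : (forall k, 1 <= om k) -> coef_bound om f M ->
  cmod (kersum n f z) <= M.
Proof.
move=> om1 hf; apply: le_trans (cmod_sum _ _ _) _.
apply: le_trans (hf _ (uniq_window n)); rewrite big_map big_mkord.
apply: ler_sum => j _; set c := fourier_coef _ _; rewrite 2!cmodM cmod_charz mulr1 cmod_real.
rewrite ger0_norm ?kercoef_ge0 //.
apply: le_trans (ler_wpM2r (cmod_ge0 _) (kercoef_le1 _ _)) _.
by rewrite mul1r ler_peMr ?cmod_ge0.
Qed.

(** Convergence of the Fourier series is avoided: [kersum n f] tends to [f] uniformly and, its
    kernel having coefficients in [0, 1], is bounded by [M]. *)
Lemma cmod_le_bound om f M z : ccont f -> (forall k, 1 <= om k) -> coef_bound om f M ->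
  cmod (f z) <= M.
Proof.
move=> cf om1 hf; rewrite -[_ <= _]/(cmod (f z) <= M); apply/ler_addgt0Pr => e e0.
have [n hn] := kersum_approx cf e0.
have := cmodD (f z - kersum n f z) (kersum n f z); rewrite subrK.
have := hn z; have := cmod_kersum_le n z om1 hf; lra.
Qed.

Lemma fourier_coef_inj f g : ccont f -> ccont g ->
  (forall n, fourier_coef f n = fourier_coef g n) -> f = g.
Proof.
move=> cf cg h; apply/funext => z; apply/eqP; rewrite -subr_eq0 -cmod_eq0.
rewrite eq_le cmod_ge0 andbT.
apply: (@cmod_le_bound (fun=> 1) (fun z => f z - g z) 0) => //; first exact: ccontB.
by move=> s us; rewrite big1 // => n _; rewrite fourier_coefB // h subrr cmod0 mul0r.
Qed.

(** Instead of a convolution of two series, [f] is replaced by [kersum n f], whose product with [g]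
    is a finite combination of shifts of [g]. The limit in [n] is then taken on a fixed finite set
    of coefficients. *)
Lemma coef_boundM om f g M N : weight om -> ccont f -> ccont g ->
  coef_bound om f M -> coef_bound om g N -> coef_bound om (fun z => f z * g z) (M * N).
Proof.
move=> hom cf cg hf hg; have [om1 omM] := hom.
have om0 k : 0 <= om k by apply: le_trans (om1 k).
have M0 : 0 <= M by have := hf [::] isT; rewrite big_nil.
have N0 : 0 <= N by have := hg [::] isT; rewrite big_nil.
have Pbound n : coef_bound om (fun z => kersum n f z * g z) (M * N).
  pose F (j : 'I_n.*2.+1) := fun z : circle R =>
    (kercoef n j)%:C * fourier_coef f (j%:Z - n%:Z) * (set_val z ^ (j%:Z - n%:Z) * g z).
  have hF j : calg om (F j).
    by apply/calgZ/calg_mulchar => //; apply: calg_bound hg.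
  have -> : (fun z => kersum n f z * g z) = (fun z => \sum_j F j z).
    apply/funext => z; rewrite mulr_suml; apply: eq_bigr => j _.
    by rewrite /F !mulrA.
  suff h : nrm om (fun z => \sum_j F j z) <= M * N.
    move=> s us; apply: le_trans h; apply: nrm_bound => //; exact: calg_sum.
  apply: le_trans (nrm_sum _ om0 hF) _.
  apply: le_trans (ler_wpM2r N0 (hf _ (uniq_window n))); rewrite big_map big_mkord mulr_suml.
  apply: ler_sum => j _.
  apply: le_trans (nrmZ_le _ (calg_mulchar _ hom (calg_bound cg hg))) _.
  rewrite cmodM cmod_real ger0_norm ?kercoef_ge0 // -[X in _ <= X]mulrA.
  apply: ler_pM; rewrite ?mulr_ge0 ?kercoef_ge0 ?cmod_ge0 ?nrm_ge0 //.
    by rewrite ler_piMl ?cmod_ge0 ?kercoef_le1.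
  apply: le_trans (nrm_mulchar _ hom (calg_bound cg hg)) _.
  by rewrite ler_wpM2l // nrm_le.
move=> s us; apply/ler_addgt0Pr => e e0.
have [G G0 hG] := ccont_bounded cg.
(* The precision of the uniform approximation has to be weighed by the total weight of the finite
   set [s]. *)
pose W := \sum_(n <- s) om n.
have W0 : 0 <= W by exact: sumr_ge0.
have d0 : 0 < e / (G * (W + 1)) by rewrite divr_gt0 // mulr_gt0 // ltr_wpDl.
have [n hn] := kersum_approx cf d0.
have ck : ccont (fun z => kersum n f z * g z) by apply: ccontM => //; exact: ccont_kersum.
have cfg : ccont (fun z => f z * g z) by exact: ccontM.
apply: le_trans (_ : \sum_(k <- s) (cmod (fourier_coef (fun z => kersum n f z * g z) k) +
   e / (W + 1)) * om k <= _).
  apply: ler_sum => k _; rewrite ler_wpM2r // -lerBlDl.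
  apply: le_trans (_ : cmod (fourier_coef (fun z => f z * g z - kersum n f z * g z) k) <= _).
    have := cmodD (fourier_coef (fun z => f z * g z) k -
      fourier_coef (fun z => kersum n f z * g z) k) (fourier_coef (fun z => kersum n f z * g z) k).
    by rewrite subrK fourier_coefB //; lra.
  apply: cmod_fourier_coef_le => [|z]; first exact: ccontB.
  rewrite -mulrBl cmodM; have -> : e / (W + 1) = e / (G * (W + 1)) * G.
    by field; rewrite !gt_eqF //= ltr_wpDl.
  by apply: ler_pM; rewrite ?cmod_ge0.
under eq_bigr do rewrite mulrDl.
rewrite big_split /= -mulr_sumr lerD ?Pbound //.
by rewrite -[X in _ <= X]mulr1 -mulrA ler_pM2l // mulrC ler_pdivrMr ?mul1r ?lerDl // ltr_wpDl.
Qed.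

Lemma calgM om f g : weight om -> calg om f -> calg om g -> calg om (fun z => f z * g z).
Proof.
move=> hom [cf [M hM]] [cg [N hN]]; apply: calg_bound (coef_boundM hom cf cg hM hN).
exact: ccontM.
Qed.

Lemma nrmM om f g : weight om -> calg om f -> calg om g ->
  nrm om (fun z => f z * g z) <= nrm om f * nrm om g.
Proof.
move=> hom hf hg; apply: nrm_le; apply: coef_boundM => //; try exact: nrm_bound.
  exact: calg_ccont hf.
exact: calg_ccont hg.
Qed.

End Kersum.

(** * Continuous functions with prescribed summable coefficients *)

Section Synthesis.
Context {R : realType}.
Implicit Types (z w : circle R) (f g : circle R -> R[i]) (n : int) (s : seq int).
Implicit Types (om : int -> R) (M : R).

Lemma real_nested_limit (u eps : nat -> R) :
  (forall k l, (k <= l)%N -> `|u k - u l| <= eps k) ->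
  exists x, forall k, `|u k - x| <= 2 * eps k.
Proof.
move=> h; have e0 k : 0 <= eps k by apply: le_trans (h k k (leqnn k)).
have key k l : u k - 2 * eps k <= u l + 2 * eps l.
  have [kl|/ltnW lk] := leqP k l.
    have := h _ _ kl; rewrite ler_norml => /andP[h1 h2]; have := e0 k; have := e0 l; lra.
  have := h _ _ lk; rewrite ler_norml => /andP[h1 h2]; have := e0 k; have := e0 l; lra.
pose E := [set u k - 2 * eps k | k in [set: nat]].
have hE : has_sup E.
  split; first by exists (u 0%N - 2 * eps 0%N), 0%N.
  by exists (u 0%N + 2 * eps 0%N) => _ [k _ <-].
exists (sup E) => k; rewrite ler_norml; apply/andP; split.
  have : sup E <= u k + 2 * eps k by apply: ge_sup; [case: hE | move=> _ [l _ <-]].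
  lra.
have : u k - 2 * eps k <= sup E by apply: ub_le_sup; [case: hE | exists k].
lra.
Qed.

Lemma uniform_limit (F : nat -> circle R -> R[i]) (eps : nat -> R) :
  (forall k, ccont (F k)) ->
  (forall k l z, (k <= l)%N -> cmod (F k z - F l z) <= eps k) ->
  (forall e : R, 0 < e -> exists k, eps k <= e) ->
  exists2 g, ccont g & forall k z, cmod (F k z - g z) <= 4 * eps k.
Proof.
move=> cF hF heps.
have hRe z : exists x, forall k, `|complex.Re (F k z) - x| <= 2 * eps k.
  apply: real_nested_limit => k l kl; rewrite -raddfB.
  by apply: le_trans (Re_le_cmod _) (hF _ _ z kl).
have hIm z : exists x, forall k, `|complex.Im (F k z) - x| <= 2 * eps k.
  apply: real_nested_limit => k l kl; rewrite -raddfB.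
  by apply: le_trans (Im_le_cmod _) (hF _ _ z kl).
have [a ha] := choice hRe; have [b hb] := choice hIm.
have hg k z : cmod (F k z - (a z +i* b z)) <= 4 * eps k.
  apply: le_trans (cmod_le_ReIm _) _.
  have := ha z k; have := hb z k; case: (F k z) => x y /=; lra.
exists (fun z => a z +i* b z) => //.
apply: ccont_uniform_limit => e e0; have [k hk] := heps (e / 4) (ltac:(by rewrite divr_gt0)).
exists (F k) => // z; rewrite cmodBC; apply: le_trans (hg k z) _; lra.
Qed.

Lemma sum_diff_le (a : int -> R) s t M e : uniq s -> uniq t ->
  (forall u, uniq u -> \sum_(n <- u) a n <= M) -> M - e <= \sum_(n <- s) a n ->
  \sum_(n <- [seq n <- t | n \notin s]) a n <= e.
Proof.
move=> us ut h hs.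
have urt : uniq (s ++ [seq n <- t | n \notin s]).
  rewrite cat_uniq us filter_uniq // andbT; apply/hasPn => n.
  by rewrite mem_filter => /andP[].
have := h _ urt; rewrite big_cat /=; lra.
Qed.

Lemma trig_sum_diff (a : int -> R[i]) s t z : uniq s -> uniq t ->
  cmod (\sum_(n <- s) a n * set_val z ^ n - \sum_(n <- t) a n * set_val z ^ n) <=
  \sum_(n <- [seq n <- s | n \notin t]) cmod (a n) +
  \sum_(n <- [seq n <- t | n \notin s]) cmod (a n).
Proof.
move=> us ut.
have split (u v : seq int) : uniq u -> uniq v -> \sum_(n <- u) a n * set_val z ^ n =
    \sum_(n <- [seq n <- u | n \in v]) a n * set_val z ^ n +
    \sum_(n <- [seq n <- u | n \notin v]) a n * set_val z ^ n.
  by move=> uu uv; rewrite !big_filter (bigID (mem v)).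
rewrite (split s t) // (split t s) //.
have -> : \sum_(n <- [seq n <- t | n \in s]) a n * set_val z ^ n =
    \sum_(n <- [seq n <- s | n \in t]) a n * set_val z ^ n.
  apply: perm_big; apply: uniq_perm; rewrite ?filter_uniq // => n.
  by rewrite !mem_filter andbC.
rewrite opprD addrACA subrr add0r; apply: le_trans (cmodB _ _) _.
by apply: lerD; apply: le_trans (cmod_sum _ _ _) _; apply: ler_sum => n _;
  rewrite cmodM cmod_charz mulr1.
Qed.

Lemma half_expn_small (e : R) : 0 < e -> exists N, 2^-1 ^+ N <= e.
Proof.
move=> e0; have : (fun n : nat => 2^-1 ^+ n) @ \oo --> (0 : R).
  by apply: cvg_expr; rewrite ger0_norm ?invr_ge0 // invf_lt1 // ltr1n.
move=> /cvgrPdist_le/(_ e e0)[] N _ /(_ N (leqnn N)).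
by rewrite /= sub0r normrN ger0_norm ?exprn_ge0 ?invr_ge0 //; exists N.
Qed.

(** Finite sets whose sums are within [2 ^ (- k)] of the supremum give trigonometric polynomials
    that are uniformly Cauchy, since whatever lies outside such a set has sum at most
    [2 ^ (- k)]. *)
Theorem fourier_synthesis (a : int -> R[i]) M :
  (forall s, uniq s -> \sum_(n <- s) cmod (a n) <= M) ->
  exists2 g, ccont g & forall n, fourier_coef g n = a n.
Proof.
move=> hM.
pose E := [set \sum_(n <- s) cmod (a n) | s in [set s | uniq s]].
have hE : has_sup E.
  split; first by exists (\sum_(n <- [::]) cmod (a n)), [::].
  by exists M => _ [s us <-]; exact: hM.
have hs s : uniq s -> \sum_(n <- s) cmod (a n) <= sup E.
  by move=> us; apply: ub_le_sup; [case: hE | exists s].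
have ex (k : nat) : exists s, uniq s /\ sup E - 2^-1 ^+ k <= \sum_(n <- s) cmod (a n).
  have p0 : 0 < 2^-1 ^+ k :> R by rewrite exprn_gt0 // invr_gt0.
  have [_ [s us <-] h] := sup_adherent p0 hE.
  by exists s; split => //; exact: ltW.
have [S hS] := choice ex.
pose F k z := \sum_(n <- S k) a n * set_val z ^ n.
have cF k : ccont (F k).
  by apply: ccont_sum => n; apply: ccontZ; exact: ccont_char.
have mono k l : (k <= l)%N -> 2^-1 ^+ l <= 2^-1 ^+ k :> R.
  by move=> kl; rewrite ler_wiXn2l // ?invr_ge0 // invf_le1 // ler1n.
have [||g cg hg] := @uniform_limit F (fun k => 2 * 2^-1 ^+ k) cF.
- move=> k l z kl; have [uk hk] := hS k; have [ul hl] := hS l.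
  apply: le_trans (trig_sum_diff _ _ uk ul) _.
  have := sum_diff_le uk ul hs hk; have := sum_diff_le ul uk hs hl.
  have := mono _ _ kl; lra.
- move=> e e0; have [N hN] := half_expn_small (e := e / 2) (ltac:(by rewrite divr_gt0)).
  by exists N; lra.
exists g => // n; apply/eqP; rewrite -subr_eq0 -cmod_eq0 eq_le cmod_ge0 andbT.
apply/ler_addgt0Pr => e e0; rewrite add0r.
(* The errors are [2 ^ (- N)] for the coefficient of [F N] and [8 * 2 ^ (- N)] for the uniform
   limit. *)
have [N hN9] := half_expn_small (e := e / 9) (ltac:(by rewrite divr_gt0)).
have [uN hN] := hS N.
have E1 : cmod (fourier_coef (F N) n - a n) <= 2^-1 ^+ N.
  have -> : fourier_coef (F N) n = if n \in S N then a n else 0.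
    rewrite fourier_coef_sum => [|k]; last by apply: ccontZ; exact: ccont_char.
    have EE k : fourier_coef (fun z : circle R => a k * set_val z ^ k) n = a k * (k == n)%:R.
      by rewrite fourier_coefZ ?fourier_coef_char //; exact: ccont_char.
    rewrite (eq_bigr _ (fun k _ => EE k)); case: ifPn => ns.
      rewrite (bigD1_seq n) //= eqxx mulr1 big1 ?addr0 // => k kn.
      by rewrite (negPf kn) mulr0.
    rewrite big_seq big1 // => k ks; case: eqP => [kn|]; last by rewrite mulr0.
    by rewrite -kn ks in ns.
  case: ifPn => nS; first by rewrite subrr cmod0 exprn_ge0 // invr_ge0.
  rewrite sub0r cmodN; have := sum_diff_le uN (isT : uniq [:: n]) hs hN.
  by rewrite /= nS big_seq1.
have E2 : cmod (fourier_coef g n - fourier_coef (F N) n) <= 4 * (2 * 2^-1 ^+ N).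
  rewrite -fourier_coefB //; apply: cmod_fourier_coef_le; first exact: ccontB.
  by move=> z; rewrite cmodBC.
have := cmodD (fourier_coef g n - fourier_coef (F N) n) (fourier_coef (F N) n - a n).
rewrite addrA subrK; lra.
Qed.

End Synthesis.

(** * Derivatives along the circle *)

Section Derivative.
Context {R : realType}.
Implicit Types (z w : circle R) (f g : circle R -> R[i]) (n : int) (s : seq int).
Implicit Types (M : R) (j : nat).

Definition polyw j n : R := (1 + (absz n)%:R) ^+ j.

Lemma polyw_ge1 j n : 1 <= polyw j n.
Proof. by rewrite exprn_ege1 // lerDl. Qed.

Lemma polyw_ge0 j n : 0 <= polyw j n.
Proof. by apply: le_trans (polyw_ge1 j n). Qed.

Lemma weight_polyw j : weight (polyw j).
Proof.
split=> [n|m n]; first exact: polyw_ge1.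
rewrite -exprMn lerXn2r ?nnegrE ?mulr_ge0 ?addr_ge0 //.
have : (absz (m + n))%:R <= (absz m)%:R + (absz n)%:R :> R by rewrite -natrD ler_nat; lia.
have : 0 <= (absz m)%:R * (absz n)%:R :> R by rewrite mulr_ge0.
lra.
Qed.

Lemma polyw_shift j n : polyw j n <= 2 ^+ j * polyw j (n + 1).
Proof.
rewrite -exprMn lerXn2r ?nnegrE ?mulr_ge0 ?addr_ge0 //.
have : (absz n)%:R <= (absz (n + 1))%:R + 1 :> R by rewrite -[1]/(1%:R) -natrD ler_nat; lia.
have : 0 <= (absz (n + 1))%:R :> R by [].
lra.
Qed.

Lemma cmod_int n : cmod (n%:~R : R[i]) = (absz n)%:R.
Proof.
have -> : n%:~R = (n%:~R : R)%:C by rewrite rmorph_int.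
by rewrite cmod_real -intr_norm -abszE.
Qed.

Lemma coef_bound_derivative j f g M :
  (forall n, fourier_coef g n = (n + 1)%:~R * fourier_coef f (n + 1)) ->
  coef_bound (polyw j.+1) f M -> coef_bound (polyw j) g (2 ^+ j * M).
Proof.
move=> hg hf s us.
have us' : uniq [seq n + 1 | n <- s] by rewrite map_inj_uniq //; exact: addIr.
apply: le_trans (ler_wpM2l (exprn_ge0 j (ler0n R 2)) (hf _ us')).
rewrite mulr_sumr big_map; apply: ler_sum => n _.
rewrite hg cmodM cmod_int mulrCA [X in X * _]mulrC -mulrA ler_wpM2l ?cmod_ge0 //.
rewrite {2}/polyw exprS -/(polyw j (n + 1)) mulrCA.
apply: ler_pM; rewrite ?polyw_ge0 ?polyw_shift //.
by rewrite lerDr.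
Qed.

Lemma cmod_char_dist z w n :
  cmod (set_val w ^ n - set_val z ^ n) <= (absz n)%:R * cmod (set_val w - set_val z).
Proof.
suff h (k : nat) : cmod (set_val w ^ k%:Z - set_val z ^ k%:Z) <=
    k%:R * cmod (set_val w - set_val z).
  case: n => k; first exact: h.
  rewrite NegzE abszN /=.
  have -> : set_val w ^ (- k.+1%:Z) - set_val z ^ (- k.+1%:Z) =
      set_val w ^ (- k.+1%:Z) * set_val z ^ (- k.+1%:Z) *
      (set_val z ^ k.+1%:Z - set_val w ^ k.+1%:Z).
    rewrite -!exprnN -!exprnP; field.
    by rewrite !expf_neq0 ?circle_neq0.
  by rewrite 2!cmodM 2!cmod_charz !mul1r [X in X <= _]cmodBC; exact: h.
elim: k => [|k ih]; first by rewrite !expr0z subrr cmod0 mul0r.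
have -> : set_val w ^ k.+1%:Z - set_val z ^ k.+1%:Z =
    set_val w * (set_val w ^ k%:Z - set_val z ^ k%:Z) +
    set_val z ^ k%:Z * (set_val w - set_val z).
  by rewrite -!exprnP !exprS; ring.
apply: le_trans (cmodD _ _) _; rewrite !cmodM cmod_charz cmod_circle !mul1r.
by rewrite mulrSr mulrDl mul1r lerD2r.
Qed.

Lemma cmod_triangle4 (a b c d : R[i]) :
  cmod (a - d) <= cmod (a - b) + cmod (b - c) + cmod (c - d).
Proof.
have -> : a - d = (a - b) + (b - c) + (c - d) by ring.
by apply: le_trans (cmodD _ _) _; rewrite lerD2r cmodD.
Qed.

Lemma cmod_dist_bound f M z w : ccont f -> coef_bound (polyw 1) f M ->
  cmod (f w - f z) <= M * cmod (set_val w - set_val z).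
Proof.
move=> cf hf; apply/ler_addgt0Pr => e e0.
have [n hn] := kersum_approx cf (ltac:(by rewrite divr_gt0) : 0 < e / 2).
have : cmod (kersum n f w - kersum n f z) <= M * cmod (set_val w - set_val z).
  rewrite /kersum -sumrB; apply: le_trans (cmod_sum _ _ _) _.
  apply: le_trans (ler_wpM2r (cmod_ge0 _) (hf _ (uniq_window n))).
  rewrite big_map big_mkord mulr_suml; apply: ler_sum => j _.
  have := kercoef_ge0 (R := R) n j; have := kercoef_le1 (R := R) n j.
  move: (fourier_coef f _) (kercoef n j) => c a a1 a0.
  rewrite -mulrBr !cmodM cmod_real ger0_norm // -!mulrA.
  apply: le_trans (ler_wpM2r _ a1) _.
    by rewrite mulr_ge0 ?cmod_ge0.
  rewrite mul1r ler_wpM2l ?cmod_ge0 //; apply: le_trans (cmod_char_dist _ _ _) _.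
  by rewrite ler_wpM2r ?cmod_ge0 // /polyw expr1 lerDr.
move=> h3; apply: le_trans (cmod_triangle4 _ (kersum n f w) (kersum n f z) _) _.
rewrite (cmodBC (kersum n f z)); apply: le_trans (lerD (lerD (hn w) h3) (hn z)) _.
by rewrite addrAC -splitr addrC.
Qed.

Lemma cmod_char_taylor n : exists2 C : R, 0 <= C & forall z w,
  cmod (set_val w ^ n - set_val z ^ n - n%:~R * set_val z ^ (n - 1) *
     (set_val w - set_val z)) <= C * cmod (set_val w - set_val z) ^+ 2.
Proof.
pose E n z w : R[i] := set_val w ^ n - set_val z ^ n - n%:~R * set_val z ^ (n - 1) *
     (set_val w - set_val z).
have step n' z w : E (n' + 1) z w = set_val w * E n' z w +
    n'%:~R * set_val z ^ (n' - 1) * (set_val w - set_val z) ^+ 2.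
  rewrite /E addrK rmorphD /= !expfzDr ?circle_neq0 //.
  rewrite exprN1 !expr1z; field; exact: circle_neq0.
have S1 n' z w : cmod (n'%:~R * set_val z ^ (n' - 1) * (set_val w - set_val z) ^+ 2) =
    (absz n')%:R * cmod (set_val w - set_val z) ^+ 2.
  by rewrite !cmodM cmod_charz mulr1 cmod_int expr2.
elim/int_rec: n => [|n [C C0 hC]|n [C C0 hC]].
- by exists 0 => // z w; rewrite !expr0z subrr !mul0r subrr cmod0.
- exists (C + n%:R) => [|z w]; first by rewrite addr_ge0.
  rewrite -/(E _ _ _) -addn1 PoszD step; apply: le_trans (cmodD _ _) _.
  rewrite S1 cmodM cmod_circle mul1r mulrDl lerD2r; exact: hC.
exists (C + n.+1%:R) => [|z w]; first by rewrite addr_ge0.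
rewrite -/(E _ _ _).
have -> : E (- n.+1%:Z) z w = (set_val w)^-1 * (E (- n%:Z) z w -
    (- n.+1%:Z)%:~R * set_val z ^ (- n.+1%:Z - 1) * (set_val w - set_val z) ^+ 2).
  have -> : - n%:Z = - n.+1%:Z + 1 by lia.
  rewrite step addrK mulrA mulVf ?circle_neq0 // mul1r; congr E.
rewrite cmodM cmodV cmod_circle invr1 mul1r; apply: le_trans (cmodB _ _) _.
rewrite S1 abszN /= mulrDl lerD2r; exact: hC.
Qed.

Lemma ler_norm_sin (t : R) : `|sin t| <= `|t|.
Proof.
suff h (u : R) : 0 < u -> `|sin u| <= u.
  have [t0|t0|->] := ltrgtP t 0; last by rewrite sin0.
    rewrite (ltr0_norm t0) -normrN -sinN; apply: h; lra.
  by rewrite (gtr0_norm t0); exact: h.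
move=> u0; have [|c _] := MVT_segment (ltW u0) (fun x _ => is_derive_sin x).
  by apply: continuous_subspaceT => x; exact: continuous_sin.
rewrite sin0 !subr0 => ->; rewrite normrM (gtr0_norm u0).
by apply: ler_piMl; [exact: ltW | exact: cos_max].
Qed.

Lemma cmod_expi_sub1 (t : R) : cmod (set_val (expi t) - 1) <= `|t|.
Proof.
rewrite -(ler_pXn2r (n := 2)) ?nnegrE ?cmod_ge0 //.
rewrite sqr_cmod val_expi /= subr0.
have := cos2Dsin2 (t / 2); have : cos t = cos (t / 2 *+ 2) by rewrite -mulr_natr divfK.
have := cos2Dsin2 t.
rewrite cos_mulr2n => h1 h2 h3.
have : `|sin (t / 2)| ^+ 2 <= `|t / 2| ^+ 2 by rewrite lerXn2r ?nnegrE // ler_norm_sin.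
rewrite !real_normK ?num_real //; nra.
Qed.

Lemma circle_rotate z w : exists v : circle R, set_val v = set_val z * set_val w.
Proof. by apply: circle_of; rewrite cmodM !cmod_circle mulr1. Qed.

Lemma circle_perfect z (d : R) : 0 < d ->
  exists w, cmod (set_val z - set_val w) < d /\ w != z.
Proof.
move=> d0; pose t := Num.min (d / 2) 1.
have t0 : 0 < t by rewrite lt_min divr_gt0 /=.
have t1 : t <= 1 by rewrite ge_min lexx orbT.
have td : t < d by rewrite gt_min; apply/orP; left; lra.
have [w hw] := circle_rotate z (expi t); exists w; split.
  rewrite hw -[X in X - _]mulr1 -mulrBr cmodM cmod_circle mul1r cmodBC.
  by apply: le_lt_trans (cmod_expi_sub1 _) _; rewrite gtr0_norm.
apply/eqP => wz; have : sin t = 0.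
  have : set_val (expi t) = 1 :> R[i].
    by apply: (mulfI (circle_neq0 z)); rewrite -hw wz mulr1.
  by rewrite val_expi => /(congr1 (@complex.Im R)).
have : 0 < sin t by apply: sin_gt0_pi; rewrite t0 /=; have := @pi_ge2 R; lra.
by move=> /[swap] ->; rewrite ltxx.
Qed.

(** The circle has no isolated point; without this, a [lim] along the punctured neighbourhoods would
    not be determined by convergence. *)
Lemma circle_dnbhs_proper z : ProperFilter (z^'%classic : set_system (circle R)).
Proof.
apply: Build_ProperFilter_ex => P; rewrite /dnbhs /within /= => /nbhs_circleP[d d0 hd].
by have [w [h1 h2]] := circle_perfect z d0; exists w; exact: hd.
Qed.

Lemma circle_deriveE f z (l : R[i]) : (forall e : R, 0 < e -> exists2 d : R, 0 < d &
    forall w, w != z -> cmod (set_val z - set_val w) < d ->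
      cmod (l - (f w - f z) / (set_val w - set_val z)) < e) ->
  circle_derive f z = l.
Proof.
move=> h; have PF := circle_dnbhs_proper z.
rewrite /circle_derive; apply: cvg_lim; first exact: norm_hausdorff.
move=> P /nbhs_cmodP[e e0 he]; have [d d0 hd] := h e e0.
apply/nbhs_circleP; exists d => // w zw wz; apply: he; exact: hd.
Qed.

(** The candidate [g] is synthesized from the expected coefficients, and the difference quotients of
    [f] are shown to tend to it. For this [f] is split into a partial sum, handled by the
    second-order estimate for each character, and a remainder [h] whose [polyw 1] bound is a small
    Lipschitz constant. *)
Theorem circle_derive_coef j f M : ccont f -> coef_bound (polyw j.+1) f M ->
  [/\ ccont (circle_derive f), coef_bound (polyw j) (circle_derive f) (2 ^+ j * M) &
      forall n, fourier_coef (circle_derive f) n = (n + 1)%:~R * fourier_coef f (n + 1)].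
Proof.
move=> cf hf.
have hM (s : seq int) : uniq s ->
    \sum_(n <- s) cmod ((n + 1)%:~R * fourier_coef f (n + 1)) <= M.
  move=> us; have us' : uniq [seq n + 1 | n <- s] by rewrite map_inj_uniq //; exact: addIr.
  apply: le_trans (hf _ us'); rewrite big_map; apply: ler_sum => n _.
  rewrite cmodM cmod_int mulrC ler_wpM2l ?cmod_ge0 // /polyw exprS.
  apply: le_trans (_ : (absz (n + 1))%:R * 1 <= _); first by rewrite mulr1.
  by apply: ler_pM => //; [rewrite lerDr | exact: polyw_ge1].
have [g cg hg] := fourier_synthesis hM.
suff -> : circle_derive f = g by split => //; exact: coef_bound_derivative.
apply/funext => z; apply: circle_deriveE => e e0.
have e4 : 0 < e / 4 by rewrite divr_gt0.
have p1 k : 1 <= polyw j.+1 k by exact: polyw_ge1.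
have p0 k : 0 <= polyw j.+1 k by exact: polyw_ge0.
have [s us hs] := partial_approx p0 (calg_bound cf hf) e4.
pose h z := f z - partial s f z.
have ch : ccont h by apply: ccontB => //; exact: ccont_partial.
have hs1 : coef_bound (polyw 1) h (e / 4).
  move=> t ut; apply: le_trans (hs t ut); apply: ler_sum => n _.
  by rewrite ler_wpM2l ?cmod_ge0 // /polyw ler_weXn2l // lerDl.
pose dS z : R[i] := \sum_(n <- s) fourier_coef f n * (n%:~R * set_val z ^ (n - 1)).
have cdS : ccont dS.
  apply: ccont_sum => n; apply: ccontZ; apply: ccontZ; exact: ccont_char.
have dSE n : fourier_coef dS n = (n + 1)%:~R * fourier_coef (partial s f) (n + 1).
  rewrite /dS fourier_coef_sum => [|k]; last by apply: ccontZ; apply: ccontZ; exact: ccont_char.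
  rewrite fourier_coef_sum => [|k]; last by apply: ccontZ; exact: ccont_char.
  rewrite mulr_sumr; apply: eq_bigr => k _.
  rewrite fourier_coefZ ?fourier_coefZ ?fourier_coef_char; try exact: ccont_char.
    rewrite subr_eq; case: eqP => [->|]; last by rewrite !mulr0.
    by rewrite !mulr1 mulrC.
  by apply: ccontZ; exact: ccont_char.
have gdS : cmod (g z - dS z) <= e / 4.
  apply: (@cmod_le_bound R (fun=> 1) (fun z => g z - dS z)) => //; first exact: ccontB.
  move=> t ut; have ut' : uniq [seq n + 1 | n <- t] by rewrite map_inj_uniq //; exact: addIr.
  apply: le_trans (hs1 _ ut'); rewrite big_map; apply: ler_sum => n _.
  rewrite fourier_coefB // hg dSE /h fourier_coefB //; last exact: ccont_partial.
  rewrite -mulrBr cmodM cmod_int mulr1 mulrC ler_wpM2l ?cmod_ge0 //.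
  by rewrite /polyw expr1 lerDr.
pose T n := projT1 (cid2 (cmod_char_taylor n)).
have T0 n : 0 <= T n by rewrite /T; case: cid2.
have TP n w : cmod (set_val w ^ n - set_val z ^ n - n%:~R * set_val z ^ (n - 1) *
     (set_val w - set_val z)) <= T n * cmod (set_val w - set_val z) ^+ 2.
  by rewrite /T; case: cid2 => C C0 hC; exact: hC.
pose D := \sum_(n <- s) cmod (fourier_coef f n) * T n.
have D0 : 0 <= D by apply: sumr_ge0 => n _; rewrite mulr_ge0 ?cmod_ge0.
exists (e / 4 / (D + 1)); first by rewrite divr_gt0 // ltr_wpDl.
move=> w wz; rewrite cmodBC ltr_pdivlMr ?ltr_wpDl // => hd.
have x0 : set_val w - set_val z != 0 :> R[i].
  by rewrite subr_eq0; apply: contra wz => /eqP/circle_inj ->.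
set x := set_val w - set_val z in hd x0 *.
have cx : 0 < cmod x by rewrite lt_neqAle eq_sym cmod_eq0 x0 cmod_ge0.
have E1 : cmod (partial s f w - partial s f z - dS z * x) <= D * cmod x ^+ 2.
  rewrite /partial /dS -sumrB mulr_suml -sumrB /D mulr_suml.
  apply: le_trans (cmod_sum _ _ _) _; apply: ler_sum => n _.
  move: (fourier_coef f n) => c.
  rewrite -mulrBr -mulrA -mulrBr cmodM -mulrA ler_wpM2l ?cmod_ge0 //; exact: TP.
have E2 := cmod_dist_bound z w ch hs1.
have -> : g z - (f w - f z) / x = (g z - dS z) - (partial s f w - partial s f z - dS z * x) / x
    - (h w - h z) / x.
  by rewrite /h; field.
apply: le_lt_trans (cmodB _ _) _.
have E3 : cmod ((h w - h z) / x) <= e / 4 by rewrite cmodM cmodV ler_pdivrMr.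
have E4 : cmod ((partial s f w - partial s f z - dS z * x) / x) <= D * cmod x.
  by rewrite cmodM cmodV ler_pdivrMr // -mulrA -expr2.
have E5 := cmodB (g z - dS z) ((partial s f w - partial s f z - dS z * x) / x).
have E6 : D * cmod x < e / 4.
  by apply: le_lt_trans hd; rewrite mulrC ler_pM2l // lerDl.
apply: le_lt_trans (lerD (le_trans E5 (lerD gdS E4)) E3) _.
by clear -e0 E6; lra.
Qed.

End Derivative.

Section HigherDerivatives.
Context {R : realType}.
Implicit Types (z w : circle R) (f g : circle R -> R[i]) (n : int) (s : seq int).
Implicit Types (M : R) (j l : nat).

Lemma polyw_pos j n : 0 <= polyw (R := R) j n. Proof. exact: polyw_ge0. Qed.

Lemma calg_polyw_le i j f : (i <= j)%N -> calg (polyw j) f -> calg (polyw i) f.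
Proof.
move=> ij [cf [M hM]]; apply: (calg_bound (M := M)) => // s us.
apply: le_trans (hM s us); apply: ler_sum => n _.
by rewrite ler_wpM2l ?cmod_ge0 // /polyw ler_weXn2l // lerDl.
Qed.

Lemma calg_derive j f : calg (polyw j.+1) f -> calg (polyw j) (circle_derive f).
Proof.
move=> [cf [M hM]]; have [c h _] := circle_derive_coef cf hM.
exact: calg_bound h.
Qed.

Lemma fourier_coef_derive f n : calg (polyw 1) f ->
  fourier_coef (circle_derive f) n = (n + 1)%:~R * fourier_coef f (n + 1).
Proof. by move=> [cf [M hM]]; have [_ _] := circle_derive_coef cf hM; apply. Qed.

Lemma calg_deriven l j f : calg (polyw (l + j)) f -> calg (polyw j) (circle_deriven l f).
Proof.
elim: l j => [//|l ih] j hf; apply: calg_derive; apply: ih.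
by rewrite addnS.
Qed.

Lemma circle_deriven_bound l j : exists2 C : R, 0 <= C & forall f M,
  ccont f -> coef_bound (polyw (l + j)) f M -> coef_bound (polyw j) (circle_deriven l f) (C * M).
Proof.
elim: l j => [|l ih] j; first by exists 1 => // f M _; rewrite mul1r.
have [C C0 hC] := ih j.+1; exists (2 ^+ j * C) => [|f M cf hf].
  by rewrite mulr_ge0 // exprn_ge0.
rewrite addSnnS in hf; rewrite -mulrA.
have hl : calg (polyw j.+1) (circle_deriven l f).
  by apply: calg_deriven; exact: calg_bound hf.
by have [] := circle_derive_coef (calg_ccont hl) (hC _ _ cf hf).
Qed.

Lemma cmod_deriven_le l : exists2 C : R, 0 <= C & forall f z,
  calg (polyw l) f -> cmod (circle_deriven l f z) <= C * nrm (polyw l) f.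
Proof.
have [C C0 hC] := circle_deriven_bound l 0; exists C => // f z hf.
have h : calg (polyw (l + 0)) f by rewrite addn0.
have := hC _ _ (calg_ccont h) (nrm_bound h); rewrite addn0; apply: cmod_le_bound.
  exact: calg_ccont (calg_deriven h).
by move=> k; exact: polyw_ge1.
Qed.

(** Here and below, identities between derivatives are checked on Fourier coefficients, which
    determine a continuous function, rather than on limits. *)
Lemma circle_deriveD f g : calg (polyw 1) f -> calg (polyw 1) g ->
  circle_derive (fun z => f z + g z) = fun z => circle_derive f z + circle_derive g z.
Proof.
move=> hf hg; have hfg := calgD (polyw_pos 1) hf hg.
have cf := calg_ccont hf; have cg := calg_ccont hg.
have df := calg_ccont (calg_derive hf); have dg := calg_ccont (calg_derive hg).
apply: fourier_coef_inj => [||n].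
- exact: calg_ccont (calg_derive hfg).
- exact: ccontD.
by rewrite fourier_coef_derive // !fourier_coefD // mulrDr !fourier_coef_derive.
Qed.

Lemma circle_deriveZ (c : R[i]) f : calg (polyw 1) f ->
  circle_derive (fun z => c * f z) = fun z => c * circle_derive f z.
Proof.
move=> hf; have hcf := calgZ c hf; have cf := calg_ccont hf.
have df := calg_ccont (calg_derive hf).
apply: fourier_coef_inj => [||n].
- exact: calg_ccont (calg_derive hcf).
- exact: ccontZ.
by rewrite fourier_coef_derive // !fourier_coefZ // mulrCA fourier_coef_derive.
Qed.

Lemma circle_derive_char n :
  circle_derive (fun z : circle R => set_val z ^ n) =
  fun z => n%:~R * set_val z ^ (n - 1).
Proof.
have hn := calg_char (polyw_pos 1 n).
apply: fourier_coef_inj => [||k].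
- exact: calg_ccont (calg_derive hn).
- by apply: ccontZ; exact: ccont_char.
rewrite fourier_coef_derive // fourier_coefZ ?fourier_coef_char; last exact: ccont_char.
by rewrite subr_eq; case: eqP => [->|]; rewrite ?mulr0.
Qed.

Lemma circle_derivenSr l f : circle_deriven l.+1 f = circle_deriven l (circle_derive f).
Proof. by rewrite /circle_deriven iterSr. Qed.

Lemma circle_derivenD l f g : calg (polyw l) f -> calg (polyw l) g ->
  circle_deriven l (fun z => f z + g z) =
  fun z => circle_deriven l f z + circle_deriven l g z.
Proof.
elim: l f g => [//|l ih] f g hf hg; rewrite !circle_derivenSr circle_deriveD.
- by rewrite ih //; exact: calg_derive.
- exact: calg_polyw_le hf.
- exact: calg_polyw_le hg.
Qed.

Lemma circle_derivenZ l (c : R[i]) f : calg (polyw l) f ->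
  circle_deriven l (fun z => c * f z) = fun z => c * circle_deriven l f z.
Proof.
elim: l f => [//|l ih] f hf; rewrite !circle_derivenSr circle_deriveZ.
  by rewrite ih //; exact: calg_derive.
exact: calg_polyw_le hf.
Qed.

Lemma circle_derivenB l f g : calg (polyw l) f -> calg (polyw l) g ->
  circle_deriven l (fun z => f z - g z) =
  fun z => circle_deriven l f z - circle_deriven l g z.
Proof.
move=> hf hg; have -> : (fun z => f z - g z) = (fun z => f z + -1 * g z).
  by apply/funext => z; rewrite mulN1r.
by rewrite (circle_derivenD hf (calgZ (-1) hg)) (circle_derivenZ _ hg); apply/funext => z; rewrite mulN1r.
Qed.

(** Leibniz's rule for a factor of degree one. At the point [c] itself only the last term remains:
    multiplication by [z - c] raises the order of vanishing by exactly one. *)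
Lemma circle_derivenX_sub l f c : calg (polyw l.+1) f ->
  circle_deriven l.+1 (fun z => (set_val z - c) * f z) =
  fun z => (set_val z - c) * circle_deriven l.+1 f z + l.+1%:R * circle_deriven l f z.
Proof.
have calgX j g : calg (polyw j) g -> calg (polyw j) (fun z => (set_val z - c) * g z).
  move=> hg; apply: calgM => //; first exact: weight_polyw.
  have h1 := calg_char (polyw_pos j 1); have h0 := calgZ c (calg_char (polyw_pos j 0)).
  apply: eq_calg (calgB (polyw_pos j) h1 h0) => z.
  by rewrite expr1z expr0z mulr1.
have dX g : calg (polyw 1) g -> circle_derive (fun z => (set_val z - c) * g z) =
    fun z => g z + (set_val z - c) * circle_derive g z.
  move=> hg; have cg := calg_ccont hg; have dg := calg_ccont (calg_derive hg).
  have E h : (fun z => (set_val z - c) * h z) = (fun z => set_val z ^ 1 * h z - c * h z).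
    by apply/funext => z; rewrite expr1z mulrBl.
  have cX h k : ccont h -> ccont (fun z => set_val z ^ k * h z).
    by move=> ch; apply: ccontM => //; exact: ccont_char.
  apply: fourier_coef_inj => [||n].
  - exact: calg_ccont (calg_derive (calgX _ _ hg)).
  - apply: ccontD => //; apply: calg_ccont (calgX 0%N _ (calg_derive hg)).
  rewrite fourier_coef_derive; last exact: calgX.
  rewrite fourier_coefD //; last by apply: calg_ccont (calgX 0%N _ (calg_derive hg)).
  rewrite !E !fourier_coefB ?fourier_coefZ ?fourier_coef_mulchar ?fourier_coef_derive //;
    try exact: cX; try exact: ccontZ.
  by rewrite addrK subrK rmorphD /=; ring.
elim: l f => [|l ih] f hf.
  by rewrite /circle_deriven /= dX //; apply/funext => z; rewrite mul1r addrC.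
rewrite circle_derivenSr dX; last exact: calg_polyw_le hf.
rewrite circle_derivenD; first last.
- apply: calgX; exact: calg_derive.
- exact: calg_polyw_le hf.
rewrite ih; last exact: calg_derive.
apply/funext => z; rewrite -!circle_derivenSr.
rewrite -[l.+2]addn1 natrD.
move: (circle_deriven l.+1 f z) (circle_deriven l.+2 f z) => x y; ring.
Qed.

End HigherDerivatives.

Local Opaque fourier_coef kercoef.

(** * Functions with small support *)

Section Rotation.
Context {R : realType}.
Implicit Types (z w v : circle R) (f g : circle R -> R[i]) (n : int).

Definition rot v z : circle R := projT1 (cid (circle_rotate v z)).

Lemma val_rot v z : set_val (rot v z) = set_val v * set_val z.
Proof. by rewrite /rot; case: cid. Qed.

Lemma dist_rot v z w : cmod (set_val (rot v z) - set_val (rot v w)) =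
  cmod (set_val z - set_val w).
Proof. by rewrite !val_rot -mulrBr cmodM cmod_circle mul1r. Qed.

Lemma ccont_rot v f : ccont f -> ccont (fun z => f (rot v z)).
Proof.
move=> cf e e0; have [d d0 hd] := cf e e0; exists d => // z w zw.
by apply: hd; rewrite dist_rot.
Qed.

(** Obvious for trigonometric polynomials; the general case follows by approximation with [kersum],
    which spares a change of variables in the integral. *)
Lemma fourier_coef_rot v f n : ccont f ->
  fourier_coef (fun z => f (rot v z)) n = set_val v ^ n * fourier_coef f n.
Proof.
move=> cf; apply/eqP; rewrite -subr_eq0 -cmod_eq0 eq_le cmod_ge0 andbT.
apply/ler_addgt0Pr => e e0; rewrite add0r.
have [N hN] := kersum_approx cf (ltac:(by rewrite divr_gt0) : 0 < e / 2).
have ck := ccont_kersum N f.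
have E : fourier_coef (fun z => kersum N f (rot v z)) n =
    set_val v ^ n * fourier_coef (kersum N f) n.
  pose c (j : 'I_N.*2.+1) : R[i] := (kercoef N j)%:C * fourier_coef f (j%:Z - N%:Z).
  have -> : (fun z => kersum N f (rot v z)) = fun z =>
      \sum_(j < N.*2.+1) (c j * set_val v ^ (j%:Z - N%:Z)) * set_val z ^ (j%:Z - N%:Z).
    apply/funext => z; apply: eq_bigr => j _; rewrite val_rot exprzMl ?unitfE ?circle_neq0 //.
    by rewrite mulrA.
  rewrite fourier_coef_sum => [|j]; last by apply: ccontZ; exact: ccont_char.
  rewrite fourier_coef_sum => [|j]; last by apply: ccontZ; exact: ccont_char.
  rewrite mulr_sumr; apply: eq_bigr => j _.
  rewrite !fourier_coefZ ?fourier_coef_char; try exact: ccont_char.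
  rewrite -/(c j); move: (c j) => x.
  by case: eqP => [->|]; rewrite ?mulr0 ?mulr1 // mulrC.
have E1 : cmod (fourier_coef (fun z => f (rot v z)) n -
    fourier_coef (fun z => kersum N f (rot v z)) n) <= e / 2.
  rewrite -fourier_coefB; try exact: ccont_rot.
  by apply: (cmod_fourier_coef_le _ (ccontB (ccont_rot v cf) (ccont_rot v ck))) => z; exact: hN.
have E2 : cmod (fourier_coef (kersum N f) n - fourier_coef f n) <= e / 2.
  rewrite -fourier_coefB //; apply: cmod_fourier_coef_le; first exact: ccontB.
  by move=> z; rewrite cmodBC.
rewrite (splitr e); apply: le_trans (lerD E1 E2).
have rotB (x y : R[i]) : cmod (x - y) = cmod (set_val v ^ n * x - set_val v ^ n * y).
  by rewrite -mulrBr cmodM cmod_charz mul1r.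
rewrite [X in _ <= _ + X]rotB E; apply: le_trans (cmodD _ _); rewrite addrA subrK; exact: lexx.
Qed.

(** Convolution with two half masses at [exp (i a)] and [exp (- i a)]: it damps the coefficient of
    index [n] by [cos (n a)], widens the support by at most [a], and preserves Lipschitz
    constants. *)
Definition avg (a : R) f : circle R -> R[i] := fun z =>
  2^-1 * (f (rot (expi a) z) + f (rot (expi (- a)) z)).

Lemma fourier_coef_avg a f n : ccont f ->
  fourier_coef (avg a f) n = (cos (n%:~R * a))%:C * fourier_coef f n.
Proof.
move=> cf; rewrite fourier_coefZ; last by apply: ccontD; exact: ccont_rot.
rewrite fourier_coefD; try exact: ccont_rot.
rewrite !fourier_coef_rot // -mulrDl mulrA -!expi_int; congr (_ * _).
rewrite !val_expi mulrN cosN sinN.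
have -> : 2^-1 = (2^-1 : R)%:C :> R[i] by rewrite fmorphV rmorph_nat.
apply/eqP; rewrite eq_complex /=; apply/andP; split; apply/eqP; [by field | by ring].
Qed.

Lemma dist_rot_expi (a : R) z : cmod (set_val (rot (expi a) z) - set_val z) <= `|a|.
Proof.
rewrite val_rot -[X in _ - X]mul1r -mulrBl cmodM cmod_circle mulr1.
exact: cmod_expi_sub1.
Qed.

Lemma cmod_avg_le a f z M : (forall w, cmod (set_val w - set_val z) <= `|a| -> cmod (f w) <= M) ->
  cmod (avg a f z) <= M.
Proof.
move=> h; rewrite cmodM.
have -> : cmod (2^-1 : R[i]) = 2^-1 by rewrite cmodV cmod_nat.
rewrite mulrC ler_pdivrMr //; apply: le_trans (cmodD _ _) _.
have h1 := h _ (dist_rot_expi a z).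
have : cmod (set_val (rot (expi (- a)) z) - set_val z) <= `|a|.
  by rewrite -(normrN a) dist_rot_expi.
by move=> /h h2; apply: le_trans (lerD h1 h2) _; rewrite mulr_natr mulr2n.
Qed.

Lemma cmod_avg_sub a f z M :
  (forall w, cmod (set_val w - set_val z) <= `|a| -> cmod (f w - f z) <= M) ->
  cmod (avg a f z - f z) <= M.
Proof.
move=> h; have -> : avg a f z - f z = avg a (fun w => f w - f z) z by rewrite /avg; field.
exact: cmod_avg_le.
Qed.

Lemma lipschitz_avg a f L : (forall z w, cmod (f z - f w) <= L * cmod (set_val z - set_val w)) ->
  forall z w, cmod (avg a f z - avg a f w) <= L * cmod (set_val z - set_val w).
Proof.
move=> h z w.
have -> : avg a f z - avg a f w = 2^-1 * ((f (rot (expi a) z) - f (rot (expi a) w)) +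
  (f (rot (expi (- a)) z) - f (rot (expi (- a)) w))) by rewrite /avg; ring.
rewrite cmodM; have -> : cmod (2^-1 : R[i]) = 2^-1 by rewrite cmodV cmod_nat.
rewrite mulrC ler_pdivrMr //; apply: le_trans (cmodD _ _) _.
apply: le_trans (lerD (h _ _) (h _ _)) _; rewrite !dist_rot.
by rewrite mulr_natr mulr2n.
Qed.

End Rotation.

Section Bump.
Context {R : realType}.
Implicit Types (z w v : circle R) (f g : circle R -> R[i]) (n : int).

Definition bump_rate : R := cos (1 / 4).

Lemma bump_rate_itv : 0 < bump_rate < 1.
Proof.
have p2 := @pi_ge2 R; rewrite cos_gt0_pihalf /=; last by lra.
by rewrite -cos0 ltr_cos ?in_itv /=; lra.
Qed.

Lemma cos_le_bump_rate (x : R) : 1 / 4 <= x <= 1 -> `|cos x| <= bump_rate.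
Proof.
move=> /andP[x1 x2]; have p2 := @pi_ge2 R.
rewrite ger0_norm; last by apply: cos_ge0_pihalf; lra.
have [->|hx] := eqVneq x (1 / 4); first exact: lexx.
by rewrite ltW // ltr_cos ?in_itv /=; lra.
Qed.

Lemma prod_le_rate (c : nat -> R) (t : R) (q p : nat) : 0 <= t ->
  (forall j, 0 <= c j <= 1) -> (forall j, (p <= j < p + q)%N -> c j <= t) ->
  \prod_(0 <= j < p + q) c j <= t ^+ q.
Proof.
move=> t0 h1 h2; rewrite (big_cat_nat (n := p)) //= ?leq_addr //.
rewrite -[X in _ <= X]mul1r; apply: ler_pM; rewrite ?prodr_ge0 //.
- by move=> i _; case/andP: (h1 i).
- by move=> i _; case/andP: (h1 i).
- by apply: prodr_ile1.
have -> : t ^+ q = \prod_(p <= j < p + q) t by rewrite prodr_const_nat addKn.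
rewrite big_seq [X in _ <= X]big_seq; apply: ler_prod => i.
by rewrite mem_index_iota => hi; rewrite (h2 i hi) andbT; case/andP: (h1 i).
Qed.

(* A tent function averaged over infinitely many rotations, by the angles [+- a j] with
   [a j = 1 / ((j + J) (j + J + 1))]: the coefficient of index [n] is multiplied by
   [cos (n a j)], which is bounded away from [1] in modulus for about [sqrt n] values of [j]. *)
Theorem bump_exists z0 (r : R) : 0 < r -> exists f, [/\ ccont f, f z0 != 0,
  forall z, r <= cmod (set_val z - set_val z0) -> f z = 0 &
  exists C, forall n k, (k * k <= absz n < k.+1 * k.+1)%N ->
    cmod (fourier_coef f n) <= C * bump_rate ^+ k].
Proof.
move=> r0; pose rho := r / 2; have rho0 : 0 < rho by rewrite divr_gt0.
(* The angles [a k = b k - b k.+1] have total sum [b 0 < rho / 4]. The support thus stays within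
   distance [2 rho = r] of [z0], and the value 1 of the tent function at [z0] changes by less than
   1. *)
pose J := (Num.truncn (4 / rho)).+1.
have J0 : 0 < J%:R :> R by rewrite ltr0n.
have J1 : 4 / rho < J%:R by exact: truncnS_gt.
pose b k : R := 1 / (k + J)%:R.
have kJ k : 0 < (k + J)%:R :> R by rewrite ltr0n addnS.
have b0 k : 0 < b k by rewrite divr_gt0.
have bJ : b 0%N < rho / 4.
  rewrite /b add0n ltr_pdivrMr // mulrC.
  by move: J1; rewrite ltr_pdivrMr // => h; lra.
pose a k := b k - b k.+1.
have aE k : a k = 1 / ((k + J)%:R * (k + J).+1%:R).
  rewrite /a /b addSn -natr1; have := kJ k => h.
  by field; rewrite gt_eqF ?gt_eqF // ltr_wpDl // ltW.
have a0 k : 0 <= a k by rewrite aE divr_ge0 // mulr_ge0.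
pose F0 z : R[i] := (Num.max 0 (1 - cmod (set_val z - set_val z0) / rho))%:C.
pose F := fix F k := if k is k'.+1 then avg (a k') (F k') else F0.
have max_lip (x y : R) : `|Num.max 0 x - Num.max 0 y| <= `|x - y|.
  by case: (lerP 0 x) => ?; case: (lerP 0 y) => ?; rewrite ler_norml;
    apply/andP; have := ler_norm (x - y); have := ler_norm (- (x - y)); rewrite normrN; lra.
have lipF k z w : cmod (F k z - F k w) <= rho^-1 * cmod (set_val z - set_val w).
  elim: k z w => [|k ih] z w; last exact: lipschitz_avg.
  rewrite /= /F0 -rmorphB cmod_real; apply: le_trans (max_lip _ _) _.
  have -> (x y : R) : 1 - x / rho - (1 - y / rho) = (y - x) / rho by ring.
  rewrite normrM mulrC.
  rewrite (ger0_norm (ltW (ltac:(by rewrite invr_gt0) : 0 < rho^-1))) ler_wpM2l ?invr_ge0 ?(ltW rho0) //.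
  apply: le_trans (ler_dist_cmod _ _) _.
  by rewrite opprB addrA subrK cmodBC.
have cF k : ccont (F k).
  move=> e e0; exists (e * rho); first by rewrite mulr_gt0.
  move=> z w zw; apply: le_lt_trans (lipF k z w) _.
  by rewrite mulrC ltr_pdivrMr.
have stepF k z : cmod (F k.+1 z - F k z) <= rho^-1 * a k.
  apply: cmod_avg_sub => w; rewrite (ger0_norm (a0 k)) => hw.
  by apply: le_trans (lipF k _ _) _; rewrite ler_wpM2l // invr_ge0 ltW.
have diffF k l z : (k <= l)%N -> cmod (F k z - F l z) <= rho^-1 * (b k - b l).
  elim: l => [|l ih]; first by rewrite leqn0 => /eqP ->; rewrite !subrr cmod0 mulr0.
  rewrite leq_eqVlt => /orP[/eqP ->|kl]; first by rewrite !subrr cmod0 mulr0.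
  have -> : F k z - F l.+1 z = (F k z - F l z) - (F l.+1 z - F l z) by ring.
  apply: le_trans (cmodB _ _) _; apply: le_trans (lerD (ih kl) (stepF l z)) _.
  by rewrite -mulrDr /a addrA subrK.
have F01 z : cmod (F0 z) <= 1.
  rewrite cmod_real ger0_norm ?le_max ?lexx // ge_max ler01 /=.
  by rewrite gerBl divr_ge0 ?cmod_ge0 // ltW.
have supF k z : rho + (b 0%N - b k) <= cmod (set_val z - set_val z0) -> F k z = 0.
  elim: k z => [|k ih] z hz.
    rewrite /= /F0; move: hz; rewrite subrr addr0 => hz.
    by rewrite max_l // subr_le0 ler_pdivlMr // mul1r.
  apply/eqP; rewrite -cmod_eq0 eq_le cmod_ge0 andbT; apply: cmod_avg_le => w.
  rewrite (ger0_norm (a0 k)) => hw; rewrite [X in cmod X](_ : _ = 0) ?cmod0 //; apply: ih.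
  have := cmodB (set_val w - set_val z0) (set_val w - set_val z).
  have -> : set_val w - set_val z0 - (set_val w - set_val z) = set_val z - set_val z0 by ring.
  by move: hz hw; rewrite /a; lra.
have coefF n k l : (k <= l)%N -> cmod (fourier_coef (F l) n) <=
    \prod_(0 <= j < k) `|cos (n%:~R * a j)|.
  have base : cmod (fourier_coef (F k) n) <= \prod_(0 <= j < k) `|cos (n%:~R * a j)|.
    elim: k {l} => [|k ih].
      rewrite big_geq //; apply: cmod_fourier_coef_le => //; exact: (cF 0%N).
    rewrite big_nat_recr //= fourier_coef_avg // cmodM cmod_real mulrC.
    by rewrite ler_wpM2r.
  elim: l => [|l ih]; first by rewrite leqn0 => /eqP k0; move: base; rewrite k0.
  rewrite leq_eqVlt => /orP[/eqP <- //|kl]; apply: le_trans (ih kl).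
  by rewrite /= fourier_coef_avg // cmodM cmod_real ler_piMl ?cmod_ge0 ?cos_max.
have ib0 : 0 < rho^-1 by rewrite invr_gt0.
have smallb (e : R) : 0 < e -> exists k, rho^-1 * b k <= e.
  move=> e0; exists (Num.truncn ((e * rho)^-1)).+1.
  rewrite mulrC ler_pdivrMr // /b ler_pdivrMr // mulrC -ler_pdivrMr ?mulr_gt0 // div1r.
  apply: le_trans (ltW (truncnS_gt _)) _.
  by rewrite ler_nat leq_addr.
have [|g cg hg] := @uniform_limit R F (fun k => rho^-1 * b k) cF _ smallb.
  move=> k l z kl; apply: le_trans (diffF k l z kl) _.
  by rewrite ler_wpM2l ?(ltW ib0) // gerBl ltW.
exists g; split => //.
- have : cmod (F 0%N z0 - g z0) < 1.
    apply: le_lt_trans (hg 0%N z0) _.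
    have : rho^-1 * b 0%N < rho^-1 * (rho / 4) by rewrite ltr_pM2l.
    have -> : rho^-1 * (rho / 4) = 1 / 4 by field; rewrite gt_eqF.
    by move=> h; lra.
  apply: contraTneq => ->; rewrite subr0 -leNgt /= /F0 subrr cmod0 mul0r subr0.
  by rewrite max_r // cmod_real normr1.
- move=> z hz; apply/eqP; rewrite -cmod_eq0 eq_le cmod_ge0 andbT.
  apply/ler_addgt0Pr => e e0; rewrite add0r.
  have [k hk] := smallb (e / 4) (ltac:(by rewrite divr_gt0)).
  have := hg k z; rewrite supF ?sub0r ?cmodN; first lra.
  have := b0 k; rewrite /rho in bJ *; lra.
have /andP[t0 t1] := bump_rate_itv.
exists ((bump_rate^-1) ^+ J.+1) => n k /andP[kn nk].
have coefg m : cmod (fourier_coef g n) <= \prod_(0 <= j < m) `|cos (n%:~R * a j)|.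
  apply/ler_addgt0Pr => e e0.
  have [k0 hk0] := smallb (e / 4) (ltac:(by rewrite divr_gt0)).
  pose l := maxn m k0.
  have bl : b l <= b k0.
    by rewrite /b !div1r lef_pV2 ?posrE ?kJ // ler_nat leq_add2r leq_maxr.
  have E1 : cmod (fourier_coef g n - fourier_coef (F l) n) <= 4 * (rho^-1 * b l).
    rewrite -fourier_coefB //; apply: cmod_fourier_coef_le; first exact: ccontB.
    by move=> z; rewrite cmodBC.
  have := coefF n m l (leq_maxl _ _).
  have := cmodD (fourier_coef g n - fourier_coef (F l) n) (fourier_coef (F l) n).
  rewrite subrK.
  have : rho^-1 * b l <= rho^-1 * b k0 by rewrite ler_pM2l.
  move: (cmod _) (cmod _) (cmod _) E1 => x y u E1; lra.
have pw (i j : nat) : (i <= j)%N -> bump_rate ^+ j <= bump_rate ^+ i.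
  by move=> ij; rewrite ler_wiXn2l // ltW.
have cosn x : 0 <= `|cos x : R| <= 1 by rewrite normr_ge0 cos_max.
have [kJ'|Jk] := ltnP k J.
  apply: le_trans (coefg 0%N) _; rewrite big_geq // -[1](mulVf (x := bump_rate ^+ J.+1)).
    by rewrite exprVn ler_wpM2l ?invr_ge0 ?exprn_ge0 ?(ltW t0) // pw // ltnW // ltnW.
  by rewrite expf_neq0 // gt_eqF.
(* For [p <= j < p + k.-1] one has [k < j + J < 2 k], so that [(j + J) (j + J + 1)] lies between
   [|n|] and [4 |n|], and [|n| a j] between 1/4 and 1. When [k < J] the empty product was enough,
   thanks to the constant. *)
pose p := (k.+1 - J)%N.
apply: le_trans (coefg (p + k.-1)%N) _.
apply: le_trans (prod_le_rate (t := bump_rate) (ltW t0) _ _) _ => //.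
  move=> j /andP[pj jp].
  have -> : `|cos (n%:~R * a j)| = `|cos ((absz n)%:R * a j)|.
    by case: (n) => // i; rewrite NegzE mulrNz mulNr cosN.
  apply: cos_le_bump_rate; rewrite aE mulrA mulr1 -natrM.
  have i0 : 0 < ((j + J) * (j + J).+1)%:R :> R by rewrite natrM mulr_gt0.
  rewrite ler_pdivlMr // ler_pdivrMr // [1 / 4]div1r ler_pdivrMl // mul1r.
  rewrite -natrM !ler_nat; rewrite /p in pj jp; clear -pj jp kn nk Jk.
  by apply/andP; split; nia.
have -> : bump_rate ^+ k.-1 = bump_rate^-1 ^+ 1 * bump_rate ^+ k.
  have : (0 < k)%N by apply: leq_trans Jk.
  by case: (k) => // k' _; rewrite expr1 exprS mulKf // gt_eqF.
by rewrite ler_wpM2r ?exprn_ge0 ?(ltW t0) // ler_weXn2l // invf_ge1 // ltW.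
Qed.

End Bump.

Section Summability.
Context {R : realType}.

Lemma sum_inv_sqr_nat (t : seq nat) : uniq t ->
  \sum_(k <- t) ((1 + k%:R) ^+ 2)^-1 <= 2 :> R.
Proof.
move=> ut; pose N := (\max_(k <- t) k).+1.
have tN : {subset t <= index_iota 0 N}.
  by move=> k kt; rewrite mem_index_iota /= /N ltnS (leq_bigmax_seq k).
have F0 k : 0 <= ((1 + k%:R) ^+ 2)^-1 :> R by rewrite invr_ge0 exprn_ge0 // addr_ge0.
apply: le_trans (_ : \sum_(0 <= k < N) ((1 + k%:R) ^+ 2)^-1 <= _).
  rewrite [X in _ <= X](bigID (mem t) xpredT) /=; apply: ler_wpDr; first exact: sumr_ge0.
  rewrite -[X in _ <= X]big_filter.
  rewrite (perm_big [seq i <- index_iota 0 N | i \in t]) //; apply: uniq_perm => //.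
    by rewrite filter_uniq // iota_uniq.
  move=> k; rewrite mem_filter; case: (boolP (k \in t)) => //= /tN ->; rewrite //.
have h n : \sum_(0 <= k < n.+1) ((1 + k%:R) ^+ 2)^-1 <= 2 - (1 + n%:R)^-1 :> R.
  elim: n => [|n ih]; first by rewrite big_nat1 addr0 expr1n invr1; lra.
  rewrite big_nat_recr //=; apply: le_trans (lerD ih (lexx _)) _.
  rewrite -[n.+1%:R]natr1 [n%:R + 1]addrC; have n1 : 0 < 1 + n%:R :> R by rewrite ltr_wpDr.
  have n2 : 0 < 1 + (1 + n%:R) :> R by rewrite addr_gt0.
  rewrite -subr_ge0.
  have -> : 2 - (1 + (1 + n%:R))^-1 - (2 - (1 + n%:R)^-1 + ((1 + (1 + n%:R)) ^+ 2)^-1) =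
      ((1 + n%:R) * (1 + (1 + n%:R)) ^+ 2)^-1 :> R by field; rewrite !gt_eqF.
  by rewrite invr_ge0 mulr_ge0 ?exprn_ge0 // ltW.
apply: le_trans (h _) _; rewrite lerBlDr lerDl invr_ge0; exact: addr_ge0.
Qed.

Lemma sum_inv_sqr_int (t : seq int) : uniq t ->
  \sum_(n <- t) ((1 + (absz n)%:R) ^+ 2)^-1 <= 4 :> R.
Proof.
move=> ut; rewrite (bigID (fun n : int => 0 <= n)) /=.
rewrite (_ : 4 = 2 + 2); last by ring.
pose F k : R := ((1 + k%:R) ^+ 2)^-1.
have h (P : pred int) : {in P &, injective absz} -> \sum_(n <- t | P n) F (absz n) <= 2.
  move=> hP; rewrite -big_filter -(big_map absz xpredT F); apply: sum_inv_sqr_nat.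
  rewrite map_inj_in_uniq ?filter_uniq // => m n; rewrite !mem_filter => /andP[Pm _] /andP[Pn _].
  exact: hP.
apply: lerD; apply: h => m n; rewrite /in_mem /=; lia.
Qed.

(** The exponent 4 is meant for [k] close to [sqrt |n|]: it yields the summable bound
    [(1 + |n|) ^ (- 2)]. *)
Lemma poly4_geometric_bound (q : R) : 0 < q < 1 ->
  exists2 C, 0 <= C & forall k : nat, q ^+ k <= C / (1 + k%:R) ^+ 4.
Proof.
move=> /andP[q0 q1]; pose x := - ln q.
have x0 : 0 < x by rewrite oppr_gt0 ln_lt0 // q0.
have qx : q = expR (- x) by rewrite opprK lnK.
exists (24 * expR x / x ^+ 4) => [|k].
  by rewrite divr_ge0 ?mulr_ge0 ?expR_ge0 ?exprn_ge0 // ltW.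
have k1 : 0 < 1 + k%:R :> R by rewrite ltr_wpDr.
rewrite 2?ler_pdivlMr ?exprn_gt0 //.
have := expR_ge1Dxn 3 (ltW (mulr_gt0 x0 k1)).
have -> : expR (x * (1 + k%:R)) = expR x / q ^+ k.
  by rewrite qx -expRM_natl -expRN -expRD; congr expR; ring.
have qk : 0 < q ^+ k by rewrite exprn_gt0.
rewrite exprMn (_ : 4`!%:R = 24) // => h.
have : x ^+ 4 * (1 + k%:R) ^+ 4 <= 24 * (expR x / q ^+ k) by lra.
by rewrite mulrA ler_pdivlMr // => {}h; rewrite -mulrA mulrC [(_ ^+ 4) * (x ^+ 4)]mulrC.
Qed.

Lemma floor_sqrt (n : nat) : exists k, (k * k <= n < k.+1 * k.+1)%N.
Proof.
elim: n => [|n [k /andP[h1 h2]]]; first by exists 0%N.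
have [h|h] := ltnP n.+1 (k.+1 * k.+1); first by exists k; rewrite h (leq_trans h1).
by exists k.+1; rewrite h /=; apply: leq_ltn_trans h2 _; nia.
Qed.

End Summability.

Section SubexponentialWeight.
Context {R : realType}.
Implicit Types (z w : circle R) (f g : circle R -> R[i]) (n : int).

Definition subexp_weight (omega : int -> R) : Prop := forall e : R, 0 < e ->
  exists2 C, 0 <= C & forall n, omega n <= C * expR (e * Num.sqrt (absz n)%:R).

Theorem calg_bump omega z0 (r : R) : weight omega -> subexp_weight omega -> 0 < r ->
  exists f, [/\ calg omega f, f z0 != 0 &
    forall z, r <= cmod (set_val z - set_val z0) -> f z = 0].
Proof.
move=> [om1 _] hsub r0; have [f [cf fz0 fr [C hC]]] := bump_exists z0 r0.
exists f; split => //.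
have /andP[t0 t1] := @bump_rate_itv R.
have C0 : 0 <= C.
  by have := hC 0 0%N isT; rewrite expr0 mulr1; apply: le_trans; exact: cmod_ge0.
(* One half of the exponential decay of the coefficients absorbs the weight, the other half makes
   the series converge. *)
pose e := - ln (@bump_rate R) / 2.
have e0 : 0 < e by rewrite divr_gt0 // oppr_gt0 ln_lt0 // t0.
have tE : @bump_rate R = expR (- (e + e)).
  by rewrite /e -splitr opprK lnK.
have [D D0 hD] := hsub e e0.
have q01 : 0 < expR (- e) < 1 by rewrite expR_gt0 /= expR_lt1 oppr_lt0.
have [B B0 hB] := poly4_geometric_bound q01.
apply: (@calg_bound R omega f (C * D * expR e * B * 4) cf) => s us.
apply: le_trans (_ : \sum_(n <- s) (C * D * expR e * B) * ((1 + (absz n)%:R) ^+ 2)^-1 <= _).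
  apply: ler_sum => n _; have [k hk] := floor_sqrt (absz n).
  apply: le_trans (_ : C * bump_rate ^+ k * (D * expR (e * Num.sqrt (absz n)%:R)) <= _).
    by apply: ler_pM (hC _ _ hk) (hD n); [exact: cmod_ge0 | exact: le_trans (om1 n)].
  case/andP: hk => k1 k2; have kE : 1 + k%:R = k.+1%:R :> R by rewrite -natr1 addrC.
  have sk : Num.sqrt (absz n)%:R <= 1 + k%:R :> R.
    rewrite -(ler_pXn2r (n := 2)) ?nnegrE ?sqrtr_ge0 ?addr_ge0 // sqr_sqrtr ?ler0n //.
    by rewrite kE expr2 -natrM ler_nat ltnW.
  have h1 : expR (e * Num.sqrt (absz n)%:R) <= expR e * expR e ^+ k.
    rewrite -expRM_natl -expRD ler_expR -[X in _ <= X + _]mulr1 [k%:R * e]mulrC -mulrDr.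
    by rewrite ler_pM2l.
  have h2 : bump_rate ^+ k * expR e ^+ k = expR (- e) ^+ k :> R.
    by rewrite -exprMn tE -expRD; congr (expR _ ^+ _); ring.
  apply: le_trans (_ : C * bump_rate ^+ k * (D * (expR e * expR e ^+ k)) <= _).
    by rewrite ler_wpM2l ?mulr_ge0 ?exprn_ge0 ?(ltW t0) // ler_wpM2l.
  have -> : C * bump_rate ^+ k * (D * (expR e * expR e ^+ k)) =
      (C * D * expR e) * expR (- e) ^+ k by rewrite -h2; ring.
  rewrite -[X in _ <= X]mulrA ler_wpM2l ?mulr_ge0 ?expR_ge0 //.
  apply: le_trans (hB k) _; rewrite ler_wpM2l // lef_pV2 ?posrE ?exprn_gt0 ?ltr_wpDr //.
  rewrite (_ : (1 + k%:R) ^+ 4 = ((1 + k%:R) ^+ 2) ^+ 2); last by rewrite -exprM.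
  rewrite lerXn2r ?nnegrE ?addr_ge0 ?sqr_ge0 // kE expr2 -natrM addrC natr1 ler_nat.
  exact: k2.
rewrite -mulr_sumr ler_wpM2l ?mulr_ge0 ?expR_ge0 //; exact: sum_inv_sqr_int.
Qed.

End SubexponentialWeight.

(** * Closed ideals with at most one common zero *)

Section BeurlingRing.
Context {R : realType}.

(** Bundled so that the algebra of a weight is a type with a canonical ring structure; [om 0 = 1]
    makes the constant function 1 of norm at most 1. *)
Record nweight := NWeight {
  nweight_fun :> int -> R;
  nweightP : weight nweight_fun;
  nweight0 : nweight_fun 0 = 1 }.

Lemma nweight_ge0 (om : nweight) n : 0 <= om n.
Proof. by have [h _] := nweightP om; apply: le_trans (h n). Qed.

Definition balg_pred (om : nweight) : {pred circle R -> R[i]} :=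
  fun f => `[< calg om f >].

Lemma balg_predE (om : nweight) f : (f \in balg_pred om) = `[< calg om f >].
Proof. by []. Qed.

(** A point of the domain makes the ring of functions on the circle nontrivial. *)
HB.instance Definition _ := isPointed.Build (circle R) (expi 0).

Lemma calg1 (om : nweight) : calg om (fun=> 1).
Proof. by apply: eq_calg (calg_char (nweight_ge0 om 0)) => z; rewrite expr0z. Qed.

Fact balg_subring (om : nweight) : subring_closed (balg_pred om).
Proof.
split=> [|f g|f g]; rewrite !balg_predE.
- apply/asboolP; exact: calg1.
- move=> /asboolP hf /asboolP hg; apply/asboolP; apply: calgB => //; exact: nweight_ge0.
- move=> /asboolP hf /asboolP hg; apply/asboolP; apply: calgM => //; exact: nweightP.
Qed.

HB.instance Definition _ (om : nweight) :=
  GRing.isSubringClosed.Build (circle R -> R[i]) (balg_pred om) (balg_subring om).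

Record balg (om : nweight) := Balg {
  balg_val :> circle R -> R[i];
  balg_valP : balg_val \in balg_pred om }.

HB.instance Definition _ (om : nweight) := [isSub for @balg_val om].
HB.instance Definition _ (om : nweight) := [Choice of balg om by <:].
HB.instance Definition _ (om : nweight) :=
  [SubChoice_isSubComNzRing of balg om by <:].

Lemma balg_calg (om : nweight) (x : balg om) : calg om x.
Proof. by apply/asboolP; have := balg_valP x. Qed.

Lemma balg_of (om : nweight) f : calg om f -> exists x : balg om, x = f :> (_ -> _).
Proof.
move=> hf; have h : f \in balg_pred om by apply/asboolP.
by exists (Balg h).
Qed.

Lemma balg_inj (om : nweight) (x y : balg om) :
  (forall z, balg_val x z = balg_val y z) -> x = y.
Proof. by move=> h; apply: val_inj; exact/funext. Qed.

Lemma balgD (om : nweight) (x y : balg om) z : balg_val (x + y) z = x z + y z.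
Proof. by []. Qed.

Lemma balgN (om : nweight) (x : balg om) z : balg_val (- x) z = - x z.
Proof. by []. Qed.

Lemma balgM (om : nweight) (x y : balg om) z : balg_val (x * y) z = x z * y z.
Proof. by []. Qed.

Lemma balg1 (om : nweight) z : balg_val (1 : balg om) z = 1.
Proof. by []. Qed.

Lemma balg0 (om : nweight) z : balg_val (0 : balg om) z = 0.
Proof. by []. Qed.

Lemma balgX (om : nweight) (x : balg om) k z : balg_val (x ^+ k) z = x z ^+ k.
Proof. by elim: k => [|k ih]; rewrite ?expr0 ?exprS ?balg1 // balgM ih. Qed.

Lemma calg_cst (om : nweight) (c : R[i]) : calg om (fun=> c).
Proof. by apply: eq_calg (calgZ c (calg1 om)) => z; rewrite mulr1. Qed.

Fact balg_cst_subproof (om : nweight) (c : R[i]) : (fun=> c) \in balg_pred om.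
Proof. by apply/asboolP; exact: calg_cst. Qed.

Definition balg_cst (om : nweight) (c : R[i]) : balg om := Balg (balg_cst_subproof om c).

Fact balg_cst_additive om : zmod_morphism (balg_cst om).
Proof. by move=> c d; apply: balg_inj. Qed.

Fact balg_cst_multiplicative om : monoid_morphism (balg_cst om).
Proof. by split=> [|c d]; apply: balg_inj. Qed.

HB.instance Definition _ om :=
  GRing.isZmodMorphism.Build R[i] (balg om) (balg_cst om) (balg_cst_additive om).
HB.instance Definition _ om :=
  GRing.isMonoidMorphism.Build R[i] (balg om) (balg_cst om) (balg_cst_multiplicative om).

Fact balg_char_subproof (om : nweight) (n : int) :
  (fun z : circle R => set_val z ^ n) \in balg_pred om.
Proof. by apply/asboolP; apply: calg_char; exact: nweight_ge0. Qed.

Definition balg_char (om : nweight) (n : int) : balg om := Balg (balg_char_subproof om n).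

Lemma balg_charX (om : nweight) (n : int) (k : nat) : balg_char om n ^+ k = balg_char om (n * k%:Z).
Proof. by apply: balg_inj => z; rewrite balgX /= exprnP exprz_exp. Qed.

Lemma balg_charM (om : nweight) (m n : int) :
  balg_char om m * balg_char om n = balg_char om (m + n).
Proof. by apply: balg_inj => z; rewrite balgM /= expfzDr ?circle_neq0. Qed.

End BeurlingRing.

Lemma perturbed_mul_le (R : realType) (a b d e : R) :
  d * d <= d -> d * (a + b + 1) <= e -> (a + d) * (b + d) <= a * b + e.
Proof. lra. Qed.

(** * The quotient seminorm modulo a closed ideal *)

Section QuotientSeminorm.
Context {R : realType} (om : nweight (R := R)) (I : set (circle R -> R[i])).
Hypothesis hI : closed_ideal om I.
Implicit Types (x y : balg om) (k l : circle R -> R[i]) (z : circle R).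

Let om0 n : 0 <= om n. Proof. exact: nweight_ge0. Qed.

Lemma ideal_calg k : I k -> calg om k.
Proof. by move=> /(closed_ideal_sub hI)/calgP. Qed.

Lemma idealM k x : I k -> I (fun z => x z * k z).
Proof. by move=> hk; apply: (closed_idealM hI) => //; apply/calgP; exact: balg_calg. Qed.

Lemma idealZ k (c : R[i]) : I k -> I (fun z => c * k z).
Proof. exact: (@idealM k (balg_cst om c)). Qed.

Lemma idealB k l : I k -> I l -> I (fun z => k z - l z).
Proof.
move=> hk hl; have := closed_idealD hI hk (idealZ (-1) hl).
by congr I; apply/funext => z; rewrite mulN1r.
Qed.

Definition qnorm x : R := inf [set nrm om (fun z => x z - k z) | k in I].

Lemma qnorm_set_neq0 x : [set nrm om (fun z => x z - k z) | k in I] !=set0.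
Proof. by have h := closed_ideal0 hI; exists (nrm om (fun z => x z - 0)), (fun=> 0). Qed.

Lemma qnorm_ge0 x : 0 <= qnorm x.
Proof.
by apply: lb_le_inf => [|_ [k _ <-]]; [exact: qnorm_set_neq0 | exact: nrm_ge0].
Qed.

Lemma qnorm_ex x (e : R) : 0 < e ->
  exists2 k, I k & nrm om (fun z => x z - k z) < qnorm x + e.
Proof.
move=> e0; have hE : has_inf [set nrm om (fun z => x z - k z) | k in I].
  split; first exact: qnorm_set_neq0.
  by exists 0 => _ [k _ <-]; exact: nrm_ge0.
by have [_ [k hk <-] h] := inf_adherent e0 hE; exists k.
Qed.

Lemma qnorm_le x k : I k -> qnorm x <= nrm om (fun z => x z - k z).
Proof.
move=> hk; apply: ge_inf; last by exists k.
by exists 0 => _ [l _ <-]; exact: nrm_ge0.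
Qed.

Lemma qnorm_le_nrm x : qnorm x <= nrm om x.
Proof.
apply: le_trans (qnorm_le x (closed_ideal0 hI)) _.
by rewrite (@eq_nrm _ om _ x) // => z; rewrite subr0.
Qed.

(** The only place where the seminorm is translated back into the ideal: as [I] is closed, elements
    at distance 0 from it belong to it. *)
Lemma qnorm_ideal x : qnorm x <= 0 -> I x.
Proof.
move=> hx; have cx := balg_calg x.
apply: (closed_ideal_closed hI); first exact/calgP.
move=> e e0; have [k hk h] := qnorm_ex x e0; exists k => //.
rewrite beurling_normE ?lte_fin; last by apply: calgB => //; exact: ideal_calg.
by apply: lt_le_trans h _; rewrite gerDr.
Qed.

Local Opaque qnorm.

Lemma qnorm_axioms : seminorm_axioms (balg_cst om) qnorm.
Proof.
have cB x k : I k -> calg om (fun z => x z - k z).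
  by move=> hk; apply: calgB => //; [exact: balg_calg | exact: ideal_calg].
split=> [x y|x y|c x|].
- apply/ler_addgt0Pr => e e0; have e2 : 0 < e / 2 by rewrite divr_gt0.
  have [k hk h1] := qnorm_ex x e2; have [l hl h2] := qnorm_ex y e2.
  apply: le_trans (qnorm_le _ (closed_idealD hI hk hl)) _.
  rewrite (@eq_nrm _ om _ (fun z => (x z - k z) + (y z - l z))) => [|z]; last first.
    by rewrite balgD opprD addrACA.
  apply: le_trans (nrmD om0 (cB _ _ hk) (cB _ _ hl)) _.
  apply: le_trans (lerD (ltW h1) (ltW h2)) _.
  by rewrite addrACA -splitr.
- apply/ler_addgt0Pr => e e0.
  have px := qnorm_ge0 x; have py := qnorm_ge0 y.
  pose d := Num.min 1 (e / (qnorm x + qnorm y + 1)).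
  have s0 : 0 < qnorm x + qnorm y + 1.
    by move: (qnorm x) (qnorm y) px py => a b a0 b0; lra.
  have d0 : 0 < d by rewrite lt_min ltr01 divr_gt0.
  have [k hk h1] := qnorm_ex x d0; have [l hl h2] := qnorm_ex y d0.
  have [K hK] : exists K : balg om, K = k :> (_ -> _) by apply/balg_of/ideal_calg.
  have hm : I (fun z => (x z * l z + y z * k z) - K z * l z).
    apply: idealB; last exact: idealM.
    by apply: (closed_idealD hI); exact: idealM.
  apply: le_trans (qnorm_le _ hm) _.
  rewrite (@eq_nrm _ om _ (fun z => (x z - k z) * (y z - l z))) => [|z]; last first.
    by rewrite balgM hK; ring.
  apply: le_trans (nrmM (nweightP om) (cB _ _ hk) (cB _ _ hl)) _.
  apply: le_trans (ler_pM (nrm_ge0 _ _) (nrm_ge0 _ _) (ltW h1) (ltW h2)) _.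
  have d1 : d <= 1 by rewrite ge_min lexx.
  have d2 : d * (qnorm x + qnorm y + 1) <= e.
    by rewrite -ler_pdivlMr // ge_min lexx orbT.
  have d3 : d * d <= d by rewrite ler_piMl // ltW.
  exact: perturbed_mul_le d3 d2.
- have [->|c0] := eqVneq c 0.
    rewrite cmod0 mul0r rmorph0 mul0r; apply: le_trans (qnorm_le_nrm _) _.
    by rewrite (@eq_nrm _ om _ (fun=> 0)) // nrm0.
  apply/ler_addgt0Pr => e e0.
  have cc : 0 < cmod c by rewrite lt_neqAle eq_sym cmod_eq0 c0 cmod_ge0.
  have [k hk h] := qnorm_ex x (divr_gt0 e0 cc).
  apply: le_trans (qnorm_le _ (idealZ c hk)) _.
  rewrite (@eq_nrm _ om _ (fun z => c * (x z - k z))) => [|z]; last by rewrite balgM mulrBr.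
  apply: le_trans (nrmZ_le c (cB _ _ hk)) _.
  apply: le_trans (ler_wpM2l (ltW cc) (ltW h)) _.
  by rewrite mulrDr [X in _ + X]mulrC divfK ?gt_eqF.
apply: le_trans (qnorm_le_nrm _) _; rewrite -(nweight0 om).
rewrite (@eq_nrm _ om _ (fun z => set_val z ^ 0)) ?nrm_char //.
Qed.

End QuotientSeminorm.

Section ApproximateInverses.
Context {R : realType} {A : comNzRingType} (iota : {rmorphism R[i] -> A}).
Context (p : A -> R) (hp : seminorm_axioms iota p).
Implicit Types (q u v x : A) (c lam w : R[i]).

Lemma approx_unit_mul u v q : u * v = 1 -> approx_unit p q -> approx_unit p (u * q).
Proof.
move=> uv h e e0; have [x hx] := h e e0; exists (v * x).
by rewrite mulrACA uv mul1r.
Qed.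

Lemma approx_unitZ c q : c != 0 -> approx_unit p q -> approx_unit p (iota c * q).
Proof.
by move=> c0; apply: (@approx_unit_mul _ (iota c^-1)); rewrite -rmorphM mulfV // rmorph1.
Qed.

Lemma approx_unit1 : approx_unit p 1.
Proof. by move=> e e0; exists 1; rewrite mulr1 subrr (seminorm0 hp) ltW. Qed.

Lemma approx_unit_geometric q :
  (forall e : R, 0 < e -> exists n, p (q ^+ n) <= e) -> approx_unit p (1 - q).
Proof.
move=> h e e0; have [n hn] := h e e0; exists (\sum_(i < n) q ^+ i).
rewrite (_ : _ - 1 = - q ^+ n) ?(seminormN hp) //.
by rewrite -[1 - q]opprB mulNr -subrX1 opprB addrAC subrr add0r.
Qed.

Lemma rmorph_mulACA (a b : R[i]) x y : iota a * x * (iota b * y) = iota (a * b) * (x * y).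
Proof. by rewrite mulrACA rmorphM. Qed.

Section Spectrum.
Variable Z : A.

Lemma approx_unit_resolvent : (forall lam, approx_unit p (Z - iota lam)) ->
  forall w, approx_unit p (1 - iota w * Z).
Proof.
move=> h w; have [->|w0] := eqVneq w 0.
  rewrite rmorph0 mul0r subr0; exact: approx_unit1.
rewrite (_ : 1 - _ = iota (- w) * (Z - iota w^-1)).
  by apply: approx_unitZ => //; rewrite oppr_eq0.
by rewrite rmorphN mulNr mulrBr -rmorphM mulfV // rmorph1 opprB.
Qed.

(** For [w] nonzero, [1 - w (Z / c - 1)] is a nonzero multiple of [Z - lam] with [lam = c + c / w],
    which differs from [c]. *)
Lemma approx_unit_resolvent_except c : c != 0 ->
  (forall lam, lam != c -> approx_unit p (Z - iota lam)) ->
  forall w, approx_unit p (1 - iota w * (iota c^-1 * Z - 1)).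
Proof.
move=> c0 h w; have [->|w0] := eqVneq w 0.
  rewrite rmorph0 mul0r subr0; exact: approx_unit1.
have wc : - (w / c) != 0 by rewrite oppr_eq0 mulf_neq0 ?invr_eq0.
rewrite (_ : 1 - _ = iota (- (w / c)) * (Z - iota (c + c / w))).
  apply: approx_unitZ => //; apply: h.
  by rewrite -subr_eq0 addrAC subrr add0r mulf_neq0 ?invr_eq0.
rewrite [RHS]mulrBr -[X in _ = _ - X](rmorphM iota).
rewrite (_ : - (w / c) * (c + c / w) = - (w + 1)); last by field; rewrite w0 c0.
by rewrite !rmorphN !rmorphM rmorphD rmorph1; ring.
Qed.

(** Write 1 as [Z ^ n Zi ^ n]: the first factor is [O(2 ^ (- n))] since [Z] is quasinilpotent, and
    the growth of the second one is slower than [2 ^ n]. *)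
Lemma seminorm1_le0 Zi : Z * Zi = 1 -> (forall lam, approx_unit p (Z - iota lam)) ->
  (forall e : R, 0 < e -> exists n, 2^-1 ^+ n * p (Zi ^+ n) <= e) -> p 1 <= 0.
Proof.
move=> hZ h hZi; have h2 : 0 < 2^-1 :> R by rewrite invr_gt0.
have [C hC] := quasinilpotent_exprn hp (approx_unit_resolvent h) h2.
have C0 : 0 <= C.
  by have := hC 0%N; rewrite !expr0 mulr1; apply: le_trans; exact: seminorm_ge0 hp _.
apply/ler_addgt0Pr => e e0; rewrite add0r.
have [n hn] := hZi (e / (C + 1)) (divr_gt0 e0 (ltr_wpDl C0 ltr01)).
rewrite -(expr1n _ n) -hZ exprMn; apply: le_trans (seminormM hp _ _) _.
apply: le_trans (ler_wpM2r (seminorm_ge0 hp _) (hC n)) _; rewrite -mulrA.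
apply: le_trans (ler_wpM2l C0 hn) _; rewrite mulrCA ler_piMr ?(ltW e0) //.
by rewrite ler_pdivrMr ?mul1r ?lerDl // ltr_wpDl.
Qed.

End Spectrum.
End ApproximateInverses.

Section SpectralSynthesis.
Context {R : realType} (om : nweight (R := R)).
Hypothesis hsub : subexp_weight om.
Implicit Types (z w : circle R) (f g : circle R -> R[i]) (lam c : R[i]).

Let om0 n : 0 <= om n. Proof. exact: nweight_ge0. Qed.

Local Notation Z := (balg_char om 1).

(** With [q = r * r], one factor [r ^ n] absorbs the subexponential weight and the other one tends
    to 0. *)
Lemma subexp_geometric (q e : R) : 0 <= q -> q < 1 -> 0 < e ->
  exists n : nat, q ^+ n * om n%:Z <= e /\ q ^+ n * om (- n%:Z) <= e.
Proof.
move=> q0 q1 e0; have [->|qn0] := eqVneq q 0.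
  by exists 1%N; rewrite expr1 !mul0r ltW.
have qp : 0 < q by rewrite lt_neqAle eq_sym qn0.
pose r := Num.sqrt q; have r0 : 0 < r by rewrite sqrtr_gt0.
have rq : r * r = q by rewrite -expr2 sqr_sqrtr.
have r1 : r < 1 by rewrite -(ltr_pXn2r (n := 2)) ?nnegrE ?(ltW r0) // expr2 rq expr1n.
have ln0 : 0 < - ln r by rewrite oppr_gt0 ln_lt0 // r0.
have [C C0 hC] := hsub ln0.
have hn (n : int) : q ^+ absz n * om n <= C * r ^+ absz n.
  apply: le_trans (ler_wpM2l (exprn_ge0 _ q0) (hC n)) _.
  rewrite -rq exprMn mulrCA ler_wpM2l // -mulrA -[X in _ <= X]mulr1.
  rewrite ler_wpM2l ?exprn_ge0 ?(ltW r0) //.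
  have -> : r ^+ absz n = expR (- (- ln r * (absz n)%:R)).
    by rewrite mulNr opprK mulrC expRM_natl lnK.
  rewrite -expRD expR_le1 addrC subr_le0 ler_pM2l //.
  rewrite -(ler_pXn2r (n := 2)) ?nnegrE ?sqrtr_ge0 // sqr_sqrtr //.
  by rewrite -natrX ler_nat; case: absz => // k; rewrite expnS leq_pmulr // expn_gt0.
have C1 : 0 < e / (C + 1) by rewrite divr_gt0 // ltr_wpDl.
have : (fun n : nat => r ^+ n) @ \oo --> (0 : R) by apply: cvg_expr; rewrite ger0_norm // ltW.
move=> /cvgrPdist_le/(_ _ C1)[] n _ /(_ n (leqnn n)).
rewrite /= sub0r normrN ger0_norm ?exprn_ge0 ?(ltW r0) // => h.
have hCr : C * r ^+ n <= e.
  apply: le_trans (ler_wpM2l C0 h) _; rewrite mulrCA ler_piMr ?(ltW e0) //.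
  by rewrite ler_pdivrMr ?mul1r ?lerDl // ltr_wpDl.
exists n; split; apply: le_trans hCr; first exact: (hn n%:Z).
by have := hn (- n%:Z); rewrite abszN.
Qed.

Lemma nrm_cst_le c : nrm om (fun=> c) <= cmod c.
Proof.
rewrite (@eq_nrm _ om _ (fun z => c * set_val z ^ 0)) => [|z]; last by rewrite expr0z mulr1.
apply: le_trans (nrmZ_le _ (calg_char (om0 0))) _.
by rewrite ler_piMr ?cmod_ge0 // (le_trans (nrm_char _)) // nweight0.
Qed.

Lemma char_factor n w : exists x : balg om, forall z,
  set_val z ^ n - set_val w ^ n = (set_val z - set_val w) * x z.
Proof.
have h (k : nat) : exists x : balg om, forall z,
    set_val z ^ k%:Z - set_val w ^ k%:Z = (set_val z - set_val w) * x z.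
  exists (\sum_(i < k) Z ^+ (k.-1 - i) * balg_cst om (set_val w) ^+ i) => z.
  have := congr1 (fun x : balg om => x z) (subrXX Z (balg_cst om (set_val w)) k).
  by rewrite balgM !balgD !balgN !balgX /= expr1z.
case: n => k; first exact: h.
have [x hx] := h k.+1.
exists (- (balg_cst om (set_val w ^ Negz k) * balg_char om (Negz k) * x)) => z.
rewrite balgN !balgM /= mulrN mulrCA -hx NegzE -!exprnN -!exprnP.
by field; rewrite !expf_neq0 ?circle_neq0.
Qed.

(** The functions vanishing at [w] are limits of multiples of [z - w]: differences of characters are
    exact multiples, and trigonometric polynomials are dense. *)
Lemma eval_factor f w (e : R) : calg om f -> 0 < e -> exists x : balg om,
  nrm om (fun z => f z - f w - (set_val z - set_val w) * x z) <= e.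
Proof.
move=> hf e0; have e2 : 0 < e / 2 by rewrite divr_gt0.
have [s us hs] := partial_approx om0 hf e2.
have cp := calg_partial s f om0; have cfp := calgB om0 hf cp.
have [X hX] := choice (fun n => char_factor n w).
exists (\sum_(n <- s) balg_cst om (fourier_coef f n) * X n).
pose h z := f z - partial s f z.
have E z : (set_val z - set_val w) * balg_val (\sum_(n <- s) balg_cst om (fourier_coef f n) * X n) z =
    partial s f z - partial s f w.
  rewrite -sumrB; elim: (s) => [|n t ih]; first by rewrite !big_nil balg0 mulr0.
  by rewrite !big_cons balgD mulrDr ih balgM /= mulrCA -hX mulrBr.
rewrite (@eq_nrm _ om _ (fun z => h z - h w)) => [|z]; last by rewrite E /h; ring.
apply: le_trans (nrmB om0 cfp (calg_cst om (h w))) _.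
rewrite (splitr e) lerD //; first exact: nrm_le.
apply: le_trans (nrm_cst_le _) _; apply: cmod_le_bound hs; first exact: calg_ccont cfp.
by case: (nweightP om).
Qed.

Section Quotient.
Variable I : set (circle R -> R[i]).
Hypothesis hI : closed_ideal om I.
Local Notation p := (qnorm I).
Let hp := qnorm_axioms hI.

Lemma qnorm_char_le n : p (balg_char om n) <= om n.
Proof.
apply: le_trans (qnorm_le_nrm hI _) _.
have -> : balg_val (balg_char om n) = (fun z => set_val z ^ n) by [].
exact: nrm_char.
Qed.

Lemma qnorm_char_scaled c k (n : nat) :
  p ((balg_cst om c * balg_char om k) ^+ n) <= cmod c ^+ n * om (k * n%:Z).
Proof.
rewrite exprMn -(rmorphXn (balg_cst om)) (seminormZ hp) balg_charX cmodX.
by rewrite ler_wpM2l ?exprn_ge0 ?cmod_ge0 ?qnorm_char_le.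
Qed.

Lemma balg_char0 : balg_char om 0 = 1.
Proof. by apply: balg_inj => z; rewrite balg1 /= expr0z. Qed.

Lemma balg_charK : Z * balg_char om (-1) = 1.
Proof. by rewrite balg_charM subrr balg_char0. Qed.

(** Off the unit circle a geometric series converges for any closed ideal, as the weight is
    subexponential in both directions. If [lam] is a point [w] of the circle and [g] in [I] does not
    vanish there, then [(z - w) x] is close to [g - g w], that is to the nonzero constant [- g w]
    modulo [I]. *)
Lemma approx_unit_sub lam :
  (forall w, set_val w = lam -> exists2 g, I g & g w != 0) ->
  approx_unit p (Z - balg_cst om lam).
Proof.
move=> hlam; have [l1|l1|l1] := ltrgtP (cmod lam) 1.
- pose q := balg_cst om lam * balg_char om (- 1).
  have -> : Z - balg_cst om lam = Z * (1 - q).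
    by rewrite mulrBr mulr1 mulrCA balg_charK mulr1.
  apply: approx_unit_mul balg_charK _; apply: (approx_unit_geometric hp) => e e0.
  have [n [_ hn]] := subexp_geometric (cmod_ge0 lam) l1 e0.
  by exists n; apply: le_trans (qnorm_char_scaled _ _ _) _; rewrite mulN1r.
- have l0 : lam != 0 by rewrite -cmod_eq0 gt_eqF // (lt_trans ltr01).
  have i1 : cmod lam^-1 < 1 by rewrite cmodV invf_lt1 // (lt_trans ltr01).
  pose q := balg_cst om lam^-1 * Z.
  have -> : Z - balg_cst om lam = balg_cst om (- lam) * (1 - q).
    rewrite mulrBr mulr1 mulrA -(rmorphM (balg_cst om)) mulNr mulfV //.
    by rewrite !(rmorphN (balg_cst om)) (rmorph1 (balg_cst om)) mulN1r opprK addrC.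
  apply: (@approx_unitZ _ _ (balg_cst om)); first by rewrite oppr_eq0.
  apply: (approx_unit_geometric hp) => e e0.
  have [n [hn _]] := subexp_geometric (cmod_ge0 _) i1 e0.
  by exists n; apply: le_trans (qnorm_char_scaled _ _ _) _; rewrite mul1r.
move=> e e0.
have [w hw] := circle_of l1; have [g Ig gw] := hlam w hw.
have gc : 0 < cmod (g w) by rewrite lt_neqAle eq_sym cmod_eq0 gw cmod_ge0.
have cg := ideal_calg hI Ig.
have [x hx] := eval_factor w cg (mulr_gt0 e0 gc).
exists (balg_cst om (- (g w)^-1) * x).
set y := _ - 1; apply: le_trans (@qnorm_le R om I y _ (idealZ hI (- (g w)^-1) Ig)) _.
pose h z := g z - g w - (set_val z - set_val w) * x z.
have ch : calg om h.
  have -> : h = (fun z => g z - g w - balg_val ((Z - balg_cst om (set_val w)) * x) z).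
    by apply/funext => z; rewrite balgM balgD balgN /= expr1z.
  exact: (calgB om0 (calgB om0 cg (calg_cst om (g w))) (balg_calg _)).
rewrite (@eq_nrm _ om _ (fun z => (g w)^-1 * h z)); last first.
  by move=> z; rewrite /y balgD balgN !balgM !balgD !balgN balg1 /= expr1z -hw /h; field.
by apply: le_trans (nrmZ_le _ ch) _; rewrite cmodV mulrC ler_pdivrMr.
Qed.

Lemma hull0P z : hull 0 I z <-> forall g, I g -> g z = 0.
Proof.
split=> [h g hg|h g hg j]; first exact: (h g hg 0%N).
by rewrite leqn0 => /eqP ->; exact: h.
Qed.

Lemma hull0N z : ~ hull 0 I z -> exists2 g, I g & g z != 0.
Proof.
move=> h; apply: contrapT => hN; apply: h; apply/hull0P => g hg.
by apply: contrapT => /eqP gz; apply: hN; exists g.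
Qed.

Theorem ideal_hull_empty : (forall z, ~ hull 0 I z) -> I (fun=> 1).
Proof.
move=> h; apply: (qnorm_ideal hI (x := 1)).
apply: (seminorm1_le0 hp balg_charK) => [lam|e e0].
  by apply: approx_unit_sub => w _; exact/hull0N/h.
have h2 : 2^-1 < 1 :> R by rewrite invf_lt1 // ltr1n.
have [|n [_ hn]] := @subexp_geometric 2^-1 e _ h2 e0; first by rewrite invr_ge0.
exists n; apply: le_trans hn; rewrite ler_wpM2l ?exprn_ge0 ?invr_ge0 //.
by rewrite balg_charX mulN1r qnorm_char_le.
Qed.

Theorem ideal_hull_sub1 w0 (s : R) m : 0 <= s -> s < m%:R ->
  (forall n : nat, om n%:Z = (1 + n%:R) `^ s) ->
  (forall z, hull 0 I z -> z = w0) -> I (fun z => (set_val z / set_val w0 - 1) ^+ m).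
Proof.
move=> s0 sm hom h; have w00 := circle_neq0 w0.
pose c := set_val w0; pose q := balg_cst om c^-1 * Z - 1.
have E : 1 + q = balg_cst om c^-1 * Z by rewrite addrC subrK.
have qm : p (q ^+ m) = 0.
  apply: (gelfand_hille hp (C0 := 1) (S := balg_cst om c * balg_char om (-1)) s0 sm).
  - apply: (approx_unit_resolvent_except hp w00) => lam lc.
    apply: approx_unit_sub => w hw; apply: hull0N => /h ww; move: lc.
    by rewrite -hw ww eqxx.
  - rewrite E mulrACA balg_charK mulr1 -(rmorphM (balg_cst om)) mulVf //.
    by rewrite (rmorph1 (balg_cst om)).
  - move=> n; rewrite E mul1r; apply: le_trans (qnorm_char_scaled _ _ _) _.
    by rewrite cmodV cmod_circle invr1 expr1n !mul1r hom.
  move=> e e0; have [C C0 hC] := hsub e0; exists C => n.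
  apply: le_trans (qnorm_char_scaled _ _ _) _.
  by rewrite cmod_circle expr1n mul1r mulN1r; have := hC (- n%:Z); rewrite abszN.
have : I (balg_val (q ^+ m)) by apply: (qnorm_ideal hI); rewrite qm.
congr I; apply/funext => z; rewrite balgX balgD balgN balgM balg1 /= expr1z.
by rewrite mulrC.
Qed.

End Quotient.

End SpectralSynthesis.

(** * Approximate identities at a point *)

Section ApproximateIdentity.
Context {R : realType} {A : comNzRingType} (iota : {rmorphism R[i] -> A}).
Context (p : A -> R) (hp : seminorm_axioms iota p).
Context (E : int -> A).
Hypotheses (E0 : E 0 = 1) (ED : forall m n, E (m + n) = E m * E n).
Implicit Types (x y : A) (a b n : int) (L : R).

(** Laurent polynomials with frequencies in [[a, b]] and sum of moduli of coefficients at most [L].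
    Repeated frequencies are allowed, so that sums and products need no regrouping. *)
Definition trig a b L x : Prop := exists r : seq (R[i] * int),
  [/\ x = \sum_(t <- r) iota t.1 * E t.2,
      forall t, t \in r -> a <= t.2 <= b &
      \sum_(t <- r) cmod t.1 <= L].

Lemma trigE n : trig n n 1 (E n).
Proof.
exists [:: (1, n)]; split; rewrite ?big_seq1 /= ?rmorph1 ?mul1r ?cmod1 //.
by move=> t; rewrite inE => /eqP -> /=; rewrite !lexx.
Qed.

Lemma trig_le a b L a' b' L' x : a' <= a -> b <= b' -> L <= L' -> trig a b L x -> trig a' b' L' x.
Proof.
move=> aa bb LL [r [-> h1 h2]]; exists r; split => // [t /h1 /andP[h3 h4]|].
  by rewrite (le_trans aa h3) (le_trans h4 bb).
exact: le_trans LL.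
Qed.

Lemma trig_ge0 a b L x : trig a b L x -> 0 <= L.
Proof. by move=> [r [_ _]]; apply: le_trans; apply: sumr_ge0 => t _; exact: cmod_ge0. Qed.

Lemma trig0 a b : trig a b 0 0.
Proof. by exists [::]; split; rewrite ?big_nil. Qed.

Lemma trigD a b L L' x y : trig a b L x -> trig a b L' y -> trig a b (L + L') (x + y).
Proof.
move=> [r [-> h1 h2]] [t [-> h3 h4]]; exists (r ++ t); split; rewrite ?big_cat ?lerD //.
by move=> i; rewrite mem_cat => /orP[/h1|/h3].
Qed.

Lemma trigZ a b L c x : trig a b L x -> trig a b (cmod c * L) (iota c * x).
Proof.
move=> [r [-> h1 h2]]; exists [seq (c * t.1, t.2) | t <- r]; split.
- by rewrite big_map mulr_sumr; apply: eq_bigr => t _; rewrite mulrA -rmorphM.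
- by move=> _ /mapP[t /h1 h ->].
rewrite big_map; apply: le_trans (ler_wpM2l (cmod_ge0 c) h2).
by rewrite mulr_sumr; apply: ler_sum => t _; rewrite cmodM.
Qed.

Lemma trigN a b L x : trig a b L x -> trig a b L (- x).
Proof.
by move=> /(trigZ (-1)); rewrite rmorphN rmorph1 mulN1r cmodN cmod1 mul1r.
Qed.

Lemma trigB a b L L' x y : trig a b L x -> trig a b L' y -> trig a b (L + L') (x - y).
Proof. by move=> hx hy; apply: trigD => //; exact: trigN. Qed.

Lemma trig_sum (T : Type) (r : seq T) a b (F : T -> R) (G : T -> A) :
  (forall i, trig a b (F i) (G i)) -> trig a b (\sum_(i <- r) F i) (\sum_(i <- r) G i).
Proof.
move=> h; elim: r => [|i r ih]; first by rewrite !big_nil; exact: trig0.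
by rewrite !big_cons; exact: trigD.
Qed.

Lemma trig_mulE n a b L x : trig a b L x -> trig (n + a) (n + b) L (E n * x).
Proof.
move=> [r [-> h1 h2]]; exists [seq (t.1, n + t.2) | t <- r]; split.
- by rewrite big_map mulr_sumr; apply: eq_bigr => t _; rewrite mulrCA ED.
- by move=> _ /mapP[t /h1 h ->] /=; rewrite !lerD2l.
by rewrite big_map.
Qed.

Lemma trigM a b a' b' L L' x y : trig a b L x -> trig a' b' L' y ->
  trig (a + a') (b + b') (L * L') (x * y).
Proof.
move=> [r [-> h1 h2]] hy; have L'0 := trig_ge0 hy; rewrite mulr_suml.
apply: (trig_le (lexx _) (lexx _) (ler_wpM2r L'0 h2)).
rewrite mulr_suml; elim: r h1 {h2} => [|t r ih] h1; first by rewrite !big_nil; exact: trig0.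
rewrite !big_cons; apply: trigD; last by apply: ih => i ir; apply: h1; rewrite inE ir orbT.
have /andP[at_ tb] := h1 t (mem_head _ _).
by rewrite -mulrA; apply: trigZ; apply: trig_le (trig_mulE t.2 hy); rewrite ?lerD2r.
Qed.

Lemma trig1 : trig 0 0 1 1.
Proof. by rewrite -E0; exact: trigE. Qed.

Lemma trigX b L x k : trig 0 b L x -> trig 0 (b *+ k) (L ^+ k) (x ^+ k).
Proof.
move=> hx; elim: k => [|k ih]; first by rewrite mulr0n !expr0; exact: trig1.
by rewrite mulrS !exprS; have := trigM hx ih; rewrite addr0.
Qed.

Lemma seminorm_trig (om : int -> R) a b L x W : (forall n, p (E n) <= om n) -> 0 <= W ->
  (forall n, a <= n <= b -> om n <= W) -> trig a b L x -> p x <= L * W.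
Proof.
move=> hE W0 hW [r [-> h1 h2]].
apply: le_trans (seminorm_sum hp _ _ _) _; apply: le_trans (ler_wpM2r W0 h2).
rewrite mulr_suml big_seq [X in _ <= X]big_seq; apply: ler_sum => t /h1 ht.
rewrite (seminormZ hp) ler_wpM2l ?cmod_ge0 //.
by apply: le_trans (hE _) (hW _ ht).
Qed.

Section Remainder.
Let u := E 1.

(* The remainder at [u = 1] of the expansion of [u ^ n] in powers of [u - 1]. *)
Definition taylor_rem (n : int) (d : nat) : A :=
  E n - \sum_(j < d) iota (binpoly j).[n%:~R] * (u - 1) ^+ j.

Lemma taylor_rem_step n d :
  taylor_rem (n + 1) d.+1 = taylor_rem n d.+1 + (u - 1) * taylor_rem n d.
Proof.
rewrite /taylor_rem ED -/u !big_ord_recl /= !expr0 !mulr1.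
have b0 (k : R[i]) : (binpoly 0).[k] = 1 by rewrite binpoly0 hornerC.
rewrite !b0.
have -> : \sum_(i < d) iota (binpoly (bump 0 i)).[(n + 1)%:~R] * (u - 1) ^+ bump 0 i =
   \sum_(i < d) iota (binpoly (bump 0 i)).[n%:~R] * (u - 1) ^+ bump 0 i +
   (u - 1) * \sum_(i < d) iota (binpoly i).[n%:~R] * (u - 1) ^+ i.
  rewrite mulr_sumr -big_split; apply: eq_bigr => i _.
  rewrite /bump /= add1n rmorphD /= binpoly_pascal rmorphD exprS; ring.
by ring.
Qed.

Lemma taylor_rem_0 d : taylor_rem 0 d.+1 = 0.
Proof.
rewrite /taylor_rem big_ord_recl big1 => [|i _].
  by rewrite binpoly0 hornerC rmorph1 expr0 mulr1 addr0 E0 subrr.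
by rewrite binpolyE big_ord_recl subr0 mul0r mul0r rmorph0 mul0r.
Qed.

(** The cofactor keeps its frequencies between 0 and [n], which is where the weight is controlled.
    It is built with [taylor_rem_step], read forwards for positive [n] and backwards for negative
    [n]; its coefficient bound rests on [k ^ (d + 1) + (k + 1) ^ d <= (k + 1) ^ (d + 1)]. *)
Lemma taylor_rem_factor d n : exists2 W, taylor_rem n d = (u - 1) ^+ d * W &
  forall a b, a <= n <= b -> a <= 0 <= b -> trig a b ((absz n)%:R ^+ d) W.
Proof.
elim: d n => [|d ih] n.
  exists (E n) => [|a b /andP[h1 h2] _].
    by rewrite /taylor_rem big_ord0 subr0 expr0 mul1r.
  by apply: trig_le (trigE n).
have powS (k : nat) : k%:R ^+ d.+1 + k.+1%:R ^+ d <= k.+1%:R ^+ d.+1 :> R.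
  rewrite !exprS mulrSr [X in _ <= X]mulrDl mul1r lerD2r ler_wpM2l //.
  by rewrite lerXn2r ?nnegrE // lerDl.
have powS' (k : nat) : k%:R ^+ d.+1 + k%:R ^+ d <= k.+1%:R ^+ d.+1 :> R.
  apply: le_trans (powS k); rewrite lerD2l lerXn2r ?nnegrE //.
  by rewrite ler_nat.
elim/int_rec: n => [|n [W hW tW]|n [W hW tW]].
- exists 0 => [|a b _ h]; first by rewrite taylor_rem_0 mulr0.
  by apply: trig_le (trig0 a b) => //; rewrite exprn_ge0.
- have [W' hW' tW'] := ih n; exists (W + W') => [|a b h1 h2].
    by rewrite -addn1 PoszD taylor_rem_step hW hW' exprS; ring.
  by apply: trig_le (lexx _) (lexx _) (powS' n) (trigD (tW a b _ _) (tW' a b _ _)); lia.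
have [W' hW' tW'] := ih (- n.+1%:Z); exists (W - W') => [|a b h1 h2].
  have := taylor_rem_step (- n.+1%:Z) d; rewrite (_ : - n.+1%:Z + 1 = - n%:Z); last by lia.
  by move=> h; rewrite mulrBr -hW h hW' exprS; ring.
rewrite !abszN /= in tW tW' *.
by apply: trig_le (lexx _) (lexx _) (powS n) (trigB (tW a b _ _) (tW' a b _ _)); lia.
Qed.

End Remainder.

(** * Bounded approximate identities from averages of powers *)

Section FejerType.
Variables (om : int -> R) (s : R) (m : nat).
Hypotheses (s0 : 0 <= s) (ms : m%:R <= s) (sm : s < m.+1%:R).
Hypotheses (pE : forall n, p (E n) <= om n)
  (om_nat : forall n : nat, om n%:Z = (1 + n%:R) `^ s)
  (om_ge : forall n, (1 + (absz n)%:R) `^ s <= om n)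
  (om_neg : forall k l : nat, (k <= l)%N -> om (- k%:Z) <= om (- l%:Z)).
Let u := E 1.
Let M := m.+1.
(** [K] bounds the coefficients of the geometric sum in [1 - favg N ^+ M] by which [approx_id N]
    differs from [favg N ^+ M], and [B N] bounds the frequencies of [approx_id N]. *)
Let K : R := M%:R * 2 ^+ M.
Let B := (M * M)%N.

Lemma om_gt0 n : 0 < om n.
Proof. by apply: lt_le_trans (om_ge n); rewrite powR_gt0 // ltr_wpDr. Qed.

(** This is where the monotony of the weight on negative integers acts: a negative frequency
    [k >= n] costs no more than [n], whatever the size of the weight there, and a nonnegative one
    only costs a power. *)
Lemma om_interval n k (b : nat) : (n <= k) || (0 <= k) -> k <= b%:Z ->
  om k <= om n + (1 + b%:R) `^ s.
Proof.
move=> nk kb; have [k0|k0] := lerP 0 k.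
  rewrite -[om k]add0r lerD ?(ltW (om_gt0 _)) //.
  have -> : k = (absz k)%:Z by lia.
  by rewrite om_nat ge0_ler_powR ?nnegrE ?addr_ge0 // lerD2l ler_nat; lia.
have -> : k = - (absz k)%:Z by lia.
have {1}-> : n = - (absz n)%:Z by lia.
by apply: ler_wpDr; [exact: powR_ge0 | apply: om_neg; lia].
Qed.

Lemma E_nat (n : nat) : E n%:Z = u ^+ n.
Proof. by elim: n => [|n ih]; rewrite ?E0 ?expr0 // -addn1 PoszD ED ih addn1 exprSr. Qed.

Definition favg N : A := iota N%:R^-1 * \sum_(k < N) u ^+ k.

Lemma trig_favg N : (0 < N)%N -> trig 0 N%:Z 1 (favg N).
Proof.
move=> N0; have h : trig 0 N%:Z (\sum_(k < N) 1) (\sum_(k < N) u ^+ k).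
  by apply: trig_sum => i; rewrite -E_nat; apply: trig_le (trigE i) => //; have := ltn_ord i; lia.
apply: trig_le (lexx _) (lexx _) _ (trigZ N%:R^-1 h).
by rewrite cmodV cmod_nat sumr_const card_ord mulVf // pnatr_eq0 -lt0n.
Qed.

Lemma favg_tel N : (u - 1) * favg N = iota N%:R^-1 * (E N%:Z - 1).
Proof. by rewrite mulrCA E_nat -subrX1. Qed.

Lemma trig_favg_tel N : trig 0 N%:Z (2 / N%:R) ((u - 1) * favg N).
Proof.
rewrite favg_tel; apply: trig_le (lexx _) (lexx _) _ (trigZ _ (trigB (trig_le _ _ (lexx _) (trigE N%:Z))
  (trig_le _ _ (lexx _) trig1))) => //.
by rewrite cmodV cmod_nat mulrC.
Qed.

(* It is a multiple of [favg N ^+ M], and [1 - approx_id N] one of [(u - 1) ^+ M]. *)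
Definition approx_id N : A := 1 - (1 - favg N ^+ M) ^+ M.

(** Each factor [u - 1], paired with one of the [M] factors [favg N], telescopes to
    [(u ^ N - 1) / N] and gains [2 / N]. *)
Lemma approx_id_bound N j : (0 < N)%N -> (j <= M)%N ->
  trig 0 (B * N)%:Z ((2 / N%:R) ^+ j * K) ((u - 1) ^+ j * approx_id N).
Proof.
move=> N0 jM; pose x := favg N ^+ M.
have tx : trig 0 (N%:Z *+ M) 1 x by have := trigX M (trig_favg N0); rewrite expr1n.
have E1 : approx_id N = x * \sum_(i < M) (1 - x) ^+ i.
  rewrite /approx_id -/x -opprB subrX1 -mulNr; congr (_ * _); ring.
have E2 : (u - 1) ^+ j * approx_id N =
    ((u - 1) * favg N) ^+ j * favg N ^+ (M - j) * \sum_(i < M) (1 - x) ^+ i.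
  by rewrite E1 exprMn -!mulrA; congr (_ * _); rewrite mulrA -exprD subnKC.
have ty : trig 0 ((N%:Z *+ M) *+ m) K (\sum_(i < M) (1 - x) ^+ i).
  have h (i : 'I_M) : trig 0 ((N%:Z *+ M) *+ m) (2 ^+ M) ((1 - x) ^+ i).
    have t1 : trig 0 (N%:Z *+ M) (1 + 1) (1 - x).
      by apply: trigB => //; apply: trig_le trig1.
    apply: trig_le (trigX i t1); rewrite //; last by apply: ler_weXn2l; [rewrite lerDl ler01 | exact: ltnW].
    by have := ltn_ord i; rewrite /M; nia.
  have := trig_sum (index_enum 'I_M) h.
  by have -> : \sum_(i < M) 2 ^+ M = K by rewrite sumr_const card_ord -[LHS]mulr_natl.
rewrite E2; have t2 := trigX j (trig_favg_tel N).
have t3 := trigX (M - j) (trig_favg N0); rewrite expr1n in t3.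
have t4 := trigM (trigM t2 t3) ty; rewrite !addr0 mulr1 in t4.
by apply: trig_le t4 => //; rewrite /B /M; nia.
Qed.

Lemma approx_id_complement N : (0 < N)%N ->
  exists x, 1 - approx_id N = (u - 1) ^+ M * x.
Proof.
move=> N0; have [y hy] : exists y, \sum_(k < N) u ^+ k - N%:R = (u - 1) * y.
  elim: (N) => [|n [y hy]]; first by exists 0; rewrite big_ord0 subrr mulr0.
  exists (y + \sum_(i < n) u ^+ i); rewrite big_ord_recr /= mulrDr -hy -subrX1.
  by rewrite -natr1; ring.
have n0 : N%:R != 0 :> R[i] by rewrite pnatr_eq0 -lt0n.
have F1 : 1 - favg N = (u - 1) * (- iota N%:R^-1 * y).
  have Nn : iota N%:R^-1 * N%:R = 1 by rewrite -(rmorph_nat iota) -rmorphM mulVf // rmorph1.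
  by rewrite mulrCA -hy /favg mulrBr !mulNr Nn; ring.
exists ((- iota N%:R^-1 * y * \sum_(i < M) favg N ^+ i) ^+ M).
rewrite /approx_id opprB addrC subrK -exprMn; congr (_ ^+ _).
by rewrite mulrA -F1 -[1 - favg N ^+ M]opprB subrX1 -mulNr opprB.
Qed.

(** For [x = |n|] beyond [N] the comparison needs an exponent at most [s], and in
    [ler_pow_ratio_in], below [N], an exponent at least [s]. Accordingly the Taylor polynomial has
    degree [m <= s] and the remainder order [M = m + 1 > s]. *)
Lemma ler_pow_ratio_out (x N : R) j : 0 < N -> N <= x -> j%:R <= s ->
  (x / N) ^+ j * N `^ s <= x `^ s.
Proof.
move=> N0 Nx js; have x1 : 1 <= x / N by rewrite ler_pdivlMr // mul1r.
have x0 : 0 <= x / N by apply: le_trans x1.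
rewrite -{2}[x](divfK (lt0r_neq0 N0)) powRM ?(ltW N0) // ler_wpM2r ?powR_ge0 //.
by rewrite -powR_mulrn // ler_powR.
Qed.

Lemma ler_pow_ratio_in (x N : R) j : 0 < N -> 0 <= x <= N -> s <= j%:R -> (0 < j)%N ->
  (x / N) ^+ j * N `^ s <= x `^ s.
Proof.
move=> N0 /andP[x0 xN] js j0; have [->|xn0] := eqVneq x 0.
  by rewrite mul0r expr0n (gtn_eqF j0) mul0r powR_ge0.
have xp : 0 < x / N by rewrite divr_gt0 // lt_neqAle eq_sym xn0.
rewrite -{2}[x](divfK (lt0r_neq0 N0)) powRM ?(ltW N0) ?(ltW xp) // ler_wpM2r ?powR_ge0 //.
rewrite -powR_mulrn ?(ltW xp) // ger_powR // xp /=.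
by rewrite ler_pdivrMr // mul1r.
Qed.

Let D : R := (B + 2)%:R `^ s.

Lemma D_ge0 : 0 <= D. Proof. exact: powR_ge0. Qed.

Lemma K_ge0 : 0 <= K. Proof. by rewrite mulr_ge0 ?exprn_ge0. Qed.

Lemma powR_linear_le (b N : nat) : (0 < N)%N -> (b <= B.+1 * N)%N ->
  (1 + b%:R) `^ s <= D * N%:R `^ s :> R.
Proof.
move=> N0 bN; rewrite -powRM // ge0_ler_powR ?nnegrE ?addr_ge0 //.
by rewrite -natrM addrC natr1 ler_nat; nia.
Qed.

(** For low frequencies the whole factor [(u - 1) ^ M] of the Taylor remainder is spent on
    [approx_id N], gaining [N ^ (- M)] against the [|n| ^ M] of the cofactor. *)
Lemma approx_id_rem_in N n : (0 < N)%N -> (absz n <= N)%N ->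
  p (approx_id N * taylor_rem n M) <=
    2 ^+ M * K * ((absz n)%:R / N%:R) ^+ M * (om n + D * N%:R `^ s).
Proof.
move=> N0 nN; have [W hW tW] := taylor_rem_factor M n.
pose a : int := if 0 <= n then 0 else n.
have t1 := trigM (approx_id_bound N0 (leqnn M)) (tW a N%:Z _ _).
have E1 : approx_id N * taylor_rem n M = (u - 1) ^+ M * approx_id N * W.
  by rewrite hW; ring.
have -> : 2 ^+ M * K * ((absz n)%:R / N%:R) ^+ M =
    (2 / N%:R) ^+ M * K * (absz n)%:R ^+ M by rewrite !expr_div_n; ring.
rewrite E1; apply: (seminorm_trig pE) (t1 _ _).
- by rewrite addr_ge0 ?mulr_ge0 ?powR_ge0 // ltW // om_gt0.
- move=> k; rewrite add0r => /andP[h1 h2].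
  apply: le_trans (@om_interval n k (B.+1 * N) _ _) _.
  + by move: h1; rewrite /a; case: ifP => h; lia.
  + by lia.
  by rewrite lerD2l powR_linear_le.
- by rewrite /a; case: ifP => h; lia.
by rewrite /a; case: ifP => h; lia.
Qed.

Lemma ler_powR_om n : (absz n)%:R `^ s <= om n.
Proof.
apply: le_trans (om_ge n); rewrite ge0_ler_powR ?nnegrE ?addr_ge0 //.
by rewrite lerDr.
Qed.

Lemma cmod_binpoly_le n j : (0 < absz n)%N -> (j <= M)%N ->
  cmod (binpoly j).[n%:~R] <= (M%:R * (absz n)%:R) ^+ j :> R.
Proof.
move=> n0 jM; apply: le_trans (cmod_binpoly _ _) _; rewrite cmod_int /rising.
have j0 : 0 < j`!%:R :> R by rewrite ltr0n fact_gt0.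
apply: le_trans (_ : \prod_(i < j) ((absz n)%:R + i%:R) <= _).
  have P0 : 0 <= \prod_(i < j) ((absz n)%:R + i%:R) :> R.
    by apply: prodr_ge0 => i _; exact: addr_ge0.
  by rewrite ler_pdivrMr // ler_peMr // ler1n fact_gt0.
have -> : (M%:R * (absz n)%:R) ^+ j = \prod_(i < j) (M%:R * (absz n)%:R) :> R.
  by rewrite prodr_const card_ord.
apply: ler_prod => i _; rewrite addr_ge0 //= -natrD -natrM ler_nat.
by have := ltn_ord i; nia.
Qed.

(** For high frequencies the remainder is expanded: the character and each Taylor term are estimated
    separately, the latter having order [j <= m <= s]. *)
Lemma approx_id_rem_out N n : (0 < N)%N -> (N < absz n)%N ->
  p (approx_id N * taylor_rem n M) <= (K * (1 + D) * (1 + M%:R * (2 * M%:R) ^+ M)) * om n.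
Proof.
move=> N0 nN; have n0 : (0 < absz n)%N by lia.
have D0 := D_ge0; have K0 := K_ge0.
have KD : 0 <= K * (1 + D) by rewrite mulr_ge0 // addr_ge0.
rewrite /taylor_rem mulrBr; apply: le_trans (seminormB hp _ _) _.
rewrite mulrDr mulr1 mulrDl; apply: lerD.
  have t0 := approx_id_bound N0 (leq0n M); rewrite !expr0 !mul1r in t0.
  rewrite mulrC -mulrA; apply: (seminorm_trig pE) (trig_mulE n t0).
    by rewrite mulr_ge0 ?addr_ge0 // ltW // om_gt0.
  move=> k; rewrite addr0 => /andP[h1 h2].
  apply: le_trans (@om_interval n k (absz n + B * N) _ _) _; [by rewrite h1 | by lia |].
  rewrite mulrDl mul1r lerD2l.
  apply: le_trans (powR_linear_le n0 _) _; first nia.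
  by rewrite ler_wpM2l // ler_powR_om.
rewrite mulr_sumr; apply: le_trans (seminorm_sum hp _ _ _) _.
have -> : K * (1 + D) * (M%:R * (2 * M%:R) ^+ M) * om n =
    \sum_(j < M) K * (1 + D) * ((2 * M%:R) ^+ M) * om n.
  by rewrite sumr_const card_ord -[RHS]mulr_natl; ring.
apply: ler_sum => j _; rewrite mulrCA (seminormZ hp).
have jM : (j <= M)%N by exact: ltnW.
have tj := approx_id_bound N0 jM.
have Np : 0 < N%:R :> R by rewrite ltr0n.
have pj : p (approx_id N * (u - 1) ^+ j) <= (2 / N%:R) ^+ j * K * ((1 + D) * N%:R `^ s).
  rewrite mulrC; apply: (seminorm_trig pE) tj; first by rewrite mulr_ge0 ?addr_ge0 ?powR_ge0.
  move=> k /andP[h1 h2]; apply: le_trans (@om_interval 0 k (B * N) _ _) _; [by rewrite h1|by []|].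
  rewrite mulrDl mul1r lerD //; last by apply: powR_linear_le => //; nia.
  rewrite (om_nat 0) addr0 ge0_ler_powR ?nnegrE //.
  by rewrite ler1n.
apply: le_trans (ler_pM (cmod_ge0 _) (seminorm_ge0 hp _) (cmod_binpoly_le n0 jM) pj) _.
have -> : (M%:R * (absz n)%:R) ^+ j * ((2 / N%:R) ^+ j * K * ((1 + D) * N%:R `^ s)) =
  K * (1 + D) * (2 * M%:R) ^+ j * (((absz n)%:R / N%:R) ^+ j * N%:R `^ s).
  by rewrite !exprMn !exprVn; ring.
apply: ler_pM.
- by rewrite mulr_ge0 // exprn_ge0 // mulr_ge0.
- by rewrite mulr_ge0 ?powR_ge0 // exprn_ge0 // divr_ge0.
- rewrite ler_wpM2l // ler_weXn2l //; rewrite -natrM ler1n; lia.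
apply: le_trans (ler_powR_om n); apply: ler_pow_ratio_out => //.
  by rewrite ler_nat ltnW.
by apply: le_trans ms; rewrite ler_nat; have := ltn_ord j; rewrite /M; lia.
Qed.

Lemma approx_id_rem_bound : exists2 C, 0 <= C & forall N n, (0 < N)%N ->
  p (approx_id N * taylor_rem n M) <= C * om n.
Proof.
have D0 := D_ge0; have K0 := K_ge0.
pose C1 := 2 ^+ M * K * (1 + D); pose C2 := K * (1 + D) * (1 + M%:R * (2 * M%:R) ^+ M).
have C10 : 0 <= C1 by rewrite !mulr_ge0 ?exprn_ge0 ?addr_ge0.
have C20 : 0 <= C2 by rewrite !mulr_ge0 ?addr_ge0 ?mulr_ge0 ?exprn_ge0 ?mulr_ge0.
exists (C1 + C2) => [|N n N0]; first exact: addr_ge0.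
have on := ltW (om_gt0 n); rewrite [X in _ <= X]mulrDl.
have [nN|nN] := leqP (absz n) N; last first.
  by apply: le_trans (approx_id_rem_out N0 nN) _; rewrite lerDr mulr_ge0.
apply: le_trans (approx_id_rem_in N0 nN) _; apply: ler_wpDr; first exact: mulr_ge0.
have Np : 0 < N%:R :> R by rewrite ltr0n.
rewrite -mulrA /C1 -[X in _ <= X]mulrA ler_wpM2l ?mulr_ge0 ?exprn_ge0 //.
rewrite mulrDr mulrDl mul1r lerD //.
  rewrite ler_piMl // exprn_ile1 ?divr_ge0 // ler_pdivrMr // mul1r ler_nat //.
rewrite mulrCA ler_wpM2l //; apply: le_trans (ler_powR_om n).
by apply: ler_pow_ratio_in => //; rewrite ?ler0n ?ler_nat // ltW.
Qed.

Lemma approx_id_rem_cvg0 n (e : R) : 0 < e -> exists N0 : nat,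
  forall N, (N0 <= N)%N -> p (approx_id N * taylor_rem n M) <= e.
Proof.
move=> e0; have D0 := D_ge0; have K0 := K_ge0; have on := ltW (om_gt0 n).
pose C := 2 ^+ M * K * (absz n)%:R ^+ M * (om n + D).
have C0 : 0 <= C by rewrite !mulr_ge0 ?exprn_ge0 ?addr_ge0.
have d0 : 0 < M%:R - s by rewrite subr_gt0.
(* For fixed [n] the bound is [C N ^ (s - M)]; [x] is the value of [N] at which it equals [e]. *)
pose x := (C / e) `^ ((M%:R - s)^-1).
exists (maxn (absz n) (Num.truncn x).+1) => N.
rewrite geq_max => /andP[nN xN].
have N0 : (0 < N)%N by apply: leq_trans xN.
have Np : 0 < N%:R :> R by rewrite ltr0n.
have xN' : x <= N%:R.
  by apply: le_trans (ltW (truncnS_gt x)) _; rewrite ler_nat.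
apply: le_trans (approx_id_rem_in N0 nN) _.
have Ns : 1 <= N%:R `^ s.
  have : 1 `^ s <= N%:R `^ s by rewrite ge0_ler_powR ?nnegrE // ler1n.
  by rewrite powR1.
have NM : N%:R ^+ M = N%:R `^ (M%:R - s) * N%:R `^ s :> R.
  by rewrite -powRD ?subrK ?powR_mulrn ?(ltW Np) //; apply/implyP => _; rewrite gt_eqF.
have Cx : C / e <= N%:R `^ (M%:R - s).
  have Ce : 0 <= C / e by rewrite divr_ge0 // ltW.
  have -> : C / e = x `^ (M%:R - s).
    by rewrite /x -powRrM mulVf ?powRr1 // gt_eqF.
  by rewrite ge0_ler_powR ?nnegrE ?powR_ge0 // ltW.
have N1 : 0 < N%:R ^+ M :> R by rewrite exprn_gt0.
rewrite expr_div_n mulrA mulrAC ler_pdivrMr //.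
apply: le_trans (_ : C * N%:R `^ s <= _).
  rewrite -[X in _ <= X]mulrA ler_wpM2l ?mulr_ge0 ?exprn_ge0 //.
  by rewrite [X in _ <= X]mulrDl lerD2r ler_peMr.
rewrite NM mulrA ler_wpM2r ?powR_ge0 // mulrC -ler_pdivrMr //.
Qed.

(** Dominated convergence. The second hypothesis says that [f], its derivatives at the point being
    zero, is a limit of combinations of Taylor remainders; on these [approx_id N] acts by a
    uniformly bounded amount for the tail, and tends to 0 on each of the finitely many other terms.
    As [1 - approx_id N] is a multiple of [(u - 1) ^+ M], this is the claim. *)
Theorem local_approx_identity (f : A) (c : int -> R[i]) :
  (forall e : R, 0 < e -> exists2 t : seq int, uniq t & forall t' : seq int, uniq t' ->
     (forall n, n \in t' -> n \notin t) -> \sum_(n <- t') cmod (c n) * om n <= e) ->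
  (forall (t : seq int) (e : R), uniq t -> 0 < e -> exists t' : seq int,
     [/\ uniq t', forall n, n \in t' -> n \notin t &
      p (f - \sum_(n <- t ++ t') iota (c n) * taylor_rem n M) <= e]) ->
  forall e : R, 0 < e -> exists x, p (f - (u - 1) ^+ M * x * f) <= e.
Proof.
move=> htail happ e e0; have e3 : 0 < e / 3 by rewrite divr_gt0.
have [C C0 hC] := approx_id_rem_bound.
have [t ut ht] := htail (e / 3 / (C + 1)) (divr_gt0 e3 (ltr_wpDl C0 ltr01)).
pose S := \sum_(n <- t) cmod (c n).
have S0 : 0 <= S by apply: sumr_ge0 => n _; exact: cmod_ge0.
have [N0 hN0] := choice (fun n => approx_id_rem_cvg0 n (divr_gt0 e3 (ltr_wpDl S0 ltr01))).
pose N := (\max_(n <- t) N0 n).+1.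
pose V := approx_id N.
have [x hx] := approx_id_complement (ltn0Sn _ : (0 < N)%N).
have v0 := seminorm_ge0 hp V.
have [t' [ut' tt' ht']] := happ t (e / 3 / (p V + 1)) ut (divr_gt0 e3 (ltr_wpDl v0 ltr01)).
exists x; rewrite -hx -/V mulrBl mul1r opprB addrC subrK.
set P := \sum_(n <- _) _ in ht'.
have -> : V * f = V * (f - P) + (\sum_(n <- t) iota (c n) * (V * taylor_rem n M) +
    \sum_(n <- t') iota (c n) * (V * taylor_rem n M)).
  rewrite -big_cat /= (_ : \sum_(n <- _) _ = V * P); first by rewrite mulrBr subrK.
  by rewrite mulr_sumr; apply: eq_bigr => n _; rewrite mulrCA.
have frac (y : R) : 0 <= y -> y * (e / 3 / (y + 1)) <= e / 3.
  move=> y0; rewrite mulrCA ler_piMr ?(ltW e3) // ler_pdivrMr ?ltr_wpDl // mul1r lerDl //.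
apply: le_trans (seminormD hp _ _) _.
have -> : e = e / 3 + (e / 3 + e / 3) by field.
apply: lerD.
  apply: le_trans (seminormM hp _ _) _; apply: le_trans (ler_wpM2l v0 ht') _; exact: frac.
apply: le_trans (seminormD hp _ _) _; apply: lerD.
  apply: le_trans (seminorm_sum hp _ _ _) _; apply: le_trans (frac _ S0).
  rewrite mulr_suml big_seq [X in _ <= X]big_seq; apply: ler_sum => n nt.
  rewrite (seminormZ hp) ler_wpM2l ?cmod_ge0 //; apply: (hN0 n).
  by rewrite /N leqW // (leq_bigmax_seq n).
apply: le_trans (seminorm_sum hp _ _ _) _; apply: le_trans (frac _ C0).
apply: le_trans (ler_wpM2l C0 (ht _ ut' tt')); rewrite mulr_sumr; apply: ler_sum => n _.
by rewrite (seminormZ hp) mulrCA ler_wpM2l ?cmod_ge0 // hC.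
Qed.

End FejerType.

End ApproximateIdentity.

(** * Ideals with a countable hull *)

Section IsolatedPoint.
Context {R : realType}.
Implicit Types (z w y : circle R) (H : set (circle R)).

(** Baire's argument: if no point is isolated, nested balls centred in [H] can be made to avoid the
    points of [H] one after the other, and their common point contradicts the enumeration [f]. *)
Theorem countable_closed_isolated H : H !=set0 -> countable H ->
  (forall z, (forall d : R, 0 < d -> exists2 w, H w & cmod (set_val z - set_val w) < d) -> H z) ->
  exists2 z, H z & exists2 r : R, 0 < r &
    forall w, H w -> cmod (set_val w - set_val z) < r -> w = z.
Proof.
move=> [z0 Hz0] /countable_injP[f finj] Hcl; apply: contrapT => hN.
have perf z (r : R) : H z -> 0 < r ->
    exists w, [/\ H w, cmod (set_val w - set_val z) < r & w <> z].
  move=> Hz r0; apply: contrapT => hw; apply: hN; exists z => //; exists r => // w Hw wr.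
  by apply: contrapT => wz; apply: hw; exists w.
(* The ball to be avoided has radius [4 * t'.2] because [uniform_limit] locates the limit within
   four times the current radius. The implications make the step total, as [choice] requires. *)
have step (t : nat * (circle R * R)) : exists t' : circle R * R,
    H t.2.1 -> 0 < t.2.2 -> [/\ H t'.1, 0 < t'.2, t'.2 <= t.2.2 / 2,
      cmod (set_val t.2.1 - set_val t'.1) <= t.2.2 / 2 &
      forall w, H w -> cmod (set_val t'.1 - set_val w) <= 4 * t'.2 -> f w <> t.1].
  case: t => k [y r] /=; have [Hy|] := pselect (H y); last by exists (y, r).
  have [r0|] := ltP 0 r; last by exists (y, r).
  have r2 : 0 < r / 2 by rewrite divr_gt0.
  have [y' [Hy' dy' fy']] : exists y', [/\ H y', cmod (set_val y - set_val y') <= r / 2 & f y' <> k].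
    have [fyk|] := pselect (f y = k); last first.
      by exists y; rewrite subrr cmod0 ltW.
    have [w [Hw dw wy]] := perf y (r / 2) Hy r2; exists w; split => //.
      by rewrite cmodBC ltW.
    by rewrite -fyk => /finj; rewrite !inE => /(_ Hw Hy).
  have [[q [Hq fq]]|noq] := pselect (exists q, H q /\ f q = k); last first.
    exists (y', r / 2) => _ _ /=; split => // w Hw _ fw; apply: noq; by exists w.
  have qy : 0 < cmod (set_val y' - set_val q).
    rewrite lt_neqAle eq_sym cmod_ge0 andbT cmod_eq0 subr_eq0.
    by apply/eqP => /circle_inj E; apply: fy'; rewrite E.
  exists (y', Num.min (r / 2) (cmod (set_val y' - set_val q) / 8)) => _ _ /=; split => //.
  - by rewrite lt_min r2 divr_gt0.
  - by rewrite ge_min lexx.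
  move=> w Hw dw fw; have E : w = q by apply: finj; rewrite ?inE // fw fq.
  have := ge_min (cmod (set_val y' - set_val q) / 8) (r / 2) (cmod (set_val y' - set_val q) / 8).
  rewrite lexx orbT; rewrite E in dw; move: (Num.min _ _) dw => x; lra.
have [S hS] := choice step.
pose X := fix X k : circle R * R := if k is k'.+1 then S (k', X k') else (z0, 1).
have X0 k : H (X k).1 /\ 0 < (X k).2.
  elim: k => [|k [h1 h2]]; first by rewrite /= ltr01.
  by have [] := hS (k, X k) h1 h2.
have XS k : [/\ (X k.+1).2 <= (X k).2 / 2,
      cmod (set_val (X k).1 - set_val (X k.+1).1) <= (X k).2 / 2 &
      forall w, H w -> cmod (set_val (X k.+1).1 - set_val w) <= 4 * (X k.+1).2 -> f w <> k].
  by have [h1 h2] := X0 k; have [] := hS (k, X k) h1 h2.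
have r_le k : (X k).2 <= 2^-1 ^+ k.
  elim: k => [|k ih]; first by rewrite expr0.
  by have [h _ _] := XS k; rewrite exprS; apply: le_trans h _; rewrite mulrC ler_wpM2l ?invr_ge0.
have smallr (e : R) : 0 < e -> exists k, (X k).2 <= e.
  by move=> e0; have [N hN'] := half_expn_small e0; exists N; exact: le_trans (r_le N) _.
have dist k l : (k <= l)%N -> cmod (set_val (X k).1 - set_val (X l).1) <= (X k).2 - (X l).2.
  elim: l => [|l ih]; first by rewrite leqn0 => /eqP ->; rewrite !subrr cmod0.
  rewrite leq_eqVlt => /orP[/eqP ->|kl]; first by rewrite !subrr cmod0.
  have [h1 h2 _] := XS l; have := ih kl => h3.
  have -> : set_val (X k).1 - set_val (X l.+1).1 = (set_val (X k).1 - set_val (X l).1) +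
    (set_val (X l).1 - set_val (X l.+1).1) by ring.
  apply: le_trans (cmodD _ _) _; apply: le_trans (lerD h3 h2) _; lra.
(* Applied to constant functions, [uniform_limit] is the completeness of the complex numbers. *)
have [||g cg hg] := @uniform_limit R (fun k _ => set_val (X k).1) (fun k => (X k).2) _ _ smallr.
- by move=> k; exact: ccont_cst.
- move=> k l _ kl; apply: le_trans (dist k l kl) _.
  by rewrite gerBl ltW //; case: (X0 l).
pose x := g z0.
have hx k : cmod (set_val (X k).1 - x) <= 4 * (X k).2 by exact: hg.
have [y hy] : exists y : circle R, set_val y = x.
  apply: circle_of; apply/eqP; rewrite -subr_eq0 -normr_eq0 eq_le normr_ge0 andbT.
  apply/ler_addgt0Pr => e e0; rewrite add0r.
  have [k hk] := smallr (e / 4) (ltac:(by rewrite divr_gt0)).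
  rewrite -(cmod_circle (X k).1); apply: le_trans (ler_dist_cmod _ _) _.
  by rewrite cmodBC; apply: le_trans (hx k) _; lra.
have Hy : H y.
  apply: Hcl => d d0; have [k hk] := smallr (d / 5) (ltac:(by rewrite divr_gt0)).
  exists (X k).1; first by case: (X0 k).
  by rewrite hy cmodBC; apply: le_lt_trans (hx k) _; lra.
have [_ _ h] := XS (f y); apply: (h y Hy) => //.
by rewrite hy; exact: hx.
Qed.

End IsolatedPoint.

Section Ideals.
Context {R : realType} (om : nweight (R := R)).
Implicit Types (z w : circle R) (f g h : circle R -> R[i]) (I : set (circle R -> R[i])).

Let om0 n : 0 <= om n. Proof. exact: nweight_ge0. Qed.

Definition colon I f : set (circle R -> R[i]) :=
  [set g | beurling_algebra om g /\ I (fun z => g z * f z)].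

Lemma calg_idealM I f g : closed_ideal om I -> calg om f -> I g -> I (fun z => f z * g z).
Proof. by move=> hI hf; apply: (closed_idealM hI); exact/calgP. Qed.

Lemma closed_ideal_approx I f : closed_ideal om I -> calg om f ->
  (forall e : R, 0 < e -> exists2 g, I g & nrm om (fun z => f z - g z) <= e) -> I f.
Proof.
move=> hI hf h; apply: (closed_ideal_closed hI); first exact/calgP.
move=> e e0; have [g hg hfg] := h (e / 2) (ltac:(by rewrite divr_gt0)).
exists g => //; rewrite beurling_normE; last by apply: calgB => //; exact: ideal_calg hg.
by rewrite lte_fin; apply: le_lt_trans hfg _; rewrite ltr_pdivrMr // mulr_natr mulr2n ltrDl.
Qed.

Lemma closed_ideal_colon I f : closed_ideal om I -> calg om f -> closed_ideal om (colon I f).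
Proof.
move=> hI hf; have hom := nweightP om; split.
- by move=> g [].
- split; first by apply/calgP; exact: calg0.
  have := closed_ideal0 hI; congr I; apply/funext => z; by rewrite mul0r.
- move=> g h [/calgP cg hg] [/calgP ch hh]; split; first by apply/calgP; exact: calgD.
  have := closed_idealD hI hg hh; congr I; apply/funext => z; by rewrite mulrDl.
- move=> g h /calgP cg [/calgP ch hh]; split; first by apply/calgP; exact: calgM.
  have := calg_idealM hI cg hh; congr I; apply/funext => z; by rewrite mulrA.
move=> g /calgP cg happ; split; first exact/calgP.
apply: (closed_ideal_approx hI (calgM hom cg hf)) => e e0.
have n0 := nrm_ge0 om f.
have [h [/calgP ch hh] hgh] := happ (e / (nrm om f + 1)) (divr_gt0 e0 (ltr_wpDl n0 ltr01)).
exists (fun z => h z * f z) => //; have cgh := calgB om0 cg ch.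
rewrite beurling_normE // lte_fin in hgh.
rewrite (@eq_nrm _ om _ (fun z => (g z - h z) * f z)) => [|z]; last by rewrite mulrBl.
apply: le_trans (nrmM hom cgh hf) _; apply: le_trans (ler_wpM2r n0 (ltW hgh)) _.
by rewrite mulrAC ler_pdivrMr ?ltr_wpDl // ler_wpM2l ?lerDl // ltW.
Qed.

Lemma hull0_closed I z : closed_ideal om I ->
  (forall d : R, 0 < d -> exists2 w, hull 0 I w & cmod (set_val z - set_val w) < d) -> hull 0 I z.
Proof.
move=> hI h; apply/hull0P => g Ig; apply/eqP; rewrite -cmod_eq0 eq_le cmod_ge0 andbT.
apply/ler_addgt0Pr => e e0; rewrite add0r.
have [d d0 hd] := calg_ccont (ideal_calg hI Ig) e0.
have [w /hull0P hw zw] := h d d0.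
by have := hd z w zw; rewrite (hw g Ig) subr0 => /ltW.
Qed.

Lemma nrm_seminorm_axioms : seminorm_axioms (balg_cst om) (fun x : balg om => nrm om x).
Proof.
split=> [x y|x y|c x|].
- exact: nrmD om0 (balg_calg x) (balg_calg y).
- exact: nrmM (nweightP om) (balg_calg x) (balg_calg y).
- exact: nrmZ_le c (balg_calg x).
by have := nrm_cst_le om 1; rewrite cmod1.
Qed.

End Ideals.

Section LocalIdeals.
Context {R : realType} (om : nweight (R := R)) (s : R).
Hypotheses (s0 : 0 <= s) (om_nat : forall n : nat, om n%:Z = (1 + n%:R) `^ s)
  (om_ge : forall n, (1 + (absz n)%:R) `^ s <= om n)
  (om_neg : forall k l : nat, (k <= l)%N -> om (- k%:Z) <= om (- l%:Z)).
Implicit Types (z w : circle R) (f g h : circle R -> R[i]) (I : set (circle R -> R[i])).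

Let om0 n : 0 <= om n. Proof. exact: nweight_ge0. Qed.
Let m := Num.truncn s.

Lemma truncn_le_s : m%:R <= s. Proof. by rewrite truncn_le. Qed.

Lemma polyw_le_om j n : (j <= m)%N -> polyw j n <= om n.
Proof.
move=> jm; apply: le_trans (om_ge n); rewrite /polyw -powR_mulrn ?addr_ge0 //.
rewrite ler_powR ?lerDl //; apply: le_trans truncn_le_s; by rewrite ler_nat.
Qed.

Lemma coef_bound_polyw j f M : (j <= m)%N -> coef_bound om f M -> coef_bound (polyw j) f M.
Proof.
move=> jm h t ut; apply: le_trans (h t ut); apply: ler_sum => n _.
by rewrite ler_wpM2l ?cmod_ge0 // polyw_le_om.
Qed.

Lemma calg_polyw j f : (j <= m)%N -> calg om f -> calg (polyw j) f.
Proof. by move=> jm [cf [M hM]]; apply: calg_bound (coef_bound_polyw jm hM). Qed.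

Lemma calg_val_sub (c : R[i]) f : calg om f -> calg om (fun z => (set_val z - c) * f z).
Proof.
move=> hf; apply: calgM => //; first exact: nweightP.
apply: calgB => //; last exact: calg_cst.
by apply: eq_calg (calg_char (om0 1)) => z; rewrite expr1z.
Qed.

(* Take [h = (z - z0) ^ r g]. *)
Lemma ideal_shift_order I z0 g j r : closed_ideal om I -> I g -> (j + r <= m)%N ->
  (forall l, (l < j)%N -> circle_deriven l g z0 = 0) -> circle_deriven j g z0 != 0 ->
  exists h, [/\ I h, forall l, (l < j + r)%N -> circle_deriven l h z0 = 0 &
    circle_deriven (j + r) h z0 != 0].
Proof.
move=> hI Ig; elim: r => [|r ih] jr hl hj; first by rewrite addn0; exists g.
have [h [Ih h1 h2]] := ih (ltac:(lia)) hl hj.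
have ch := ideal_calg hI Ih.
exists (fun z => (set_val z - set_val z0) * h z); split.
- have cv := calg_val_sub (set_val z0) (calg1 om).
  have := calg_idealM hI cv Ih; congr I; apply/funext => z; by rewrite mulr1.
- case=> [|l] hl'; first by rewrite /circle_deriven /= subrr mul0r.
  rewrite circle_derivenX_sub; last by apply: calg_polyw ch; lia.
  by rewrite subrr mul0r add0r h1 ?mulr0 //; lia.
rewrite addnS circle_derivenX_sub; last by apply: calg_polyw ch; lia.
by rewrite subrr mul0r add0r mulf_neq0 // pnatr_eq0.
Qed.

(** The derivatives are matched one order at a time. If [z0] is in [hull i I], those of order [i] of
    [f] and [h] both vanish. Otherwise some element of [I] has a nonzero derivative of order at most
    [i]; taken of least order and shifted, it gives an element vanishing to order exactly [i], a
    multiple of which corrects [h]. *)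
Lemma ideal_jet I z0 f : closed_ideal om I -> calg om f ->
  (forall j, (j <= m)%N -> hull j I z0 -> circle_deriven j f z0 = 0) ->
  exists2 h, I h & forall j, (j <= m)%N -> circle_deriven j (fun z => f z - h z) z0 = 0.
Proof.
move=> hI hf hull0.
suff H i : (i <= m.+1)%N -> exists2 h, I h &
    forall j, (j < i)%N -> circle_deriven j (fun z => f z - h z) z0 = 0.
  by have [h Ih hh] := H m.+1 (leqnn _); exists h.
elim: i => [|i ih] im; first by exists (fun=> 0) => //; exact: closed_ideal0 hI.
have [h Ih hh] := ih (ltnW im); have ch := ideal_calg hI Ih.
have dB j g k : (j <= m)%N -> calg om g -> calg om k ->
    circle_deriven j (fun z => g z - k z) z0 = circle_deriven j g z0 - circle_deriven j k z0.
  by move=> jm cg ck; rewrite circle_derivenB //; exact: calg_polyw.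
have [hz|/existsNP[g /not_implyP[Ig /existsNP[j0 /not_implyP[j0i /eqP j0n]]]]] := pselect (hull i I z0).
  exists h => // j; rewrite ltnS leq_eqVlt => /orP[/eqP ->|]; last exact: hh.
  by rewrite dB // hull0 // (hz h Ih i) // subrr.
pose Q j := circle_deriven j g z0 != 0.
have [j Qj jmin] := ex_minnP (ex_intro Q j0 j0n).
have ji : (j <= i)%N by apply: leq_trans (jmin _ j0n) j0i.
have [||k [Ik k1 k2]] := @ideal_shift_order I z0 g j (i - j) hI Ig _ _ Qj.
- by rewrite subnKC.
- move=> l lj; apply/eqP; apply: contraTT lj => /jmin; by rewrite -leqNgt.
rewrite subnKC // in k1 k2; have ck := ideal_calg hI Ik.
pose c := circle_deriven i (fun z => f z - h z) z0 / circle_deriven i k z0.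
have hk : I (fun z => h z + c * k z) by apply: (closed_idealD hI) => //; exact: (idealZ hI c Ik).
exists (fun z => h z + c * k z) => // l li.
have -> : (fun z => f z - (h z + c * k z)) = (fun z => (f z - h z) - c * k z).
  by apply/funext => z; rewrite opprD addrA.
have lm : (l <= m)%N by lia.
rewrite (dB l _ _ lm (calgB om0 hf ch) (calgZ c ck)).
rewrite circle_derivenZ; last exact: calg_polyw.
move: li; rewrite ltnS leq_eqVlt => /orP[/eqP ->|li]; last by rewrite hh // k1 // mulr0 subrr.
by rewrite /c divfK // subrr.
Qed.

Lemma circle_deriven_char j n : circle_deriven j (fun z : circle R => set_val z ^ n) =
  fun z => (\prod_(i < j) (n%:~R - i%:R)) * set_val z ^ (n - j%:Z).
Proof.
elim: j => [|j ih].
  by apply/funext => z; rewrite big_ord0 mul1r subr0.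
rewrite /circle_deriven /= -/(circle_deriven j _) ih circle_deriveZ; last first.
  by apply: calg_char; exact: polyw_ge0.
rewrite circle_derive_char; apply/funext => z; rewrite big_ord_recr /= -mulrA.
rewrite rmorphB /=; congr (_ * (_ * _ ^ _)); lia.
Qed.

Lemma circle_deriven_partial j t f z : circle_deriven j (partial t f) z =
  \sum_(n <- t) fourier_coef f n * circle_deriven j (fun z => set_val z ^ n) z.
Proof.
have cC n : calg (polyw j) (fun z : circle R => set_val z ^ n) by apply: calg_char; exact: polyw_ge0.
elim: t => [|n t ih].
  rewrite big_nil (_ : partial [::] f = fun z => 0 * set_val z ^ 0).
    by rewrite circle_derivenZ // mul0r.
  by apply/funext => x; rewrite /partial big_nil mul0r.
rewrite big_cons -ih (_ : partial (n :: t) f = fun z => fourier_coef f n * set_val z ^ n + partial t f z).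
  rewrite circle_derivenD ?circle_derivenZ //; first exact: calgZ.
  by apply: calg_partial; exact: polyw_ge0.
by apply/funext => x; rewrite /partial big_cons.
Qed.

Section AtPoint.
Variable z0 : circle R.
Let u0 (n : int) : R[i] := set_val z0 ^ n.
Let E n : balg om := balg_cst om (u0 (- n)) * balg_char om n.
Let c f n : R[i] := fourier_coef f n * u0 n.

(** Relates derivatives at [z0] to the coefficients of the expansion in powers of [z / z0 - 1],
    which are those subtracted in [taylor_rem]. *)
Lemma deriven_char_binpoly j n : circle_deriven j (fun z : circle R => set_val z ^ n) z0 =
  j`!%:R * u0 (- j%:Z) * (u0 n * (binpoly j).[n%:~R]).
Proof.
rewrite circle_deriven_char binpolyE /u0 expfzDr ?circle_neq0 //.
by field; exact: fact_unit.
Qed.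

(** When the [j]-th derivative of [f] vanishes at [z0], the [j]-th Taylor coefficient of a partial
    sum is that of minus the tail, hence controlled by the norm of the tail. *)
Lemma jet_coef_bound j : (j <= m)%N -> exists2 C, 0 <= C & forall f t (d : R),
  calg om f -> circle_deriven j f z0 = 0 -> coef_bound om (fun z => f z - partial t f z) d ->
  cmod (\sum_(n <- t) c f n * (binpoly j).[n%:~R]) <= C * d.
Proof.
move=> jm; have [C C0 hC] := cmod_deriven_le (R := R) j; exists C => // f t d hf df hd.
have cp := calg_partial t f om0; have cfp := calgB om0 hf cp.
have E1 : circle_deriven j (partial t f) z0 =
    j`!%:R * u0 (- j%:Z) * (\sum_(n <- t) c f n * (binpoly j).[n%:~R]).
  rewrite circle_deriven_partial mulr_sumr; apply: eq_bigr => n _.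
  by rewrite deriven_char_binpoly /c; ring.
have E2 : cmod (circle_deriven j (fun z => f z - partial t f z) z0) <= C * d.
  apply: le_trans (hC _ z0 (calg_polyw jm cfp)) _; rewrite ler_wpM2l //.
  by apply: nrm_le; exact: coef_bound_polyw.
rewrite circle_derivenB ?df ?sub0r ?cmodN ?E1 in E2; try exact: calg_polyw.
apply: le_trans E2; rewrite !cmodM cmod_nat cmod_charz mulr1 ler_peMl ?cmod_ge0 //.
by rewrite ler1n fact_gt0.
Qed.

Lemma calg_local_approx f : calg om f ->
  (forall j, (j <= m)%N -> circle_deriven j f z0 = 0) ->
  forall e : R, 0 < e -> exists x : balg om,
    nrm om (fun z => f z - (set_val z / set_val z0 - 1) ^+ m.+1 * x z * f z) <= e.
Proof.
move=> hf df e e0; have [F hF] := balg_of hf.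
have hp := nrm_seminorm_axioms om.
have E0 : E 0 = 1.
  by rewrite /E balg_char0 mulr1 /u0 oppr0 expr0z (rmorph1 (balg_cst om)).
have ED k n : E (k + n) = E k * E n.
  rewrite /E (rmorph_mulACA (balg_cst om)) balg_charM.
  by rewrite /u0 -expfzDr ?circle_neq0 // opprD.
have pE n : nrm om (E n) <= om n.
  apply: le_trans (seminormZ_le hp _ _) _; rewrite cmod_charz mul1r.
  by apply: nrm_char.
have cmc n : cmod (c f n) = cmod (fourier_coef f n) by rewrite cmodM cmod_charz mulr1.
have sm : s < m.+1%:R by exact: truncnS_gt.
pose T n := taylor_rem (balg_cst om) E n m.+1.
pose u := E 1.
have [B hB] : exists B : nat -> R, forall j, (j <= m)%N -> 0 <= B j /\ forall t (d : R),
    coef_bound om (fun z => f z - partial t f z) d ->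
    cmod (\sum_(n <- t) c f n * (binpoly j).[n%:~R]) <= B j * d.
  have hh j : exists b : R, (j <= m)%N -> 0 <= b /\ forall t (d : R),
    coef_bound om (fun z => f z - partial t f z) d ->
    cmod (\sum_(n <- t) c f n * (binpoly j).[n%:~R]) <= b * d.
    have [jm|] := boolP (j <= m)%N; last by exists 0.
    by have [b b0 hb] := jet_coef_bound jm; exists b => _; split => // t d; apply: hb (df j jm).
  by have [B hB] := choice hh; exists B.
(* The term 1 accounts for the tail of [f], the sum for the Taylor polynomial of its partial sum,
   both in units of the norm of the tail. *)
pose D := 1 + \sum_(j < m.+1) B j * nrm om ((u - 1) ^+ j).
have D1 : 1 <= D.
  rewrite lerDl; apply: sumr_ge0 => j _; rewrite mulr_ge0 ?nrm_ge0 //.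
  by have [] := hB j (ltn_ord j).
have D0 : 0 < D by apply: lt_le_trans D1.
have [] := @local_approx_identity R _ (balg_cst om) (fun x => nrm om x) hp E E0 ED om s m s0
    truncn_le_s sm pE om_nat om_ge om_neg F (c f) _ _ e e0.
- move=> d d0; have [t ut ht] := partial_approx om0 hf d0; exists t => // t' ut' tt'.
  apply: le_trans (ht t' ut'); rewrite big_seq [X in _ <= X]big_seq; apply: ler_sum => n nt.
  rewrite fourier_coefB; [|exact: calg_ccont hf|exact: ccont_partial].
  by rewrite fourier_coef_partial // (negPf (tt' n nt)) subr0 cmc.
- move=> t d ut d0; have [t0 ut0 ht0] := partial_approx om0 hf (divr_gt0 d0 D0).
  exists [seq n <- t0 | n \notin t]; split; first exact: filter_uniq.
    by move=> n; rewrite mem_filter => /andP[].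
  set r := t ++ _.
  have ur : uniq r.
    rewrite cat_uniq ut filter_uniq // andbT; apply/hasPn => n.
    by rewrite mem_filter => /andP[].
  have hr : coef_bound om (fun z => f z - partial r f z) (d / D).
    move=> v uv; apply: le_trans (ht0 v uv); apply: ler_sum => n _; rewrite ler_wpM2r //.
    have cf := calg_ccont hf.
    rewrite !fourier_coefB //; try exact: ccont_partial.
    rewrite !fourier_coef_partial // mem_cat mem_filter.
    by case: (n \in t) => /=; rewrite ?subrr ?cmod0 ?cmod_ge0 ?lexx.
  pose beta j := \sum_(n <- r) c f n * (binpoly j).[n%:~R].
  have [P hP] := balg_of (calg_partial r f om0).
  (* The combination of Taylor remainders is the partial sum of [f] minus its own Taylor polynomial
     of degree [m] at [z0]. *)
  have EP : \sum_(n <- r) balg_cst om (c f n) * T n =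
      P - \sum_(j < m.+1) balg_cst om (beta j) * (u - 1) ^+ j.
    have -> : P = \sum_(n <- r) balg_cst om (c f n) * E n.
      apply: balg_inj => z; rewrite hP /partial.
      elim: (r) => [|n v ih]; first by rewrite !big_nil balg0.
      rewrite !big_cons balgD ih !balgM /= /c /u0; congr (_ + _).
      by rewrite mulrA -[fourier_coef f n * _ * _]mulrA -expfzDr ?circle_neq0 // subrr expr0z mulr1.
    under eq_bigr do rewrite mulrBr.
    rewrite sumrB; congr (_ - _).
    under eq_bigr do rewrite mulr_sumr.
    rewrite exchange_big /=; apply: eq_bigr => j _.
    rewrite (rmorph_sum (balg_cst om)) mulr_suml; apply: eq_bigr => n _.
    by rewrite mulrA -(rmorphM (balg_cst om)).
  rewrite -/T EP opprB addrA addrAC.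
  apply: le_trans (seminormD hp _ _) _.
  apply: le_trans (lerD (y := d / D) (t := (\sum_(j < m.+1) B j * nrm om ((u - 1) ^+ j)) * (d / D)) _ _) _.
  + by apply: nrm_le; move: hr; congr coef_bound; apply/funext => z; rewrite balgD balgN hF hP.
  + apply: le_trans (seminorm_sum hp _ _ _) _; rewrite mulr_suml; apply: ler_sum => j _.
    apply: le_trans (seminormZ_le hp _ _) _; rewrite mulrAC ler_wpM2r ?nrm_ge0 //.
    by have [_ hb] := hB j (ltn_ord j); apply: hb.
  by rewrite -[X in X + _]mul1r -mulrDl -/D mulrC divfK // gt_eqF.
move=> x hx; exists x; apply: le_trans hx.
rewrite le_eqVlt; apply/orP; left; apply/eqP; apply: eq_nrm => z.
rewrite balgD balgN !balgM balgX balgD balgN balgM balg1 hF /= /u0 expr1z exprN1.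
by rewrite [_^-1 * _]mulrC.
Qed.

End AtPoint.

Hypothesis hsub : subexp_weight om.

Theorem closed_ideal_synthesis I f : closed_ideal om I -> countable (hull 0 I) ->
  calg om f -> (forall j z, (j <= m)%N -> hull j I z -> circle_deriven j f z = 0) -> I f.
Proof.
move=> hI ctI hf fvanish; have sm : s < m.+1%:R by exact: truncnS_gt.
pose K := colon om I f; have hK : closed_ideal om K by exact: closed_ideal_colon.
have IK : I `<=` K.
  move=> g Ig; have cg := ideal_calg hI Ig; split; first exact/calgP.
  have := calg_idealM hI hf Ig; congr I; apply/funext => z; by rewrite mulrC.
have [hull0K|hne] := pselect (forall z, ~ hull 0 K z).
  have [_] := ideal_hull_empty hsub hK hull0K; congr I; apply/funext => z; by rewrite mul1r.
have KI : hull 0 K `<=` hull 0 I.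
  by move=> z /hull0P hz; apply/hull0P => g /IK; exact: hz.
have [|||z0 Kz0 [r r0 hr]] := @countable_closed_isolated R (hull 0 K).
- by apply: contrapT => h; apply: hne => z Kz; apply: h; exists z.
- by apply: sub_countable ctI; exact: subset_card_le.
- by move=> z; exact: (hull0_closed hK).
have r2 : 0 < r / 2 by rewrite divr_gt0.
have hom := nweightP om.
have [phi [cphi phi0 phisupp]] := calg_bump z0 hom hsub r2.
have hK' := closed_ideal_colon hK cphi.
have hullK' z : hull 0 (colon om K phi) z -> z = z0.
  move=> /hull0P hz; apply: contrapT => zz0.
  have [Kz|/hull0N[g Kg gz]] := pselect (hull 0 K z).
    have rz : r <= cmod (set_val z - set_val z0).
      by rewrite leNgt; apply/negP => h; apply: zz0; exact: hr.
    (* The supports of [psi] and [phi], of radius [r / 2] around points at distance at least [r],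
       are disjoint; [psi] thus belongs to the ideal without vanishing at [z]. *)
    have [psi [cpsi psiz psisupp]] := calg_bump z hom hsub r2.
    move: psiz; rewrite hz ?eqxx //; split; first exact/calgP.
    have -> : (fun z => psi z * phi z) = (fun=> 0); last exact: closed_ideal0 hK.
    apply/funext => w; have [h|h] := leP (r / 2) (cmod (set_val w - set_val z)).
      by rewrite psisupp // mul0r.
    rewrite phisupp ?mulr0 //.
    have := cmodB (set_val w - set_val z0) (set_val w - set_val z).
    have -> : set_val w - set_val z0 - (set_val w - set_val z) = set_val z - set_val z0 by ring.
    lra.
  move: gz; rewrite hz ?eqxx //; split; first exact/calgP/(ideal_calg hK Kg).
  have := calg_idealM hK cphi Kg; congr K; apply/funext => w; by rewrite mulrC.
have [cq [_ hq]] := ideal_hull_sub1 hsub hK' s0 sm om_nat hullK'.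
move/calgP: cq => cq.
have [h Ih hh] := ideal_jet hI hf (fun j jm => fvanish j z0 jm).
have ch := ideal_calg hI Ih; have cd := calgB om0 hf ch.
suff phid : I (fun z => phi z * (f z - h z)).
  have Kphi : K phi.
    split; first exact/calgP.
    have := closed_idealD hI phid (calg_idealM hI cphi Ih); congr I; apply/funext => z; by ring.
  by move: phi0; rewrite (proj1 (hull0P _ _) Kz0 _ Kphi) eqxx.
apply: (closed_ideal_approx hI); first exact: calgM.
move=> e e0; have n0 := nrm_ge0 om phi.
have [x hx] := calg_local_approx cd hh (divr_gt0 e0 (ltr_wpDl n0 ltr01)).
pose q z : R[i] := (set_val z / set_val z0 - 1) ^+ m.+1.
have cx := balg_calg x.
have cqx : calg om (fun z => q z * x z * (f z - h z)).
  exact: (calgM hom (calgM hom cq cx) cd).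
exists (fun z => phi z * (q z * x z * (f z - h z))).
  (* The multiple [q x phi (f - h)] is in [I] term by term: for [f] because [q phi] is in [K], for
     [h] because [h] is in [I]. *)
  have i1 := calg_idealM hI cx hq.
  have i2 := calg_idealM hI (calgM hom (calgM hom cx cq) cphi) Ih.
  have := idealB hI i1 i2; congr I; apply/funext => z.
  by rewrite /q; ring.
rewrite (@eq_nrm _ om _ (fun z => phi z * (f z - h z - q z * x z * (f z - h z)))); last first.
  by move=> z; rewrite [RHS]mulrBr.
apply: le_trans (nrmM hom cphi (calgB om0 cd cqx)) _.
apply: le_trans (ler_wpM2l n0 hx) _.
by rewrite mulrCA ler_piMr ?(ltW e0) // ler_pdivrMr ?ltr_wpDl // mul1r lerDl.
Qed.

End LocalIdeals.

Theorem mainTheorem1 (R : realType) (s : R) (omega : int -> R)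
    (I : set (circle R -> R[i])) :
  0 <= s ->
  weight omega ->
  (forall n : nat, omega n%:Z = (1 + n%:R) `^ s) ->
  nondecreasing_seq (fun n : nat => omega (- n%:Z) / (1 + n%:R) `^ s) ->
  (forall e : R, 0 < e ->
    (fun n : nat => omega (- n%:Z)) =O_\oo
      (fun n : nat => expR (e * Num.sqrt n%:R))) ->
  closed_ideal omega I ->
  countable (hull 0 I) ->
  I = [set f | beurling_algebra omega f /\
         forall j, (j <= Num.truncn s)%N ->
           forall z, hull j I z -> circle_deriven j f z = 0].
Proof.
move=> s0 hom om_nat hmono hO hI ctI; have [om1 _] := hom.
have omz : omega 0 = 1 by rewrite (om_nat 0%N) addr0 powR1.
pose om := NWeight hom omz.
have pw (k : nat) : 0 < (1 + k%:R) `^ s :> R by rewrite powR_gt0 // ltr_wpDr.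
(* The nondecreasing quotient equals 1 at 0. *)
have om_neg_ge (k : nat) : (1 + k%:R) `^ s <= omega (- k%:Z).
  have := hmono 0%N k (leq0n k); rewrite oppr0 omz addr0 powR1 divr1.
  by rewrite ler_pdivlMr // mul1r.
have om_ge n : (1 + (absz n)%:R) `^ s <= om n.
  by case: n => k /=; [rewrite om_nat | rewrite NegzE om_neg_ge].
have om_neg (k l : nat) : (k <= l)%N -> om (- k%:Z) <= om (- l%:Z).
  move=> kl; have := hmono k l kl; rewrite ler_pdivrMr // => /le_trans; apply.
  rewrite mulrAC ler_pdivrMr // ler_wpM2l ?(le_trans _ (om1 _)) //.
  by rewrite ge0_ler_powR ?nnegrE ?addr_ge0 // lerD2l ler_nat.
have hsub : subexp_weight om.
  move=> e e0; have /eqO_exP[k k0 [N _ hN]] := hO e e0.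
  (* [S] takes care of the finitely many indices below which the asymptotic bound says nothing. *)
  pose S := \sum_(n < N) omega (- n%:Z).
  have o0 n : 0 <= omega n by apply: le_trans (om1 n).
  have S0 : 0 <= S by exact: sumr_ge0.
  have hn (n : nat) : omega (- n%:Z) <= (k + S) * expR (e * Num.sqrt n%:R).
    have e1 : 1 <= expR (e * Num.sqrt n%:R).
      by rewrite -expR0 ler_expR mulr_ge0 ?sqrtr_ge0 // ltW.
    have [nN|Nn] := ltnP n N.
      apply: le_trans (_ : S * 1 <= _); last by apply: ler_pM; rewrite ?lerDr // ltW.
      by rewrite mulr1 /S (bigD1 (Ordinal nN)) //= lerDl sumr_ge0.
    have := hN n Nn; rewrite /= ger0_norm // ger0_norm ?expR_ge0 // => /le_trans; apply.
    by rewrite ler_wpM2r ?expR_ge0 // lerDl.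
  exists (k + S) => [|n]; first by rewrite addr_ge0 // ltW.
  apply: le_trans (hn (absz n)).
  by case: n => n /=; [rewrite om_nat om_neg_ge | rewrite NegzE].
apply/seteqP; split=> f.
  move=> If; split; first exact: (closed_ideal_sub hI).
  by move=> j _ z hz; exact: (hz f If j (leqnn j)).
move=> [/(calgP om) hf fvanish].
apply: (@closed_ideal_synthesis R om s s0 om_nat om_ge om_neg hsub I f hI ctI hf).
by move=> j z jm; exact: fvanish.
Qed.
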